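(* Let $d\ge1$, let $\ell\in(0,\infty]^d$ satisfy $l_1\le\dots\le l_d$, and let $g$ be elliptic over $Q^\ell$ with parameters $N\ge2$ and $0<\varepsilon_0<1$. Let $(p,q)\in[1,\infty]^2$. (a) If $(p,q)$ lies outside of the region $\{q\ge\frac{d+2}dp',\ q>\frac{2(d+1)}d\}$, then $\mathcal E^\ell_g$ does not extend as a bounded linear operator from $L^p$ to $L^q$. (b) If $l_k=\infty$ for some $1\le k\le d$, then $\mathcal E^\ell_g$ does not extend as a bounded operator from $L^p$ to $L^q$ for any $p\ge q$, nor for any $q>\frac{d-k+3}{d-k+1}p'$. (c) If $q>p$ and $q=\frac{d-j-\theta+2}{d-j-\theta}p'$ for some integer $0\le j<d$ and $0\le\theta\le1$, then $$\|\mathcal E^\ell_g\|_{L^p\to L^q}\gtrsim(l_1\cdots l_jl_{j+1}^\theta)^{\frac1{p'}-\frac1q}.$$ (d) If $l_d<\infty$ and $q=\frac{2(d-j-\theta+1)}{d-j-\theta}\le p$ with $0<\theta\le1$ and $j\in\{0,\dots,d-2\}$, then $$\|\mathcal E^\ell_g\|_{L^p\to L^q}\gtrsim(l_1\cdots l_d)^{\frac1q-\frac1p}\,\alpha\bigl(\tfrac{l_d}{l_{j+1}}\bigr)\,(l_1\cdots l_jl_{j+1}^\theta)^{1-\frac2q},$$ where $\alpha:[1,\infty)\to(0,\infty)$ is a function depending only on $d,p,q$ such that $\alpha\gtrsim1$ and $\alpha(r)\to\infty$ as $r\to\infty$. (e) If $l_d<\infty$, $q>4$ and $p\ge(\frac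 q3)'$, then $$\|\mathcal E^\ell_g\|_{L^p\to L^q}\gtrsim(l_1\cdots l_{d-1})^{\frac1{p'}-\frac1q}\,l_d^{1-\frac3q-\frac1p}.$$ The implicit constants depend only on $d,p,q$ (not on $\ell$ or $g$).
   Context: For $\ell=(l_1,\dots,l_d)\in(0,\infty]^d$ let $Q^\ell:=\prod_{j=1}^d(-l_j,l_j)$; let $\mathbf 1=(1,\dots,1)$, and for $\ell\in(0,\infty)^d$ let $A^\ell(\xi_1,\dots,\xi_d):=(l_1\xi_1,\dots,l_d\xi_d)$. $p'$ denotes the dual exponent of $p$. Ellipticity. Let $N\in\{0,1,2,\dots\}\cup\{\infty\}$, $0<\varepsilon_0\le\frac12$ and $\ell\in(0,\infty]^d$. A real-valued $g\in C^{N+2}_{\mathrm{loc}}(Q^\ell)$ is elliptic over $Q^\ell$ with parameters $N,\varepsilon_0$ if $D^2g$ is positive definite throughout $Q^\ell$ and $g(\xi)=|\xi|^2+h(\xi)$, where $h(0)=0$, $\nabla h(0)=0$, $D^2h(0)=0$, and $\|(D^2h)\circ A^{\tilde\ell}\|_{C^N(Q^{\mathbf 1})}<\varepsilon_0$ for every $\tilde\ell\in(0,\infty)^d$ with $Q^{\tilde\ell}\subseteq Q^\ell$. Here the $C^N$ norm of a matrix-valued function is the supremum over multiindices $|\alpha|\le N$ of the sup norms (with matrix operator norm) of its $\partial^\alpha$ derivatives. Extension operator. $\mathcal E^\ell_g f(t,x):=\int_{Q^\ell}e^{i(tg(\xi)+x\cdot\xi)}f(\xi)\,d\xi$, $(t,x)\in\mathbb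 R^{1+d}$. The norm $\|\mathcal E^\ell_g\|_{L^p\to L^q}\in[0,\infty]$ is the best constant in $\|\mathcal E^\ell_gf\|_{L^q(\mathbb R^{1+d})}\le C\|f\|_{L^p(Q^\ell)}$ over $f\in L^1\cap L^p(Q^\ell)$. Conventions: a relation $q=\frac{s+2}{s}p'$ is read as $\frac{s}{p'}=\frac{s+2}{q}$ (so $s=0$ means $q=\infty$), and $\infty^0=1$. *)

(* Defs.v *)
From HB Require Import structures.
From mathcomp Require Import all_boot all_order all_algebra.
From mathcomp Require Import complex.
From mathcomp Require Import all_classical all_reals all_analysis.
Set Implicit Arguments.
Unset Strict Implicit.
Unset Printing Implicit Defensive.
Import Order.TTheory GRing.Theory Num.Theory.
Import numFieldNormedType.Exports.
Local Open Scope classical_set_scope.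
Local Open Scope ring_scope.

Section measurable_row.
Context {R : realType} (n : nat).

(* The sigma-algebra on row vectors is generated by the coordinates. *)
Definition coord (i : 'I_n) (v : 'rV[R]_n) : measurableTypeR R := v 0 i.

Let row_set0 : g_sigma_preimage coord set0.
Proof. exact: sigma_algebra0. Qed.

Let row_setC A : g_sigma_preimage coord A -> g_sigma_preimage coord (~` A).
Proof. exact: sigma_algebraC. Qed.

Let row_bigcup (F : _^nat) : (forall i, g_sigma_preimage coord (F i)) ->
  g_sigma_preimage coord (\bigcup_i (F i)).
Proof. exact: sigma_algebra_bigcup. Qed.

HB.instance Definition _ := @isMeasurable.Build default_measure_display
  'rV[R]_n (g_sigma_preimage coord) row_set0 row_setC row_bigcup.

Lemma measurable_coord (i : 'I_n) : measurable_fun [set: 'rV[R]_n] (coord i).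
Proof.
move=> _ Y mY; rewrite setTI; apply: sub_sigma_algebra.
by rewrite (bigD1 i)//=; left; exists Y => //; rewrite setTI.
Qed.

Lemma measurable_fun_row d (T : measurableType d) (f : T -> 'rV[R]_n) :
  (forall i, measurable_fun [set: T] (coord i \o f)) ->
  measurable_fun [set: T] f.
Proof.
move=> mf; apply: measurability => // _ [B + <-].
elim/big_ind : _ => //= [U V HU HV [/HU|/HV]//|i _ [A mA <-]].
by rewrite setTI -comp_preimage; exact: mf.
Qed.

End measurable_row.

Section lebesgue_row.
Context {R : realType}.

Definition row_cons n (z : 'rV[R]_n * measurableTypeR R) : 'rV[R]_n.+1 :=
  row_mx (const_mx z.2 : 'rV_1) z.1.

Lemma measurable_row_cons n : measurable_fun setT (@row_cons n).
Proof.
apply: measurable_fun_row => i; rewrite /coord /row_cons /comp.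
have [j ->|j ->] := @split_ordP 1 n i.
  apply: (eq_measurable_fun snd) => [z _|]; last exact: measurable_snd.
  by rewrite (row_mxEl (const_mx z.2 : 'rV_1)) mxE.
apply: (eq_measurable_fun (coord j \o fst)) => [z _|].
  by rewrite (row_mxEr (const_mx z.2 : 'rV_1)).
by apply: measurableT_comp (measurable_fst); exact: measurable_coord.
Qed.

Definition lebesgue_cons n (mu : {measure set 'rV[R]_n -> \bar R}) :
  set 'rV[R]_n.+1 -> \bar R :=
  pushforward (mu \x (@lebesgue_measure R))%E (@row_cons n).

Section lebesgue_cons_measure.
Variables (n : nat) (mu : {measure set 'rV[R]_n -> \bar R}).
Local Open Scope ereal_scope.

Let pushm : {measure set 'rV[R]_n.+1 -> \bar R} :=
  measure_function_pushforward__canonical__measure_function_Measure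
    (mu \x (@lebesgue_measure R)) (@measurable_row_cons n).

Let lebesgue_cons0 : lebesgue_cons mu set0 = 0.
Proof. exact: (measure0 pushm). Qed.

Let lebesgue_cons_ge0 A : 0 <= lebesgue_cons mu A.
Proof. exact: (measure_ge0 pushm). Qed.

Let lebesgue_cons_sigma_additive : semi_sigma_additive (lebesgue_cons mu).
Proof. exact: (@measure_semi_sigma_additive _ _ _ pushm). Qed.

HB.instance Definition _ := isMeasure.Build _ _ _ (lebesgue_cons mu)
  lebesgue_cons0 lebesgue_cons_ge0 lebesgue_cons_sigma_additive.

End lebesgue_cons_measure.

Fixpoint lebesgue_row n : {measure set 'rV[R]_n -> \bar R} :=
  match n with
  | 0 => @dirac _ _ (0%R : 'rV[R]_0) R
  | m.+1 => lebesgue_cons (lebesgue_row m)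
  end.

Lemma lebesgue_row_box n (A : 'I_n -> set (measurableTypeR R)) :
  (forall i, measurable (A i)) ->
  lebesgue_row n [set v | forall i, A i (coord i v)] =
  (\prod_(i < n) lebesgue_measure (A i))%E.
Proof.
elim: n A => [A _|n IH A mA] /=.
  by rewrite big_ord0 diracE mem_set// => -[].
have mB : measurable
    [set v : 'rV[R]_n | forall j, A (lift ord0 j) (coord j v)].
  have -> : [set v : 'rV[R]_n | forall j, A (lift ord0 j) (coord j v)] =
      \bigcap_(j in [set: 'I_n]) (coord j @^-1` A (lift ord0 j)).
    by apply/seteqP; split => v /= H j; [move=> _|]; exact: H.
  apply: fin_bigcap_measurable => // j _.
  by rewrite -[X in measurable X]setTI; exact: measurable_coord.
rewrite /lebesgue_cons /pushforward big_ord_recl muleC -IH; last by [].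
rewrite -product_measure1E//; congr (_ _).
apply/seteqP; split => -[v a] /=.
  move=> H; split.
    move=> j; have := H (lift ord0 j); rewrite /coord.
    rewrite (_ : lift ord0 j = rshift 1 j); last exact/val_inj.
    by rewrite /row_cons (row_mxEr (const_mx a : 'rV_1)).
  have := H ord0; rewrite /coord; congr (A ord0 _).
  have -> : ord0 = lshift n (ord0 : 'I_1) by exact/val_inj.
  by rewrite [LHS](row_mxEl (const_mx a : 'rV_1)) mxE.
move=> [H1 H2] i; rewrite /coord /row_cons.
have [j ej|j ej] := @split_ordP 1 n i.
  rewrite {2}ej (row_mxEl (const_mx a : 'rV_1)) mxE.
  suff -> : i = ord0 by [].
  by rewrite ej; apply/val_inj; rewrite /= ord1.
rewrite {2}ej (row_mxEr (const_mx a : 'rV_1)).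
suff -> : i = lift ord0 j by exact: H1.
by rewrite ej; exact/val_inj.
Qed.

End lebesgue_row.

Section calculus.
Context {R : realType} {d : nat}.
Implicit Types (x v : 'rV[R]_d) (U : set 'rV[R]_d) (s : seq 'I_d).

(* The library's norm on ['rV[R]_d] is the sup norm. *)
Definition enorm x : R := Num.sqrt (\sum_i x 0 i ^+ 2).

(* [partials [:: i1; ...; ik] f] is d_i1 (... (d_ik f)). *)
Definition partials {W : normedModType R} s (f : 'rV[R]_d -> W) :
  'rV[R]_d -> W := foldr (fun i h => 'D_(delta_mx 0 i) h) f s.

Definition multi_partial {W : normedModType R} (a : {ffun 'I_d -> nat}) :
  ('rV[R]_d -> W) -> 'rV[R]_d -> W :=
  partials (flatten [seq nseq (a i) i | i <- enum 'I_d]).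

Definition C_on (k : nat) U (f : 'rV[R]_d -> R) : Prop :=
  forall s,
    ((size s < k)%N -> forall i x, U x ->
       derivable (partials s f) x (delta_mx 0 i)) /\
    ((size s <= k)%N -> forall x, U x -> {for x, continuous (partials s f)}).

Definition grad (f : 'rV[R]_d -> R) x : 'rV[R]_d :=
  \row_i partials [:: i] f x.

Definition hessian (f : 'rV[R]_d -> R) x : 'M[R]_d :=
  \matrix_(i, j) partials [:: i; j] f x.

Definition posdef (A : 'M[R]_d) : Prop :=
  A^T = A /\ forall v, v != 0 -> 0 < (v *m A *m v^T) 0 0.

(* Operator norm of [A] for the Euclidean norm; the column vector [A v] is
   written as the row [v *m A^T]. *)
Definition mx_opnorm (A : 'M[R]_d) : \bar R :=
  ereal_sup [set (enorm (v *m A^T))%:E | v in [set v | enorm v <= 1]].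

End calculus.

Section elliptic.
Context {R : realType} {d : nat}.

Definition box (l : 'I_d -> \bar R) : set 'rV[R]_d :=
  [set x | forall i, (`|x 0 i|%:E < l i)%E].

Definition dilation (l : 'I_d -> R) (x : 'rV[R]_d) : 'rV[R]_d :=
  \row_i (l i * x 0 i).

(* [None] stands for the value infinity of the smoothness parameter. *)
Definition le_extnat (k : nat) (N : option nat) : bool :=
  if N is Some n then (k <= n)%N else true.

Definition CN_norm (N : option nat) (F : 'rV[R]_d -> 'M[R]_d) : \bar R :=
  ereal_sup
    [set ereal_sup
       [set mx_opnorm (multi_partial a F x) | x in box (fun=> 1%E)]
    | a in [set a : {ffun 'I_d -> nat} | le_extnat (\sum_i a i) N]].

Definition elliptic (N : option nat) (eps0 : R) (l : 'I_d -> \bar R)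
    (g : 'rV[R]_d -> R) : Prop :=
  let h := fun x => g x - enorm x ^+ 2 in
  (forall k, le_extnat k N -> C_on k.+2 (box l) g) /\
  (forall x, box l x -> posdef (hessian g x)) /\
  (h 0 = 0 /\ grad h 0 = 0 /\ hessian h 0 = 0) /\
  (forall l' : 'I_d -> R, (forall i, 0 < l' i) ->
     box (EFin \o l') `<=` box l ->
     (CN_norm N (hessian h \o dilation l') < eps0%:E)%E).

End elliptic.

Section complex_functions.
Context {R : realType} {n : nat}.
Implicit Types (D : set 'rV[R]_n) (f : 'rV[R]_n -> R[i]) (p : \bar R).

Definition cintegral D f : R[i] :=
  ((\int[lebesgue_row n]_(x in D) complex.Re (f x)) +i*
   (\int[lebesgue_row n]_(x in D) complex.Im (f x)))%C.

Definition Lp_norm D p f : \bar R :=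
  Lnorm (lebesgue_row n) p
    ((fun x => (ComplexField.Normc.normc (f x))%:E) \_ D).

Definition in_Lp D p f : Prop :=
  [/\ measurable_fun D (fun x => complex.Re (f x)),
      measurable_fun D (fun x => complex.Im (f x)) &
      (Lp_norm D p f < +oo)%E].

Definition ae_eq_fun f1 f2 : Prop :=
  \forall x \ae lebesgue_row n, f1 x = f2 x.

End complex_functions.

Section extension.
Context {R : realType} {d : nat}.
Variables (l : 'I_d -> \bar R) (g : 'rV[R]_d -> R).
Implicit Types (f : 'rV[R]_d -> R[i]) (p q : \bar R).

Definition expi (t : R) : R[i] := (cos t +i* sin t)%C.

(* A point of ['rV[R]_(1 + d)] is [(t, x)] with [t] its first coordinate.  Only
   the values of [f] and [g] on the box matter. *)
Definition extension f (tx : 'rV[R]_(1 + d)) : R[i] :=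
  let t := lsubmx tx 0 0 in
  let x := rsubmx tx in
  cintegral (box l)
    (fun xi => expi (t * g xi + \sum_i x 0 i * xi 0 i) * f xi).

(* The best constant, [+oo] when no finite constant works. *)
Definition extension_norm p q : \bar R :=
  ereal_inf [set C%:E | C in [set C : R | 0 <= C /\
    forall f, in_Lp (box l) 1%E f -> in_Lp (box l) p f ->
      (Lp_norm setT q (extension f) <= C%:E * Lp_norm (box l) p f)%E]].

(* Elements of L^p and L^q are represented by functions, so the extension [T] is
   linear, and agrees with the oscillatory integral, up to null sets. *)
Definition extends_bounded p q : Prop :=
  exists (T : ('rV[R]_d -> R[i]) -> 'rV[R]_(1 + d) -> R[i]) (C : R),
  [/\ forall f, in_Lp (box l) p f -> in_Lp setT q (T f),
      forall (a : R[i]) f1 f2, in_Lp (box l) p f1 -> in_Lp (box l) p f2 ->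
        ae_eq_fun (T (fun x => a * f1 x + f2 x))
                  (fun y => a * T f1 y + T f2 y),
      forall f, in_Lp (box l) p f ->
        (Lp_norm setT q (T f) <= C%:E * Lp_norm (box l) p f)%E &
      forall f, in_Lp (box l) 1%E f -> in_Lp (box l) p f ->
        ae_eq_fun (T f) (extension f)].

End extension.

Section exponents.
Context {R : realType}.

(* [1 / p], with [1 / +oo = 0] *)
Definition rcp (p : \bar R) : R := fine p^-1%E.

(* [q = (s + 2) / s * p'], read as [s / p' = (s + 2) / q]. *)
Definition scaling_line (s : R) (p q : \bar R) : Prop :=
  s * rcp (hoelder_conjugate p) = (s + 2) * rcp q.

End exponents.

Definition last_ord d (hd : (0 < d)%N) : 'I_d :=
  Ordinal (etrans (ltn_predL d) hd).

(* Main.v *)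
From HB Require Import structures.
From mathcomp Require Import all_boot all_order all_algebra.
From mathcomp Require Import complex.
From mathcomp Require Import all_classical all_reals all_analysis.
From mathcomp Require Import measurable_realfun ess_sup_inf ring lra.
Require Import Defs.
Set Implicit Arguments.
Unset Strict Implicit.
Unset Printing Implicit Defensive.
Import Order.TTheory GRing.Theory Num.Theory.
Import numFieldNormedType.Exports.
Local Open Scope classical_set_scope.
Local Open Scope ring_scope.

(** All lower bounds come from two kinds of test functions.

    Knapp examples: for the indicator of a box of half-sides [a i <= lam], the
    extension has size comparable to the volume of the box on the dual slab
    [|t| <= c / lam^2], [|x i| <= c / a i].  This gives (c), (e), and the parts
    of (a) and (b) below or above the scaling lines.

    Compressed wave packets: a box is tiled by pieces of side [min (a i) lam],
    grouped into blocks of [m^m] pieces that are consecutive in one direction.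
    Ellipticity makes the velocities [grad g] within a block an arithmetic
    progression up to [O(lam)], so the tubes of a block can be translated as in
    the construction of a Besicovitch set: fix one base-m digit of the position
    in the block at each of m times.  The union of the tubes then has measure
    [O(1/m)] times the sum of their measures.  With suitable signs the square
    integral of the sum of the packets over this union is at least the sum of
    the individual square integrals, and since the union is small the L^r norm
    gains a factor [m^(1/2 - 1/r)].  This gives (d), the endpoint in (a), and
    [p >= q] in (b). *)

(** * Mean value estimates and ellipticity *)

(** The constants must not depend on [g] or [ell], and the only quantitative information on [g] is
    the dilation-invariant bound on its Hessian. Differentiated along the axis [k] it yields a
    factor [1 / a k], so along the direction [e] the velocities deviate from linear growth by at
    most the squared block length over [a e]. This ties the number of pieces in a block to the room
    in that one direction, and is why [alpha] in (d) is a function of [l_d / l_{j+1}]. Infinite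
    sides are replaced by finite boxes inside [Q^ell], to which the same estimates apply.

    No decay of oscillatory integrals and no orthogonality of packets is used. Each packet is
    bounded below only where its phase is within 1/2 of a constant, and positivity of squares on the
    union of the tubes does the rest. The exponents below 2 in (a) need no further test functions:
    the extension of a packet is bounded by a multiple of the volume of the box, so lowering the
    exponent costs a factor independent of [m]. *)

Section axis_mean_value.
Context {R : realType} {d : nat}.
Implicit Types (F : 'rV[R]_d -> R) (x y : 'rV[R]_d) (A : 'I_d -> set R).

Notation e_ i := (delta_mx 0 i : 'rV[R]_d).

Lemma is_derive_line F x v (u : R) : derivable F (x + u *: v) v ->
  is_derive u 1 (fun s : R => F (x + s *: v)) ('D_v F (x + u *: v)).
Proof.
move=> dF.
have E : (fun h : R => h^-1 *: (((fun s : R => F (x + s *: v)) \o shift u) (h *: 1)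
      - F (x + u *: v))) =
    (fun h : R => h^-1 *: ((F \o shift (x + u *: v)) (h *: v) - F (x + u *: v))).
  apply/funext => h /=; congr (_ *: (F _ - _)).
  by rewrite [h *: 1]mulr1 scalerDl addrCA.
apply: DeriveDef; first by rewrite /derivable E.
by rewrite /derive E.
Qed.

(** The two conditions on [u] say that it lies between 0 and [s], for either sign of [s]. *)
Lemma line_mean_value F x v (s K : R) :
  (forall u, `|u| <= `|s| -> 0 <= u * s -> derivable F (x + u *: v) v) ->
  (forall u, `|u| <= `|s| -> 0 <= u * s -> `|'D_v F (x + u *: v)| <= K) ->
  `|F (x + s *: v) - F x| <= K * `|s|.
Proof.
move=> dF bF.
pose f (u : R) := F (x + u *: v).
have main a b : a <= b ->
    (forall u, a <= u <= b -> `|u| <= `|s| /\ 0 <= u * s) ->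
    `|f b - f a| <= K * (b - a).
  move=> ab H.
  have D u : a <= u <= b -> is_derive u 1 f ('D_v F (x + u *: v)).
    by move=> /H[h1 h2]; apply: is_derive_line; exact: dF.
  have [||c cab ->] := @MVT_segment R f (fun u => 'D_v F (x + u *: v)) a b ab.
  - by move=> u; rewrite in_itv/= => /andP[h1 h2]; apply: D; rewrite !ltW.
  - apply: derivable_within_continuous => u; rewrite in_itv/= => uab.
    by have [] := D u uab.
  rewrite normrM [`|b - a|]ger0_norm ?subr_ge0//.
  rewrite ler_wpM2r ?subr_ge0//; move: cab; rewrite in_itv/= => /H[h1 h2].
  exact: bF.
have f0 : f 0 = F x by rewrite /f scale0r addr0.
rewrite -f0 -/(f s); have [s0|s0] := leP 0 s.
  rewrite (ger0_norm s0) -[X in K * X]subr0; apply: main => // u /andP[u0 us].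
  by rewrite (ger0_norm u0) (ger0_norm s0) mulr_ge0.
rewrite (ltr0_norm s0) distrC -[- s]add0r; apply: main; first exact: ltW.
move=> u /andP[us u0]; rewrite (ler0_norm u0) (ltr0_norm s0) lerN2; split=> //.
by rewrite mulr_le0// ltW.
Qed.

Definition cell A : set 'rV[R]_d := [set x | forall i, A i (x 0 i)].

Lemma cell_axis A x y i (u : R) : (forall i, is_interval (A i)) ->
  cell A x -> cell A (x + (y 0 i - x 0 i) *: e_ i) ->
  `|u| <= `|y 0 i - x 0 i| -> 0 <= u * (y 0 i - x 0 i) ->
  cell A (x + u *: e_ i).
Proof.
move=> iA Ax Ay us us0 k; have := Ay k; have := Ax k.
rewrite !mxE eqxx/=; have [<-{k}|ki] := eqVneq i k; last first.
  by rewrite !mulr0 !addr0.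
rewrite !mulr1; set s := y 0 i - x 0 i in us us0 * => A1 A2.
have [s0|s0] := leP 0 s.
  apply: (iA i _ _ A1 A2).
  have u0 : 0 <= u.
    have [s00|sn0] := eqVneq s 0; first by move: us; rewrite s00 normr0 normr_le0 => /eqP->.
    by move: us0; rewrite pmulr_lge0// lt_def sn0.
  by rewrite lerDl u0 lerD2l (le_trans (ler_norm _))// (le_trans us)// ger0_norm.
have u0 : u <= 0 by move: us0; rewrite nmulr_lge0.
apply: (iA i _ _ A2 A1); rewrite lerD2l gerDl u0 andbT.
by move: us; rewrite (ler0_norm u0) (ltr0_norm s0) lerN2.
Qed.

Definition mixed_row x y (k : nat) : 'rV[R]_d :=
  \row_i (if (i < k)%N then y 0 i else x 0 i).

Lemma mixed_rowS x y (i : 'I_d) :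
  mixed_row x y i.+1 = mixed_row x y i + (y 0 i - x 0 i) *: e_ i.
Proof.
apply/rowP => k; rewrite !mxE ltnS leq_eqVlt eqxx/= -val_eqE/=.
by have [ki|ki] := eqVneq (k : nat) i; rewrite ?mulr0 ?addr0// (val_inj ki) ltnn mulr1 addrC subrK.
Qed.

(** Changing one coordinate at a time uses only derivatives along the axes, which is what [C_on]
    provides, and no total differentiability. The intermediate points stay in the cell because it is
    a product. *)
Lemma cell_mean_value A F (K : 'I_d -> R) x y : (forall i, is_interval (A i)) ->
  (forall i z, cell A z -> derivable F z (e_ i)) ->
  (forall i z, cell A z -> `|'D_(e_ i) F z| <= K i) ->
  cell A x -> cell A y ->
  `|F y - F x| <= \sum_i K i * `|y 0 i - x 0 i|.
Proof.
move=> iA dF bF Ax Ay.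
have Am k : cell A (mixed_row x y k) by move=> i; rewrite mxE; case: ifP.
have md : mixed_row x y d = y by apply/rowP => i; rewrite mxE ltn_ord.
have m0 : mixed_row x y 0 = x by apply/rowP => i; rewrite mxE.
have -> : F y - F x = \sum_(i < d) (F (mixed_row x y i.+1) - F (mixed_row x y i)).
  rewrite -(big_mkord xpredT (fun k => F (mixed_row x y k.+1) - F (mixed_row x y k))).
  by rewrite (telescope_sumr (fun k => F (mixed_row x y k)) (leq0n d)) md m0.
apply: (le_trans (ler_norm_sum _ _ _)); apply: ler_sum => i _.
rewrite mixed_rowS.
have Ai u : `|u| <= `|y 0 i - x 0 i| -> 0 <= u * (y 0 i - x 0 i) ->
    cell A (mixed_row x y i + u *: e_ i).
  have := @cell_axis A (mixed_row x y i) y i u iA (Am i).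
  by rewrite [mixed_row _ _ _ 0 i]mxE ltnn; apply; rewrite -mixed_rowS.
by apply: line_mean_value => u u1 u2; [apply: dF|apply: bF]; exact: Ai.
Qed.

End axis_mean_value.

Section elliptic_bounds.
Context {R : realType} {d : nat}.
Implicit Types (g : 'rV[R]_d -> R) (a : 'I_d -> R) (x : 'rV[R]_d).

Notation e_ i := (delta_mx 0 i : 'rV[R]_d).

(** Reduces directional derivatives to one real variable, where scaling the direction becomes the
    chain rule. *)
Lemma is_derive_line0P (F : 'rV[R]_d -> R) x v D :
  is_derive x v F D <-> is_derive (0 : R) 1 (fun s : R => F (x + s *: v)) D.
Proof.
have E : (fun h : R => h^-1 *: (((fun s : R => F (x + s *: v)) \o shift 0) (h *: 1)
      - F (x + 0 *: v))) =
    (fun h : R => h^-1 *: ((F \o shift x) (h *: v) - F x)).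
  apply/funext => h /=; rewrite scale0r !addr0; congr (_ *: (F _ - _)).
  by rewrite [h *: 1]mulr1 addrC.
split=> -[dF <-]; apply: DeriveDef.
- by rewrite /derivable E.
- by rewrite /derive E.
- by move: dF; rewrite /derivable E.
- by rewrite /derive E.
Qed.

Lemma is_derive_scale_dir (F : 'rV[R]_d -> R) x v (k D : R) :
  is_derive x v F D -> is_derive x (k *: v) F (k * D).
Proof.
move=> /is_derive_line0P dF; apply/is_derive_line0P.
have -> : (fun s : R => F (x + s *: (k *: v))) =
    (fun s : R => F (x + s *: v)) \o (fun s => k * s).
  by apply/funext => s /=; rewrite scalerA mulrC.
rewrite [X in is_derive _ _ _ X]mulrC; apply: is_derive1_comp.
  by rewrite mulr0.
by have := is_deriveZ k (@is_derive_id R R 0 1); rewrite [k *: 1]mulr1.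
Qed.

Lemma is_derive_coord x v (i : 'I_d) :
  is_derive x v (fun y : 'rV[R]_d => y 0 i) (v 0 i).
Proof.
apply/is_derive_line0P.
have := is_deriveD (@is_derive_cst R R R (x 0 i) 0 1)
  (is_deriveZ (v 0 i) (@is_derive_id R R 0 1)).
rewrite add0r [_ *: 1]mulr1 (_ : _ + _ = (fun s : R => (x + s *: v) 0 i))//.
by apply/funext => s; rewrite !mxE/= [LHS]/GRing.add/= mulrC.
Qed.

Lemma enorm_sqr x : enorm x ^+ 2 = \sum_i x 0 i ^+ 2.
Proof. by rewrite sqr_sqrtr// sumr_ge0// => i _; rewrite sqr_ge0. Qed.

Lemma is_derive_enorm_sqr x j :
  is_derive x (e_ j) (fun y : 'rV[R]_d => enorm y ^+ 2) (2 * x 0 j).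
Proof.
have -> : (fun y : 'rV[R]_d => enorm y ^+ 2) =
    \sum_(i < d) (fun y : 'rV[R]_d => y 0 i) ^+ 2.
  apply/funext => y; rewrite enorm_sqr fct_sumE; apply: eq_bigr => i _.
  by rewrite exprfctE.
apply: is_derive_eq.
  by apply: is_derive_sum => i; apply: is_deriveX; exact: is_derive_coord.
rewrite (bigD1 j)//= big1 ?addr0 => [|i ij].
  by rewrite !mxE !eqxx/= expr1 [_ *: _]mulr1 mulr_natl.
by rewrite !mxE eqxx/= (negbTE ij) scaler0.
Qed.

Lemma is_derive_linear_coord (x : 'rV[R]_d) i j :
  is_derive x (e_ i) (fun y : 'rV[R]_d => 2 * y 0 j) (2 * (j == i)%:R).
Proof.
have := is_deriveZ (2 : R) (is_derive_coord x (e_ i) j).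
by rewrite !mxE eqxx/=; apply.
Qed.

Definition rbox a : set 'rV[R]_d := [set x | forall i, `|x 0 i| < a i].

Lemma rboxE a : box (EFin \o a) = rbox a.
Proof. by apply/seteqP; split => x H i; have := H i; rewrite lte_fin. Qed.

Lemma near_rbox a x : rbox a x -> \forall y \near x, rbox a y.
Proof.
move=> ax.
have := @filter_forall 'rV[R]_d _ (fun i => [set y : 'rV[R]_d | `|y 0 i| < a i])
  (nbhs x) (nbhs_filter _); apply => i.
have : \forall z \near x 0 i, `|z| < a i.
  apply/nbhs_ballP; exists (a i - `|x 0 i|) => /=; first by rewrite subr_gt0; exact: ax.
  move=> z /=; rewrite /ball/= distrC ltrBrDr => xz.
  by rewrite -[z](subrK (x 0 i)) (le_lt_trans (ler_normD _ _)).
exact: (@coord_continuous R 1 d 0 i x).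
Qed.

Lemma mx_opnorm_entry (A : 'M[R]_d) i j : (`|A i j|%:E <= mx_opnorm A)%E.
Proof.
apply: (@le_trans _ _ (enorm (e_ j *m A^T))%:E).
  rewrite lee_fin -rowE /enorm -sqrtr_sqr ler_sqrt ?sumr_ge0// => *; rewrite ?sqr_ge0//.
  rewrite (bigD1 i)//= !mxE lerDl sumr_ge0// => k _; exact: sqr_ge0.
apply: ereal_sup_ubound; exists (e_ j) => //=.
rewrite /enorm (bigD1 j)//= big1 ?addr0 => [|k kj].
  by rewrite !mxE !eqxx expr1n sqrtr1.
by rewrite !mxE eqxx (negbTE kj) expr0n.
Qed.

(* What is used of ellipticity on the box of half-sides [a]; the bound on the
   third derivatives comes from the invariance of the norm under dilations. *)
Record tame a g : Prop := Tame {
  tame_cont : forall x, rbox a x -> {for x, continuous g};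
  tame0 : g 0 = 0;
  tame_grad0 : forall i, 'D_(e_ i) g 0 = 0;
  tame_d1 : forall i x, rbox a x -> derivable g x (e_ i);
  tame_d2 : forall i j x, rbox a x -> derivable ('D_(e_ j) g) x (e_ i);
  tame_d3 : forall i j k x, rbox a x ->
    derivable ('D_(e_ i) ('D_(e_ j) g)) x (e_ k);
  tame_hess : forall i j x, rbox a x -> `|'D_(e_ i) ('D_(e_ j) g) x| <= 3;
  tame_third : forall i j k x, rbox a x ->
    `|'D_(e_ k) ('D_(e_ i) ('D_(e_ j) g)) x| <= (a k)^-1 }.

Lemma CN_norm_partial N (F : 'rV[R]_d -> 'M[R]_d) k y : le_extnat 2 N ->
  rbox (fun=> 1) y -> (mx_opnorm ('D_(e_ k) F y) <= CN_norm N F)%E.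
Proof.
move=> N2 y1; pose m : {ffun 'I_d -> nat} := [ffun i => (i == k) : nat].
have -> : 'D_(e_ k) F y = multi_partial m F y.
  rewrite /multi_partial; suff -> : flatten [seq nseq (m i) i | i <- enum 'I_d] = [:: k] by [].
  have -> : flatten [seq nseq (m i) i | i <- enum 'I_d] = [seq i <- enum 'I_d | i == k].
    elim: (enum 'I_d) => //= i s ->; rewrite ffunE; by case: eqP.
  by rewrite filter_pred1_uniq ?enum_uniq// mem_enum.
apply: le_trans; last first.
  apply: ereal_sup_ubound; exists m => //=.
  rewrite (bigD1 k)//= big1 => [|i ik]; rewrite !ffunE ?eqxx//; last by rewrite (negbTE ik).
  by case: N N2 => //= n /ltnW.
by apply: ereal_sup_ubound; exists y => //= i; rewrite lte_fin; exact: y1.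
Qed.

Lemma CN_norm_value N (F : 'rV[R]_d -> 'M[R]_d) y :
  rbox (fun=> 1) y -> (mx_opnorm (F y) <= CN_norm N F)%E.
Proof.
move=> y1; pose m : {ffun 'I_d -> nat} := [ffun i => 0].
have -> : F y = multi_partial m F y.
  rewrite /multi_partial; suff -> : flatten [seq nseq (m i) i | i <- enum 'I_d] = [::] by [].
  by elim: (enum 'I_d) => //= i s ->; rewrite ffunE.
apply: le_trans; last first.
  apply: ereal_sup_ubound; exists m => //=.
  by rewrite big1 => [|i ik]; rewrite ?ffunE//; case: N.
by apply: ereal_sup_ubound; exists y => //= i; rewrite lte_fin; exact: y1.
Qed.

(** Since [|xi|^2] contributes at most 2 to an entry of the Hessian and [h] at most 1, second
    derivatives are at most 3. Third derivatives see only [h]: differentiating the dilated Hessian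
    along [e_k] gives [a k] times a third derivative, and the norm bounds this by 1. *)
Lemma elliptic_tame N eps0 (l : 'I_d -> \bar R) g a : le_extnat 2 N -> eps0 < 1 ->
  elliptic N eps0 l g -> (forall i, 0 < a i) ->
  (forall i, ((a i)%:E <= l i)%E) -> tame a g.
Proof.
move=> N2 eps1 [Creg [_ [[h0 [gh0 _]] hN]]] a0 al.
have sub : rbox a `<=` box l.
  move=> x ax i; apply: lt_le_trans (al i); rewrite lte_fin; exact: ax.
have C4 : C_on 4 (box l) g by exact: Creg N2.
set h := fun x => g x - enorm x ^+ 2 in h0 gh0 hN.
have CN : (CN_norm N (hessian h \o dilation a) < eps0%:E)%E.
  by apply: hN => //; rewrite rboxE.
have d1 i x : rbox a x -> derivable g x (e_ i).
  by move=> /sub ax; have [/(_ isT) H _] := C4 [::]; exact: H.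
have d2 i j x : rbox a x -> derivable ('D_(e_ j) g) x (e_ i).
  by move=> /sub ax; have [/(_ isT) H _] := C4 [:: j]; exact: H.
have d3 i j k x : rbox a x -> derivable ('D_(e_ i) ('D_(e_ j) g)) x (e_ k).
  by move=> /sub ax; have [/(_ isT) H _] := C4 [:: i; j]; exact: H.
have hd1 j x : rbox a x -> 'D_(e_ j) h x = 'D_(e_ j) g x - 2 * x 0 j.
  move=> ax; have dE := is_derive_enorm_sqr x j.
  have dg : is_derive x (e_ j) g ('D_(e_ j) g x) by apply: derivableP; exact: d1.
  by have [_] := is_deriveB dg dE.
have hd2 i j x : rbox a x ->
    is_derive x (e_ i) ('D_(e_ j) h) ('D_(e_ i) ('D_(e_ j) g) x - 2 * (j == i)%:R).
  move=> ax; have dl := is_derive_linear_coord x i j.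
  have dg : is_derive x (e_ i) ('D_(e_ j) g) ('D_(e_ i) ('D_(e_ j) g) x).
    by apply: derivableP; exact: d2.
  apply: (near_eq_is_derive _ (is_deriveB dg dl)).
  by apply: filterS (near_rbox ax) => y ay; rewrite hd1.
have hd3 i j k x : rbox a x ->
    is_derive x (e_ k) ('D_(e_ i) ('D_(e_ j) h)) ('D_(e_ k) ('D_(e_ i) ('D_(e_ j) g)) x).
  move=> ax.
  have dg : is_derive x (e_ k) ('D_(e_ i) ('D_(e_ j) g)) ('D_(e_ k) ('D_(e_ i) ('D_(e_ j) g)) x).
    by apply: derivableP; exact: d3.
  rewrite -[X in is_derive _ _ _ X]subr0.
  apply: (near_eq_is_derive _ (is_deriveB dg (is_derive_cst (2 * (j == i)%:R : R) x (e_ k)))).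
  by apply: filterS (near_rbox ax) => y ay; have [_ ->] := hd2 i j y ay.
have dil x : rbox a x -> exists2 y, rbox (fun=> 1) y & x = dilation a y.
  move=> ax; exists (\row_i (x 0 i / a i)).
    by move=> i; rewrite mxE normrM normfV (gtr0_norm (a0 i)) ltr_pdivrMr// mul1r.
  by apply/rowP => i; rewrite !mxE mulrC divfK// gt_eqF.
have rb0 : rbox a 0 by move=> i; rewrite mxE normr0.
have g00 : g 0 = 0.
  move: h0; rewrite /h enorm_sqr big1 ?subr0// => i _; by rewrite mxE expr0n.
split => //.
- by move=> x /sub ax; have [_ /(_ isT)] := C4 [::]; exact.
- move=> i; have := hd1 i 0 rb0; rewrite !mxE mulr0 subr0 => <-.
  by have /rowP/(_ i) := gh0; rewrite !mxE.
- move=> i j x ax; have [_ hE] := hd2 i j x ax.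
  have : `|'D_(e_ i) ('D_(e_ j) h) x| <= 1.
    have [y y1 xy] := dil x ax.
    rewrite -lee_fin; apply: (le_trans _ (ltW (lt_trans CN _))); last by rewrite lte_fin.
    apply: le_trans (CN_norm_value N _ y1).
    have := mx_opnorm_entry ((hessian h \o dilation a) y) i j.
    by rewrite /= mxE /partials/= -xy.
  rewrite hE => H; rewrite -[X in `|X|](subrK (2 * (j == i)%:R)).
  apply: le_trans (ler_normD _ _) _.
  have : `|2 * (j == i)%:R| <= 2 :> R by case: (j == i); rewrite ?mulr1 ?mulr0 ?normr0 ?ger0_norm.
  lra.
- move=> i j k x ax.
  have [y y1 xy] := dil x ax.
  set F := hessian h \o dilation a in CN.
  have dE u v : is_derive y (e_ k) (fun z => F z u v)
      (a k * 'D_(e_ k) ('D_(e_ u) ('D_(e_ v) g)) x).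
    have := is_derive_scale_dir (a k) (hd3 u v k x ax).
    move=> /is_derive_line0P H; apply/is_derive_line0P.
    rewrite (_ : (fun s => _) = (fun s : R => 'D_(e_ u) ('D_(e_ v) h) (x + s *: (a k *: e_ k))))//.
    apply/funext => s; rewrite /F/= mxE /partials/=; congr ('D_(e_ u) _ _).
    rewrite xy; apply/rowP => t; rewrite !mxE eqxx/=.
    by case: eqP => [->|_]; rewrite ?mulr0 ?addr0// mulr1 mulrDr mulrCA mulr1.
  (* The norm differentiates a matrix-valued map; derivability of the whole matrix allows passing to
     its entries. *)
  have dF : derivable F y (e_ k) by apply/derivable_mxP => u v; have [] := dE u v.
  have : (`|('D_(e_ k) F y) i j|%:E <= eps0%:E)%E.
    have H := @CN_norm_partial N F k y N2 y1.
    exact: le_trans (mx_opnorm_entry _ _ _) (le_trans H (ltW CN)).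
  rewrite derive_mx// mxE; have [_ ->] := dE i j.
  rewrite lee_fin normrM (gtr0_norm (a0 k)) => H.
  by rewrite -[leRHS]mulr1 ler_pdivlMl// (le_trans H)// ltW.
Qed.

End elliptic_bounds.

(** * Oscillatory integrals over pieces *)

Section row_measure.
Context {R : realType} {n : nat}.
Implicit Types (c : 'rV[R]_n) (r : 'I_n -> R).

Definition cbox c r : set 'rV[R]_n := [set x | forall i, `|x 0 i - c 0 i| < r i].

Lemma cboxE c r : cbox c r =
  [set v | forall i, ([set` `]c 0 i - r i, c 0 i + r i[%R] : set (measurableTypeR R)) (coord i v)].
Proof.
by apply/seteqP; split => x H i; have := H i; rewrite /coord /= in_itv/= ltr_distl.
Qed.

Lemma measurable_rows (A : 'I_n -> set (measurableTypeR R)) : (forall i, measurable (A i)) ->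
  measurable [set v : 'rV[R]_n | forall i, A i (coord i v)].
Proof.
move=> mA.
have -> : [set v : 'rV[R]_n | forall i, A i (coord i v)] =
    \bigcap_(i in [set: 'I_n]) (coord i @^-1` A i).
  by apply/seteqP; split => v /= H j; [move=> _|]; exact: H.
apply: fin_bigcap_measurable => // j _.
by rewrite -[X in measurable X]setTI; exact: measurable_coord.
Qed.

Lemma measurable_cbox c r : measurable (cbox c r).
Proof. by rewrite cboxE; exact: (measurable_rows (fun i => measurable_itv `]c 0 i - r i, c 0 i + r i[%R)). Qed.

Lemma lebesgue_cbox c r : (forall i, 0 < r i) ->
  lebesgue_row n (cbox c r) = (\prod_i (2 * r i))%:E.
Proof.
move=> r0; rewrite cboxE (lebesgue_row_box (fun i => measurable_itv `]c 0 i - r i, c 0 i + r i[%R)).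
rewrite -prodEFin; apply: eq_bigr => i _.
rewrite lebesgue_measure_itv/= lte_fin ltrD2l gtrN// -EFinD; congr EFin.
ring.
Qed.

(** The sigma-algebra is generated by the coordinates, so an open set is written as the union of the
    boxes with rational centre and radius [1 / (m + 1)] that it contains. *)
Lemma open_measurable_row (U : set 'rV[R]_n) : open U -> measurable U.
Proof.
move=> oU.
pose B (k : 'rV[rat]_n * nat) : set 'rV[R]_n :=
  cbox (map_mx ratr k.1) (fun=> k.2.+1%:R^-1).
pose F k := if `[< B k `<=` U >] then B k else set0.
have -> : U = \bigcup_k F k.
  apply/seteqP; split => [x Ux|x [k _]]; last first.
    by rewrite /F; case: asboolP => // BU /BU.
  have := oU x Ux; rewrite nbhs_ballP => -[e/= e0 xeU].
  have e20 : 0 < e / 2 by rewrite divr_gt0.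
  have [m] := ltr_add_invr e20; rewrite add0r; set dl := m.+1%:R^-1 => dle.
  have dl0 : 0 < dl by rewrite invr_gt0.
  have Q i : exists s : rat, `|x 0 i - ratr s| < dl.
    have /rat_in_itvoo[s] : x 0 i - dl < x 0 i + dl by rewrite ltrD2l gtrN.
    by rewrite in_itv/= => s1; exists s; rewrite distrC ltr_distl.
  pose s := \row_i sval (cid (Q i)).
  have sE i : `|x 0 i - ratr (s 0 i)| < dl by rewrite mxE; case: cid.
  exists (s, m) => //; rewrite /F; case: asboolP => [_ i|[]]; first by rewrite mxE.
  move=> y By; apply: xeU; split => // i j; rewrite ord1 /ball/=.
  have h1 := sE j; have := By j; rewrite /= [map_mx _ _ _ _]mxE -/dl => h2.
  rewrite -(subrKA (ratr (s 0 j))) (le_lt_trans (ler_normD _ _))//.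
  by rewrite [`|_ - y 0 j|]distrC; lra.
apply: countable_bigcupT_measurable => // k; rewrite /F; case: asboolP => _.
  exact: measurable_cbox.
exact: measurable0.
Qed.

Lemma measurable_fun_continuous_row (D : set 'rV[R]_n) (f : 'rV[R]_n -> R) :
  open D -> (forall x, D x -> {for x, continuous f}) -> measurable_fun D f.
Proof.
move=> oD cf; apply: (measurability _ (RGenOInfty.measurableE R)).
move=> _ [_ [a ->] <-]; apply: open_measurable_row.
rewrite openE => x [Dx /=]; rewrite in_itv/= andbT => ax; rewrite /interior.
apply: filterI; first exact: oD.
have : \forall z \near f x, `]a, +oo[%classic z.
  apply/nbhs_ballP; exists (f x - a) => /=; first by rewrite subr_gt0.
  move=> z; rewrite /ball/= in_itv/= andbT => xz.
  by have := le_lt_trans (ler_norm _) xz; lra.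
exact: cf.
Qed.

End row_measure.

Section bounded_integrals.
Context {d} {T : measurableType d} {R : realType} (mu : {measure set T -> \bar R}).
Implicit Types (D B : set T) (f : T -> R).

Lemma bounded_integrable D f (M : R) : measurable D -> (mu D < +oo)%E ->
  measurable_fun D f -> (forall x, D x -> `|f x| <= M) ->
  mu.-integrable D (EFin \o f).
Proof.
move=> mD fD mf bf; apply: measurable_bounded_integrable => //.
exists M; split; first exact: num_real.
by move=> K MK x Dx; exact: le_trans (bf _ Dx) (ltW MK).
Qed.

Lemma Rintegral_sum D (J : finType) (h : J -> T -> R) : measurable D ->
  (forall j, mu.-integrable D (EFin \o h j)) ->
  \int[mu]_(x in D) (\sum_j h j x) = \sum_j \int[mu]_(x in D) h j x.
Proof.
move=> mD ih; elim: (index_enum J) => [|j s IH].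
  by rewrite big_nil; under eq_Rintegral do rewrite big_nil; rewrite Rintegral_cst// mul0r.
rewrite big_cons -IH -RintegralD//.
  by apply: eq_Rintegral => x _; rewrite big_cons.
have := @integrable_sum _ _ _ mu D mD _ s xpredT (fun j => EFin \o h j) (fun i _ => ih i).
by apply: eq_integrable => // x _ /=; rewrite sumEFin.
Qed.

Lemma Rintegral_norm_le D f (M : R) : measurable D -> (mu D < +oo)%E ->
  measurable_fun D f -> (forall x, D x -> `|f x| <= M) ->
  `|\int[mu]_(x in D) f x| <= M * fine (mu D).
Proof.
move=> mD fD mf bf; rewrite -Rintegral_cst//.
apply: le_trans (le_normr_Rintegral _ _) _ => //; first exact: bounded_integrable bf.
apply: le_Rintegral => //.
- apply: (@bounded_integrable _ _ M) => //; first exact: measurableT_comp.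
  by move=> x Dx; rewrite normr_id bf.
- by apply: (@bounded_integrable _ _ `|M|) => //.
Qed.

Lemma Rintegral_ge_cst D f (m M : R) : measurable D -> (mu D < +oo)%E ->
  measurable_fun D f -> (forall x, D x -> `|f x| <= M) -> (forall x, D x -> m <= f x) ->
  m * fine (mu D) <= \int[mu]_(x in D) f x.
Proof.
move=> mD fD mf bf lf; rewrite -Rintegral_cst//; apply: le_Rintegral => //.
- by apply: (@bounded_integrable _ _ `|m|).
- exact: bounded_integrable bf.
Qed.

End bounded_integrals.

Section trigonometric_bounds.
Context {R : realType}.
Implicit Types a b : R.

Lemma norm_cos_le1 a : `|cos a| <= 1.
Proof. by rewrite ler_norml cos_geN1 cos_le1. Qed.

Lemma norm_sin_le1 a : `|sin a| <= 1.
Proof. by rewrite ler_norml sin_geN1 sin_le1. Qed.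

Lemma lipschitz1_of_derive (f df : R -> R) a b : (forall x : R, is_derive x 1 f (df x)) ->
  (forall x, `|df x| <= 1) -> `|f a - f b| <= `|a - b|.
Proof.
move=> D bD; wlog ab : a b / b <= a.
  move=> H; have [/H//|/ltW/H] := leP b a.
  by rewrite distrC [`|a - b|]distrC.
have [|c _ ->] := @MVT_segment R f df b a ab (fun x _ => D x).
  by apply: derivable_within_continuous => x _; have [] := D x.
by rewrite normrM ler_piMl.
Qed.

Lemma cos_lipschitz a b : `|cos a - cos b| <= `|a - b|.
Proof.
by apply: (lipschitz1_of_derive _ _ (@is_derive_cos R)) => x; rewrite normrN norm_sin_le1.
Qed.

Lemma sin_lipschitz a b : `|sin a - sin b| <= `|a - b|.
Proof. exact: (lipschitz1_of_derive _ _ (@is_derive_sin R) norm_cos_le1). Qed.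

Lemma cos_ge_half a : `|a| <= 2^-1 -> 2^-1 <= cos a.
Proof.
move=> ah; have := le_trans (cos_lipschitz a 0) _; move=> /(_ 2^-1).
rewrite subr0 => /(_ ah); rewrite cos0 ler_norml => /andP[+ _]; lra.
Qed.

End trigonometric_bounds.

Section piece.
Context {R : realType} {d : nat}.
Implicit Types (g : 'rV[R]_d -> R) (B : set 'rV[R]_d) (y xi : 'rV[R]_d)
  (tx : 'rV[R]_(1 + d)).
Notation mu := (lebesgue_row d).

Definition dot y xi : R := \sum_i y 0 i * xi 0 i.

(** Subtracting [dot y xi] translates the wave by [y] in space; the phase is stationary at [xi] when
    [x = y - t * grad g xi]. *)
Definition phase g y tx xi : R := lsubmx tx 0 0 * g xi + dot (rsubmx tx) xi - dot y xi.

Definition wave_cos g B y tx : R := \int[mu]_(xi in B) cos (phase g y tx xi).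
Definition wave_sin g B y tx : R := \int[mu]_(xi in B) sin (phase g y tx xi).

(** Boundedness of [g] and of the coordinates on [B] makes the phase Lipschitz in [tx] uniformly
    over [B]; the waves are then continuous, hence measurable. *)
Record admissible g B : Prop := Admissible {
  adm_meas : measurable B;
  adm_fin : (mu B < +oo)%E;
  adm_fun : measurable_fun B g;
  adm_bound : exists M, forall xi, B xi -> `|g xi| <= M /\ forall i, `|xi 0 i| <= M }.

Lemma measurable_dot D y : measurable_fun D (dot y).
Proof.
move=> mD; apply: (@measurable_sum _ _ R D) => // i.
apply: measurable_funM => //.
exact: measurable_funS (measurable_coord i).
Qed.

Variables (g : 'rV[R]_d -> R) (B : set 'rV[R]_d) (y : 'rV[R]_d).
Hypothesis aB : admissible g B.
Let mB := adm_meas aB.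
Let fB := adm_fin aB.

Lemma measurable_phase tx : measurable_fun B (phase g y tx).
Proof.
apply: measurable_funB; last exact: measurable_dot.
apply: measurable_funD; last exact: measurable_dot.
by apply: measurable_funM => //; exact: adm_fun.
Qed.

Lemma measurable_cos_phase tx : measurable_fun B (fun xi => cos (phase g y tx xi)).
Proof.
apply: measurableT_comp (measurable_phase tx).
by apply: continuous_measurable_fun; exact: continuous_cos.
Qed.

Lemma measurable_sin_phase tx : measurable_fun B (fun xi => sin (phase g y tx xi)).
Proof.
apply: measurableT_comp (measurable_phase tx).
by apply: continuous_measurable_fun; exact: continuous_sin.
Qed.

Lemma integrable_cos_phase tx :
  mu.-integrable B (EFin \o (fun xi => cos (phase g y tx xi))).
Proof.
apply: (@bounded_integrable _ _ _ _ _ _ 1) => //; first exact: measurable_cos_phase.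
by move=> *; exact: norm_cos_le1.
Qed.

Lemma integrable_sin_phase tx :
  mu.-integrable B (EFin \o (fun xi => sin (phase g y tx xi))).
Proof.
apply: (@bounded_integrable _ _ _ _ _ _ 1) => //; first exact: measurable_sin_phase.
by move=> *; exact: norm_sin_le1.
Qed.

Lemma wave_cos_le tx : `|wave_cos g B y tx| <= fine (mu B).
Proof.
rewrite -[leRHS]mul1r; apply: Rintegral_norm_le => //; first exact: measurable_cos_phase.
by move=> *; exact: norm_cos_le1.
Qed.

Lemma wave_sin_le tx : `|wave_sin g B y tx| <= fine (mu B).
Proof.
rewrite -[leRHS]mul1r; apply: Rintegral_norm_le => //; first exact: measurable_sin_phase.
by move=> *; exact: norm_sin_le1.
Qed.

Lemma phase_lipschitz : exists2 M, 0 <= M & forall tx tx' e xi, B xi ->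
  (forall i, `|tx 0 i - tx' 0 i| <= e) -> `|phase g y tx xi - phase g y tx' xi| <= e * M.
Proof.
have [M bM] := adm_bound aB.
exists (`|M| * (1 + d%:R)); first by rewrite mulr_ge0// addr_ge0.
move=> tx tx' e xi Bxi te; have [bg bx] := bM xi Bxi.
have e0 : 0 <= e by exact: le_trans (te ord0).
have MM : M <= `|M| by exact: ler_norm.
have -> : phase g y tx xi - phase g y tx' xi =
    (lsubmx tx 0 0 - lsubmx tx' 0 0) * g xi + (dot (rsubmx tx) xi - dot (rsubmx tx') xi).
  by rewrite /phase; ring.
rewrite (le_trans (ler_normD _ _))// !mulrDr mulr1 mulrA lerD//.
  by rewrite !mxE normrM ler_pM//; exact: le_trans MM.
rewrite /dot -sumrB (le_trans (ler_norm_sum _ _ _))//.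
rewrite mulr_natr -[in leRHS](card_ord d) -sumr_const; apply: ler_sum => i _.
by rewrite -mulrBl !mxE normrM ler_pM//; exact: le_trans (bx i) MM.
Qed.

Lemma continuous_wave (f : R -> R) : (forall a b, `|f a - f b| <= `|a - b|) ->
  (forall a, `|f a| <= 1) ->
  (forall tx, measurable_fun B (fun xi => f (phase g y tx xi))) ->
  continuous (fun tx => \int[mu]_(xi in B) f (phase g y tx xi)).
Proof.
move=> fl fb mf tx; have [M M0 pl] := phase_lipschitz.
set V := fine (mu B); have V0 : 0 <= V by exact: fine_ge0.
move=> S /nbhs_ballP[e/= e0 eS].
pose dl := e / 2 / (M * V + 1).
have MV0 : 0 < M * V + 1 by rewrite ltr_wpDl// mulr_ge0.
have e20 : 0 < e / 2 by rewrite divr_gt0.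
have dl0 : 0 < dl by rewrite divr_gt0.
apply/nbhs_ballP; exists dl => //= tx' [_ tt']; apply: eS; rewrite /ball/=.
have te i : `|tx 0 i - tx' 0 i| <= dl by have := tt' 0 i; rewrite /ball/= => /ltW.
have fi t : mu.-integrable B (EFin \o (fun xi => f (phase g y t xi))).
  by apply: (@bounded_integrable _ _ _ _ _ _ 1).
rewrite -RintegralB//; apply: (@le_lt_trans _ _ (e / 2)); last by lra.
apply: (le_trans (Rintegral_norm_le (M := dl * M) _ _ _ _)) => //.
- exact: measurable_funB.
- by move=> xi Bxi; rewrite (le_trans (fl _ _))// pl.
- by rewrite -/V -mulrA /dl mulrAC ler_pdivrMr// ler_pM2l// lerDl.
Qed.

Lemma measurable_wave_cos : measurable_fun setT (wave_cos g B y).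
Proof.
apply: measurable_fun_continuous_row => [|x _]; first exact: openT.
apply: continuous_wave; [exact: cos_lipschitz|exact: norm_cos_le1|exact: measurable_cos_phase].
Qed.

Lemma measurable_wave_sin : measurable_fun setT (wave_sin g B y).
Proof.
apply: measurable_fun_continuous_row => [|x _]; first exact: openT.
apply: continuous_wave; [exact: sin_lipschitz|exact: norm_sin_le1|exact: measurable_sin_phase].
Qed.

(** There is no cancellation when the phase stays within 1/2 of a constant [k]: after rotation by
    [k] the integrand has real part at least 1/2. Cauchy-Schwarz with the unit vector
    [(cos k, sin k)] passes to the modulus. *)
Lemma wave_lower tx (k : R) : (forall xi, B xi -> `|phase g y tx xi - k| <= 2^-1) ->
  (fine (mu B)) ^+ 2 / 4 <= wave_cos g B y tx ^+ 2 + wave_sin g B y tx ^+ 2.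
Proof.
move=> pk; set V := fine (mu B); have V0 : 0 <= V by exact: fine_ge0.
have H : 2^-1 * V <= cos k * wave_cos g B y tx + sin k * wave_sin g B y tx.
  have ic := integrable_cos_phase tx; have is_ := integrable_sin_phase tx.
  have ick : mu.-integrable B (EFin \o (fun xi => cos k * cos (phase g y tx xi))).
    exact: (integrableZl mB (cos k) ic).
  have isk : mu.-integrable B (EFin \o (fun xi => sin k * sin (phase g y tx xi))).
    exact: (integrableZl mB (sin k) is_).
  rewrite -!RintegralZl// -RintegralD//.
  have -> : \int[mu]_(x in B) (cos k * cos (phase g y tx x) + sin k * sin (phase g y tx x))
      = \int[mu]_(x in B) cos (phase g y tx x - k).
    apply: eq_Rintegral => xi _; rewrite cosB; ring.
  apply: (@Rintegral_ge_cst _ _ _ _ _ _ _ 1) => //.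
  - apply: (measurableT_comp (f := cos)).
      by apply: continuous_measurable_fun; exact: continuous_cos.
    apply: measurable_funB => //; exact: measurable_phase.
  - by move=> *; exact: norm_cos_le1.
  - by move=> xi Bxi; apply: cos_ge_half; exact: pk.
set C := wave_cos _ _ _ _ in H *; set S := wave_sin _ _ _ _ in H *.
have h1 : (2^-1 * V) ^+ 2 <= (cos k * C + sin k * S) ^+ 2.
  by rewrite ler_pXn2r// ?nnegrE ?mulr_ge0// (le_trans _ H)// mulr_ge0.
have h2 : (cos k * C + sin k * S) ^+ 2 <= (cos k ^+ 2 + sin k ^+ 2) * (C ^+ 2 + S ^+ 2).
  rewrite -subr_ge0 (_ : _ - _ = (cos k * S - sin k * C) ^+ 2) ?sqr_ge0//; ring.
rewrite cos2Dsin2 mul1r in h2; apply: le_trans h2; apply: le_trans h1.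
by rewrite exprMn exprVn -natrX mulrC.
Qed.

End piece.

(** * Reciprocal exponents and L^p norms of complex functions *)

Section exponent_facts.
Context {R : realType}.
Implicit Types p q : \bar R.

Lemma rcp_fin (r : R) : 1 <= r -> rcp r%:E = r^-1.
Proof. by move=> r1; rewrite /rcp inver gt_eqF// (lt_le_trans ltr01). Qed.

Lemma rcpy : rcp (+oo%E : \bar R) = 0.
Proof. by rewrite /rcp invey. Qed.

Lemma rcp_bounds p : (1 <= p)%E -> 0 <= rcp p <= 1.
Proof.
case: p => [r|_|//]; last by rewrite rcpy lexx ler01.
rewrite lee_fin => r1; rewrite rcp_fin// invr_ge0 (le_trans ler01)//=.
by rewrite invf_le1// (lt_le_trans ltr01).
Qed.

Lemma rcp_conj p : (1 <= p)%E -> rcp (hoelder_conjugate p) = 1 - rcp p.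
Proof.
case: p => [r|_|//]; last by rewrite hoelder_conjugatey rcpy subr0 rcp_fin// invr1.
rewrite lee_fin => r1; have r0 : 0 < r by exact: lt_le_trans r1.
rewrite rcp_fin// /hoelder_conjugate/= eqe gt_eqF// -EFinB inver subr_eq0.
have [->|rn1] := eqVneq r 1.
  by rewrite mul1e rcpy invr1 subrr.
have r10 : r - 1 != 0 by rewrite subr_eq0.
rewrite -EFinM /rcp inver mulf_eq0 invr_eq0 (negbTE r10) gt_eqF//=.
by field; rewrite r10 gt_eqF.
Qed.

End exponent_facts.

Section row_norms.
Context {R : realType} {n : nat}.
Implicit Types (f : 'rV[R]_n -> R[i]) (D : set 'rV[R]_n) (p : \bar R).
Notation mu := (lebesgue_row n).
Notation cmod := (@ComplexField.Normc.normc R).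

Lemma normcE (z : R[i]) : cmod z = Num.sqrt (complex.Re z ^+ 2 + complex.Im z ^+ 2).
Proof. by case: z. Qed.

Lemma normc_sqr (z : R[i]) : cmod z ^+ 2 = complex.Re z ^+ 2 + complex.Im z ^+ 2.
Proof. by rewrite normcE sqr_sqrtr// addr_ge0// sqr_ge0. Qed.

Lemma normc_ge0 (z : R[i]) : 0 <= cmod z.
Proof. by rewrite normcE sqrtr_ge0. Qed.

Lemma measurable_normc D f : measurable_fun D (fun x => complex.Re (f x)) ->
  measurable_fun D (fun x => complex.Im (f x)) -> measurable_fun D (fun x => cmod (f x)).
Proof.
move=> mr mi.
have -> : (fun x => cmod (f x)) =
    (fun x => (complex.Re (f x) ^+ 2 + complex.Im (f x) ^+ 2) `^ 2^-1).
  by apply/funext => x; rewrite normcE powR12_sqrt// addr_ge0// sqr_ge0.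
apply: (measurableT_comp (measurable_powR _)).
by apply: measurable_funD; apply: measurable_funX.
Qed.

Lemma Lp_norm_le1 D S p (V : R) f : (1 <= p)%E -> measurable D -> measurable S -> S `<=` D ->
  measurable_fun D (fun x => complex.Re (f x)) ->
  measurable_fun D (fun x => complex.Im (f x)) ->
  (forall x, S x -> cmod (f x) <= 1) -> (forall x, D x -> ~ S x -> cmod (f x) = 0) ->
  (mu S <= V%:E)%E -> 0 < V -> (Lp_norm D p f <= (V `^ rcp p)%:E)%E.
Proof.
move=> p1 mD mS SD mr mi f1 f0 SV V0.
set F := (fun x => (cmod (f x))%:E) \_ D.
have mF : measurable_fun setT F.
  apply/measurable_restrict => //; rewrite setTI.
  by apply/measurable_EFinP; exact: measurable_normc.
have bF x : (`|F x| <= (\1_S x)%:E)%E.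
  rewrite /F patchE indicE; case: ifPn => [/set_mem Dx|_]; last first.
    by rewrite abse0 lee_fin.
  rewrite gee0_abs ?lee_fin ?normc_ge0//.
  by case: (boolP (x \in S)) => [/set_mem/f1//|/negP xS]; rewrite f0// => /mem_set.
rewrite /Lp_norm -/F unlock; case: p p1 => [r|_|//]; last first.
  rewrite rcpy powRr0; case: ifP => _ //.
  apply/ess_supP; apply: nearW => x /=; apply: le_trans (bF x) _.
  by rewrite lee_fin indicE; case: (_ \in _).
rewrite lee_fin => r1; have r0 : 0 < r by exact: lt_le_trans r1.
rewrite rcp_fin// -poweR_EFin; apply: gt0_ler_poweR => //.
- by rewrite invr_ge0 ltW.
- by rewrite in_itv/= leey andbT; apply: integral_ge0 => x _; rewrite ?lee_fin ?powR_ge0 ?poweR_ge0.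
- by rewrite in_itv/= leey andbT lee_fin ltW.
apply: le_trans SV; have := integral_indic mu measurableT mS; rewrite setIT => <-.
apply: ge0_le_integral => //.
- by move=> x _; exact: poweR_ge0.
- by apply: (measurableT_comp (measurable_poweR _)); exact: measurableT_comp.
- by apply/measurable_EFinP; exact: measurable_indic.
move=> x _; apply: (@le_trans _ _ ((\1_S x)%:E `^ r)%E).
  by apply: gt0_ler_poweR => //; rewrite ?ltW// in_itv/= leey andbT ?lee_fin.
rewrite indicE; case: (x \in S); first by rewrite poweR_EFin powR1.
by rewrite poweR_EFin powR0// gt_eqF.
Qed.

Lemma Lp_normT p f : Lp_norm setT p f = Lnorm mu p (fun x => (cmod (f x))%:E).
Proof. by rewrite /Lp_norm patch_setT. Qed.

Lemma Lp_normT_ge0 D p f : (0 <= Lp_norm D p f)%E.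
Proof. exact: Lnorm_ge0. Qed.

Lemma ess_sup_ge_on (S : set 'rV[R]_n) (F : 'rV[R]_n -> \bar R) (Y : \bar R) :
  measurable S -> (0 < mu S)%E -> (forall x, S x -> (Y <= F x)%E) -> (Y <= ess_sup mu F)%E.
Proof.
move=> mS S0 YF; rewrite leNgt; apply/negP => FY.
have [N [mN N0 sN]] := ess_sup_ge mu F.
have : (mu S <= mu N)%E.
  apply: le_measure; rewrite ?inE// => x Sx; apply: sN => /= Fx.
  by have := lt_le_trans FY (YF x Sx); rewrite ltNge Fx.
by rewrite N0 leNgt S0.
Qed.

Lemma le_Lp_normT S q (Y V : R) f : (1 <= q)%E -> measurable S ->
  measurable_fun setT (fun x => complex.Re (f x)) ->
  measurable_fun setT (fun x => complex.Im (f x)) ->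
  mu S = V%:E -> 0 < V -> 0 <= Y -> (forall x, S x -> Y <= cmod (f x)) ->
  ((Y * V `^ rcp q)%:E <= Lp_norm setT q f)%E.
Proof.
move=> q1 mS mr mi SV V0 Y0 Yf; rewrite Lp_normT unlock.
have muT : (0 < mu [set: 'rV[R]_n])%E.
  have : (mu S <= mu [set: 'rV[R]_n])%E by apply: le_measure; rewrite ?inE.
  by apply: lt_le_trans; rewrite SV lte_fin.
case: q q1 => [r|_|//]; last first.
  rewrite rcpy powRr0 mulr1 muT; apply: (ess_sup_ge_on mS); first by rewrite SV lte_fin.
  by move=> x /Yf; rewrite /= lee_fin ger0_norm ?normc_ge0.
rewrite lee_fin => r1; have r0 : 0 < r by exact: lt_le_trans r1.
have r00 : r != 0 by rewrite gt_eqF.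
have -> : Y * V `^ rcp r%:E = (Y `^ r * V) `^ r^-1.
  by rewrite powRM ?powR_ge0 ?ltW// -powRrM mulfV// powRr1// rcp_fin.
rewrite -poweR_EFin; apply: gt0_ler_poweR => //.
- by rewrite invr_ge0 ltW.
- by rewrite in_itv/= leey andbT lee_fin mulr_ge0 ?powR_ge0// ltW.
- by rewrite in_itv/= leey andbT; apply: integral_ge0 => x _; rewrite ?lee_fin ?powR_ge0 ?poweR_ge0.
rewrite EFinM -SV -integral_cst//.
apply: (@le_trans _ _ (\int[mu]_(x in S) (`|(cmod (f x))%:E| `^ r))%E).
  apply: ge0_le_integral => //.
  - by move=> x _; rewrite lee_fin powR_ge0.
  - apply: (measurableT_comp (measurable_poweR _)); apply: measurableT_comp => //.
    apply/measurable_EFinP; apply: measurable_funS (measurable_normc mr mi) => //.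
  move=> x Sx; rewrite -poweR_EFin; apply: gt0_ler_poweR; rewrite ?(ltW r0) ?in_itv/= ?leey ?andbT ?lee_fin//.
  by rewrite ?lee_fin ger0_norm ?normc_ge0 ?Yf.
apply: ge0_subset_integral => //.
- apply: (measurableT_comp (measurable_poweR _)); apply: measurableT_comp => //.
  apply/measurable_EFinP; exact: measurable_normc.
- by move=> x _; exact: poweR_ge0.
Qed.

(** Extracts an L^r lower bound from a square integral: a pointwise minorant of [|f|^r], affine in
    [|f|^2], is integrated over [S]. The bound [K] makes the integrals finite. *)
Lemma le_Lp_normT_quadratic S (r A Y2 K : R) f : 1 <= r -> measurable S -> (mu S < +oo)%E ->
  measurable_fun setT (fun x => complex.Re (f x)) ->
  measurable_fun setT (fun x => complex.Im (f x)) ->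
  (forall x, S x -> cmod (f x) <= K) ->
  (forall x, S x -> A * (cmod (f x) ^+ 2 - Y2) <= cmod (f x) `^ r) ->
  0 <= A * (\int[mu]_(x in S) (cmod (f x) ^+ 2) - Y2 * fine (mu S)) ->
  (((A * (\int[mu]_(x in S) (cmod (f x) ^+ 2) - Y2 * fine (mu S))) `^ r^-1)%:E
     <= Lp_norm setT r%:E f)%E.
Proof.
move=> r1 mS fS mr mi fK fA W0; rewrite Lp_normT unlock.
have r0 : 0 < r by exact: lt_le_trans r1.
have mc : measurable_fun S (fun x => cmod (f x)).
  by apply: measurable_funS (measurable_normc mr mi).
rewrite -poweR_EFin; apply: gt0_ler_poweR => //.
- by rewrite invr_ge0 ltW.
- by rewrite in_itv/= leey andbT lee_fin.
- by rewrite in_itv/= leey andbT; apply: integral_ge0 => x _; rewrite ?lee_fin ?powR_ge0 ?poweR_ge0.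
apply: (@le_trans _ _ (\int[mu]_(x in S) (`|(cmod (f x))%:E| `^ r))%E); last first.
  apply: ge0_subset_integral => //.
  - apply: (measurableT_comp (measurable_poweR _)); apply: measurableT_comp => //.
    apply/measurable_EFinP; exact: measurable_normc.
  - by move=> x _; exact: poweR_ge0.
have fK0 x : S x -> 0 <= K by move=> /fK; apply: le_trans; exact: normc_ge0.
have i2 : mu.-integrable S (EFin \o (fun x => cmod (f x) ^+ 2)).
  apply: (@bounded_integrable _ _ _ _ _ _ (K ^+ 2)) => //; first exact: measurable_funX.
  move=> x Sx; rewrite ger0_norm ?sqr_ge0// ler_pXn2r// ?nnegrE ?normc_ge0// ?fK//.
  exact: fK0 Sx.
have iY : mu.-integrable S (EFin \o cst Y2).
  by apply: (@bounded_integrable _ _ _ _ _ _ `|Y2|).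
have iB : mu.-integrable S (EFin \o (fun x => cmod (f x) ^+ 2 - Y2)).
  exact: (integrableB mS i2 iY).
have mr_ : measurable_fun S (fun x => cmod (f x) `^ r).
  exact: (measurableT_comp (measurable_powR _)).
have ir : mu.-integrable S (EFin \o (fun x => cmod (f x) `^ r)).
  apply: (@bounded_integrable _ _ _ _ _ _ (K `^ r)) => //.
  move=> x Sx; rewrite ger0_norm ?powR_ge0// ge0_ler_powR ?(ltW r0) ?nnegrE ?normc_ge0 ?fK//.
  exact: fK0 Sx.
rewrite -Rintegral_cst//.
rewrite -RintegralB// -RintegralZl//.
have -> : (\int[mu]_(x in S) (`|(cmod (f x))%:E| `^ r))%E =
    (\int[mu]_(x in S) (cmod (f x) `^ r))%:E.
  rewrite /Rintegral fineK; last exact: integrable_fin_num.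
  by apply: eq_integral => x _; rewrite /= ger0_norm ?normc_ge0// poweR_EFin.
rewrite lee_fin; apply: le_Rintegral => //.
exact: (integrableZl mS A iB).
Qed.

End row_norms.

(** * Sums of wave packets *)

Section sign_selection.
Context {d} {T : measurableType d} {R : realType} (mu : {measure set T -> \bar R}).
Variables (S : set T).
Hypotheses (mS : measurable S) (fS : (mu S < +oo)%E).
Implicit Types f h : T -> R.

Definition mbounded f := measurable_fun S f /\ exists K, forall x, S x -> `|f x| <= K.

Lemma mbounded_integrable f : mbounded f -> mu.-integrable S (EFin \o f).
Proof. by move=> [mf [K bK]]; exact: bounded_integrable bK. Qed.

Lemma mboundedD f h : mbounded f -> mbounded h -> mbounded (fun x => f x + h x).
Proof.
move=> [mf [K bK]] [mh [L bL]]; split; first exact: measurable_funD.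
by exists (K + L) => x Sx; rewrite (le_trans (ler_normD _ _))// lerD ?bK ?bL.
Qed.

Lemma mboundedM f h : mbounded f -> mbounded h -> mbounded (fun x => f x * h x).
Proof.
move=> [mf [K bK]] [mh [L bL]]; split; first exact: measurable_funM.
by exists (K * L) => x Sx; rewrite normrM ler_pM ?bK ?bL.
Qed.

Lemma mbounded_cst (c : R) : mbounded (fun=> c).
Proof. by split => //; exists `|c|. Qed.

Lemma mboundedX2 f : mbounded f -> mbounded (fun x => f x ^+ 2).
Proof. by move=> mf; exact: mboundedM. Qed.

Lemma mbounded_sum (J : Type) (s : seq J) (h : J -> T -> R) :
  (forall j, mbounded (h j)) -> mbounded (fun x => \sum_(j <- s) h j x).
Proof.
move=> bh; elim: s => [|j s IH].
  by under [X in mbounded X]eq_fun do rewrite big_nil; exact: mbounded_cst.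
under [X in mbounded X]eq_fun do rewrite big_cons; exact: mboundedD.
Qed.

(* Of the two signs, at least one makes the cross term nonnegative. *)
Lemma sign_selection (J : finType) (u v : J -> T -> R) :
  (forall j, mbounded (u j)) -> (forall j, mbounded (v j)) ->
  exists eps : J -> R, (forall j, eps j ^+ 2 = 1) /\
    \sum_j \int[mu]_(x in S) (u j x ^+ 2 + v j x ^+ 2) <=
    \int[mu]_(x in S) ((\sum_j eps j * u j x) ^+ 2 + (\sum_j eps j * v j x) ^+ 2).
Proof.
move=> bu bv.
suff H (s : seq J) : uniq s -> exists eps : J -> R, (forall j, eps j ^+ 2 = 1) /\
    \sum_(j <- s) \int[mu]_(x in S) (u j x ^+ 2 + v j x ^+ 2) <=
    \int[mu]_(x in S) ((\sum_(j <- s) eps j * u j x) ^+ 2 +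
      (\sum_(j <- s) eps j * v j x) ^+ 2).
  by apply: H; exact: index_enum_uniq.
elim: s => [_|j s IH /= /andP[js us]].
  exists (fun=> 1); split; first by move=> j; rewrite expr1n.
  by rewrite big_nil Rintegral_ge0// => x _; rewrite addr_ge0// sqr_ge0.
have [e [e1 eE]] := IH us.
pose U x := \sum_(i <- s) e i * u i x; pose V x := \sum_(i <- s) e i * v i x.
have bU : mbounded U by apply: mbounded_sum => i; apply: mboundedM => //; exact: mbounded_cst.
have bV : mbounded V by apply: mbounded_sum => i; apply: mboundedM => //; exact: mbounded_cst.
have bE c : mbounded (fun x => (c * u j x + U x) ^+ 2 + (c * v j x + V x) ^+ 2).
  by apply: mboundedD; apply: mboundedX2; apply: mboundedD => //; apply: mboundedM => //;
    exact: mbounded_cst.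
have buv : mbounded (fun x => u j x ^+ 2 + v j x ^+ 2).
  by apply: mboundedD; exact: mboundedX2.
have bUV : mbounded (fun x => U x ^+ 2 + V x ^+ 2).
  by apply: mboundedD; exact: mboundedX2.
pose E c := \int[mu]_(x in S) ((c * u j x + U x) ^+ 2 + (c * v j x + V x) ^+ 2).
have EE : E 1 + E (-1) = 2 * (\int[mu]_(x in S) (u j x ^+ 2 + v j x ^+ 2) +
    \int[mu]_(x in S) (U x ^+ 2 + V x ^+ 2)).
  rewrite -!RintegralD//; try exact: mbounded_integrable.
  rewrite -RintegralZl//; last by apply: mbounded_integrable; exact: mboundedD.
  by apply: eq_Rintegral => x _; ring.
have [c [c1 cE]] : exists c, c ^+ 2 = 1 /\ \int[mu]_(x in S) (u j x ^+ 2 + v j x ^+ 2) +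
    \int[mu]_(x in S) (U x ^+ 2 + V x ^+ 2) <= E c.
  have [h|h] := leP (E (-1)) (E 1).
    by exists 1; rewrite expr1n; split=> //; lra.
  by exists (-1); rewrite sqrrN expr1n; split=> //; lra.
exists (fun i => if i == j then c else e i); split.
  by move=> i; case: ifP.
have sE (w : J -> T -> R) x : \sum_(i <- j :: s) (if i == j then c else e i) * w i x =
    c * w j x + \sum_(i <- s) e i * w i x.
  rewrite big_cons eqxx; congr (_ + _); apply: eq_big_seq => i si.
  by case: eqP => // ij; move: js; rewrite -ij si.
rewrite big_cons; under [leRHS]eq_Rintegral do rewrite !sE.
by apply: le_trans cE; rewrite lerD2l.
Qed.

End sign_selection.

Section packets.
Context {R : realType} {d : nat}.
Variables (l : 'I_d -> \bar R) (g : 'rV[R]_d -> R) (J : finType).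
Variables (B : J -> set 'rV[R]_d) (y : J -> 'rV[R]_d) (eps : J -> R).
Hypothesis aB : forall j, admissible g (B j).
Hypothesis Bl : forall j, B j `<=` box l.
Hypothesis disj : forall i j x, B i x -> B j x -> i = j.
Hypothesis eps1 : forall j, eps j ^+ 2 = 1.
Notation mu := (lebesgue_row d).

(** This is [sum_j eps_j exp(-i y_j . xi)] restricted to the pieces [B_j]; each modulation
    translates the wave of its piece by [y_j]. *)
Definition packet xi : R[i] :=
  ((\sum_j eps j * ((fun x => cos (dot (y j) x)) \_ (B j)) xi) +i*
   (- \sum_j eps j * ((fun x => sin (dot (y j) x)) \_ (B j)) xi))%C.

Lemma measurable_box : measurable (box l).
Proof.
apply: (measurable_rows (A := fun i => [set u : R | (`|u|%:E < l i)%E])) => i.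
case: (l i) => [r||].
- rewrite (_ : [set u | _] = `](- r), r[%classic); first exact: measurable_itv.
  by apply/seteqP; split => u; rewrite /= lte_fin in_itv/= ltr_norml.
- by rewrite (_ : [set u | _] = setT)//; apply/seteqP; split => u //= _; exact: ltry.
- by rewrite (_ : [set u | _] = set0)//; apply/seteqP; split => u.
Qed.

Lemma measurable_patch_sum (D : set 'rV[R]_d) (f : R -> R) : continuous f ->
  measurable_fun D
    (fun xi => \sum_j eps j * ((fun x => f (dot (y j) x)) \_ (B j)) xi).
Proof.
move=> cf; apply: measurable_funS measurableT _ _ => //.
apply: (@measurable_sum _ _ R) => j; apply: measurable_funM => //.
apply/measurable_restrict => //; first exact: adm_meas.
rewrite setTI; apply: (measurableT_comp (f := f)); last exact: measurable_dot.
exact: continuous_measurable_fun.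
Qed.

Lemma measurable_packet_Re D : measurable_fun D (fun x => complex.Re (packet x)).
Proof. by apply: measurable_patch_sum; exact: continuous_cos. Qed.

Lemma measurable_packet_Im D : measurable_fun D (fun x => complex.Im (packet x)).
Proof.
apply: (measurable_funS measurableT) => //.
by apply: measurableT_comp => //; apply: measurable_patch_sum; exact: continuous_sin.
Qed.

Lemma packet_in j xi : B j xi -> packet xi =
  (eps j * cos (dot (y j) xi) +i* (- (eps j * sin (dot (y j) xi))))%C.
Proof.
move=> Bj; rewrite /packet (bigD1 j)//= [in X in (_ +i* X)%C](bigD1 j)//=.
rewrite !patchE mem_set// !big1 ?addr0// => i ij;
  rewrite patchE memNset ?mulr0// => Bi; by rewrite (disj Bi Bj) eqxx in ij.
Qed.

Lemma packet_out xi : (forall j, ~ B j xi) -> packet xi = 0.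
Proof.
move=> nB; rewrite /packet !big1 ?oppr0// => j _; rewrite patchE memNset ?mulr0//; exact: nB.
Qed.

Lemma normc_packet_in j xi : B j xi -> ComplexField.Normc.normc (packet xi) = 1.
Proof.
move=> Bj; rewrite (packet_in Bj) normcE /= sqrrN !exprMn -mulrDr cos2Dsin2.
by rewrite eps1 mulr1 sqrtr1.
Qed.

(** The modulus is 1 on the disjoint pieces and 0 elsewhere, so signs and modulations do not affect
    the norm, and the volume of a surrounding box bounds it. *)
Lemma packet_norm_le a p : (1 <= p)%E -> (forall i, 0 < a i) ->
  rbox a `<=` box l -> (forall j, B j `<=` rbox a) ->
  (Lp_norm (box l) p packet <= ((\prod_i (2 * a i)) `^ rcp p)%:E)%E.
Proof.
move=> p1 a0 al Ba; have E : rbox a = cbox 0 a.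
  by apply/seteqP; split => x H i; have := H i; rewrite mxE subr0.
apply: (Lp_norm_le1 (S := rbox a)) => //.
- exact: measurable_box.
- by rewrite E; exact: measurable_cbox.
- exact: measurable_packet_Re.
- exact: measurable_packet_Im.
- move=> x _; have [[j Bj]|nB] := pselect (exists j, B j x).
    by rewrite (normc_packet_in Bj).
  rewrite packet_out; first by rewrite normcE/= expr0n addr0 sqrtr0.
  by move=> j Bj; apply: nB; exists j.
- move=> x _ nx; rewrite packet_out; first by rewrite normcE/= expr0n addr0 sqrtr0.
  by move=> j /Ba.
- by rewrite E lebesgue_cbox.
- by apply: prodr_gt0 => i _; rewrite mulr_gt0.
Qed.

Lemma packet_in_Lp a p : (1 <= p)%E -> (forall i, 0 < a i) ->
  rbox a `<=` box l -> (forall j, B j `<=` rbox a) -> in_Lp (box l) p packet.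
Proof.
move=> p1 a0 al Ba; split; [exact: measurable_packet_Re|exact: measurable_packet_Im|].
by apply: le_lt_trans (packet_norm_le p1 a0 al Ba) _; exact: ltry.
Qed.

Lemma Rintegral_patch_sum (h : J -> 'rV[R]_d -> R) :
  (forall j, mu.-integrable (B j) (EFin \o h j)) ->
  \int[mu]_(xi in box l) (\sum_j eps j * ((h j) \_ (B j)) xi) =
  \sum_j eps j * \int[mu]_(xi in B j) h j xi.
Proof.
move=> ih.
have ihl j : mu.-integrable (box l) (EFin \o ((h j) \_ (B j))).
  rewrite -restrict_EFin; apply/integrable_restrict => //.
  - exact: adm_meas.
  - exact: measurable_box.
  - by rewrite setIidr//; exact: Bl.
rewrite Rintegral_sum.
- apply: eq_bigr => j _; rewrite RintegralZl//; last exact: measurable_box.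
  by rewrite -Rintegral_mkcondr setIidr//; exact: Bl.
- exact: measurable_box.
- by move=> j; apply: (integrableZl measurable_box (eps j) (ihl j)).
Qed.

Lemma Re_extension_packet tx : complex.Re (extension l g packet tx) =
  \sum_j eps j * wave_cos g (B j) (y j) tx.
Proof.
rewrite /extension /cintegral /=.
rewrite -(Rintegral_patch_sum (fun j => integrable_cos_phase (y j) (aB j) tx)).
apply: eq_Rintegral => xi _; rewrite /packet/=.
rewrite mulrN opprK !mulr_sumr -big_split/=; apply: eq_bigr => j _.
rewrite !patchE; case: ifP => _; last by rewrite !mulr0 addr0.
by rewrite /phase cosB -/(dot _ _); ring.
Qed.

Lemma Im_extension_packet tx : complex.Im (extension l g packet tx) =
  \sum_j eps j * wave_sin g (B j) (y j) tx.
Proof.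
rewrite /extension /cintegral /=.
rewrite -(Rintegral_patch_sum (fun j => integrable_sin_phase (y j) (aB j) tx)).
apply: eq_Rintegral => xi _; rewrite /packet/=.
rewrite mulrN addrC !mulr_sumr -sumrB; apply: eq_bigr => j _.
rewrite !patchE; case: ifP => _; last by rewrite !mulr0 subr0.
by rewrite /phase sinB -/(dot _ _); ring.
Qed.

Lemma measurable_extension_Re :
  measurable_fun setT (fun tx => complex.Re (extension l g packet tx)).
Proof.
rewrite (_ : (fun tx => _) = (fun tx => \sum_j eps j * wave_cos g (B j) (y j) tx)).
  by apply: (@measurable_sum _ _ R) => j; apply: measurable_funM => //; exact: measurable_wave_cos.
by apply/funext => tx; rewrite Re_extension_packet.
Qed.

Lemma measurable_extension_Im :
  measurable_fun setT (fun tx => complex.Im (extension l g packet tx)).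
Proof.
rewrite (_ : (fun tx => _) = (fun tx => \sum_j eps j * wave_sin g (B j) (y j) tx)).
  by apply: (@measurable_sum _ _ R) => j; apply: measurable_funM => //; exact: measurable_wave_sin.
by apply/funext => tx; rewrite Im_extension_packet.
Qed.

End packets.

Section test_bounds.
Context {R : realType} {d : nat}.
Variables (l : 'I_d -> \bar R) (g : 'rV[R]_d -> R) (p q : \bar R).

(* The measurability conditions let the bound be transferred from an extension
   that agrees with the integral only almost everywhere. *)
Definition test_bound (C : R) : Prop := forall f, in_Lp (box l) 1%E f -> in_Lp (box l) p f ->
  measurable_fun setT (fun tx => complex.Re (extension l g f tx)) ->
  measurable_fun setT (fun tx => complex.Im (extension l g f tx)) ->
  (Lp_norm setT q (extension l g f) <= C%:E * Lp_norm (box l) p f)%E.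

Lemma le_extension_norm (X : R) : (forall C, 0 <= C -> test_bound C -> X <= C) ->
  (X%:E <= extension_norm l g p q)%E.
Proof.
move=> H; apply: le_ereal_inf_tmp => _ [C [C0 bC] <-]; rewrite lee_fin; apply: H => //.
by move=> f f1 fp _ _; exact: bC.
Qed.

Lemma extends_test_bound : (1 <= q)%E -> extends_bounded l g p q ->
  exists2 C, 0 <= C & test_bound C.
Proof.
(* [extends_bounded] does not prescribe the sign of its constant, while the later estimates use
   [0 <= C]. *)
move=> q1 [T [C [Tq _ TC TE]]]; exists (Num.max C 0); first by rewrite le_max lexx orbT.
move=> f f1 fp mr mi; have := TC f fp; have := TE f f1 fp; have [Tr Ti _] := Tq f fp.
move=> ae bT; apply: (@le_trans _ _ (C%:E * Lp_norm (box l) p f)%E); last first.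
  by rewrite lee_wpmul2r ?Lp_normT_ge0// lee_fin le_max lexx.
apply: le_trans bT; rewrite !Lp_normT unlock.
case: q q1 => [r|_|//]; last first.
  case: ifP => // _; rewrite (@eq_ess_sup _ _ _ _ _
    (abse \o (fun x => (ComplexField.Normc.normc (T f x))%:E)))//.
  by apply: filterS ae => x /= ->.
rewrite lee_fin => r1; rewrite (@ge0_ae_eq_integral _ _ _ _ _ _
   (fun x => (`|(ComplexField.Normc.normc (T f x))%:E| `^ r)%E))//.
- apply: (measurableT_comp (measurable_poweR _)); apply: measurableT_comp => //.
  by apply/measurable_EFinP; exact: measurable_normc.
- apply: (measurableT_comp (measurable_poweR _)); apply: measurableT_comp => //.
  by apply/measurable_EFinP; exact: measurable_normc.
- by move=> x _; exact: poweR_ge0.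
- by move=> x _; exact: poweR_ge0.
- by apply: filterS ae => x /= ->.
Qed.

Lemma packet_test_bound C (J : finType) (B : J -> set 'rV[R]_d) y eps a : (1 <= p)%E ->
  test_bound C ->
  (forall j, admissible g (B j)) -> (forall i j x, B i x -> B j x -> i = j) ->
  (forall j, eps j ^+ 2 = 1) -> (forall i, 0 < a i) -> rbox a `<=` box l ->
  (forall j, B j `<=` rbox a) -> 0 <= C ->
  (Lp_norm setT q (extension l g (packet B y eps)) <=
    (C * (\prod_i (2 * a i)) `^ rcp p)%:E)%E.
Proof.
move=> p1 bC aB disj eps1 a0 al Ba C0.
have Bl j : B j `<=` box l by apply: subset_trans al; exact: Ba.
apply: le_trans (bC _ _ _ _ _) _.
- exact: packet_in_Lp al Ba.
- exact: packet_in_Lp al Ba.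
- exact: measurable_extension_Re.
- exact: measurable_extension_Im.
by rewrite EFinM lee_wpmul2l ?lee_fin//; exact: packet_norm_le.
Qed.

End test_bounds.

(** * Space-time boxes, Taylor expansion and Knapp examples *)

Section slabs.
Context {R : realType} {d : nat}.
Implicit Types (t : R) (x : 'rV[R]_d).

(** Slanted tubes are approximated by stacks of such axis-parallel boxes, whose measures are exact
    products. *)
Definition slab t x (rt : R) (rx : 'I_d -> R) : set 'rV[R]_(1 + d) :=
  [set tx | `|lsubmx tx 0 0 - t| < rt /\ forall i, `|rsubmx tx 0 i - x 0 i| < rx i].

Lemma slabE t x rt rx : slab t x rt rx = cbox (row_mx (const_mx t : 'rV_1) x)
  (fun i => if unlift ord0 i is Some j then rx j else rt).
Proof.
have E0 : (ord0 : 'I_(1 + d)) = lshift d (ord0 : 'I_1) by exact: val_inj.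
have ES (j : 'I_d) : lift (ord0 : 'I_(1 + d)) j = rshift 1 j by exact: val_inj.
apply/seteqP; split => tx.
  move=> [ht hx] i; case: unliftP => [j|] ->.
    by rewrite ES row_mxEr; have := hx j; rewrite mxE.
  by rewrite E0 row_mxEl mxE; move: ht; rewrite mxE.
move=> H; split => [|j].
  by have := H ord0; rewrite unlift_none {2}E0 row_mxEl !mxE E0.
by have := H (lift ord0 j); rewrite liftK {2}ES row_mxEr !mxE ES.
Qed.

Lemma measurable_slab t x rt rx : measurable (slab t x rt rx).
Proof. by rewrite slabE; exact: measurable_cbox. Qed.

Lemma lebesgue_slab t x rt rx : 0 < rt -> (forall i, 0 < rx i) ->
  lebesgue_row (1 + d) (slab t x rt rx) = (2 * rt * \prod_i (2 * rx i))%:E.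
Proof.
move=> t0 x0; rewrite slabE lebesgue_cbox => [|i]; last by case: unliftP.
rewrite big_ord_recl unlift_none; congr ((_ * _)%:E).
by apply: eq_bigr => i _; rewrite liftK.
Qed.

End slabs.

Section taylor.
Context {R : realType} {d : nat}.
Variables (a : 'I_d -> R) (g : 'rV[R]_d -> R).
Hypothesis ga : tame a g.
Notation e_ i := (delta_mx 0 i : 'rV[R]_d).

(** The mean value estimate is used twice: for the first derivatives, then for [g] minus its linear
    part at [xi0], whose derivatives are the differences just bounded. *)
Lemma taylor2 xi0 xi (s : 'I_d -> R) : rbox a xi0 -> rbox a xi ->
  (forall i, `|xi 0 i - xi0 0 i| <= s i) ->
  `|g xi - g xi0 - \sum_j 'D_(e_ j) g xi0 * (xi 0 j - xi0 0 j)| <= 3 * (\sum_i s i) ^+ 2.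
Proof.
move=> a0 ax sx.
have s0 i : 0 <= s i by exact: le_trans (sx i).
(* Both constraints matter: the displacement controls the remainder, and the box is where the
   derivative bounds hold. *)
pose A i : set R := [set u | `|u - xi0 0 i| <= s i /\ `|u| < a i].
have iA i : is_interval (A i).
  move=> u v [u1 u2] [v1 v2] w /andP[uw wv]; split.
    by move: u1 v1; rewrite !ler_norml => /andP[h1 h2] /andP[h3 h4]; apply/andP; split; lra.
  by move: u2 v2; rewrite !ltr_norml => /andP[h1 h2] /andP[h3 h4]; apply/andP; split; lra.
have Aa z : cell A z -> rbox a z by move=> Az i; case: (Az i).
have A0 : cell A xi0 by move=> i; split; [rewrite subrr normr0|exact: a0].
have Ax : cell A xi by move=> i; split; [exact: sx|exact: ax].
pose L := fun z : 'rV[R]_d => \sum_j 'D_(e_ j) g xi0 * z 0 j.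
have dL z i : is_derive z (e_ i) L ('D_(e_ i) g xi0).
  have -> : L = \sum_(j < d) ('D_(e_ j) g xi0 \*: (fun z : 'rV[R]_d => z 0 j)).
    by apply/funext => w; rewrite fct_sumE.
  apply: is_derive_eq.
    by apply: is_derive_sum => j; apply: is_deriveZ; exact: is_derive_coord.
  rewrite (bigD1 i)//= big1 ?addr0 => [|j ji]; rewrite !mxE eqxx /=.
    by rewrite eqxx [_ *: _]mulr1.
  by rewrite (negbTE ji) scaler0.
have dF z i : cell A z -> is_derive z (e_ i) (g - L) ('D_(e_ i) g z - 'D_(e_ i) g xi0).
  move=> Az; apply: is_deriveB.
  by apply: derivableP; apply: (tame_d1 ga); exact: Aa.
have dd i z : cell A z -> `|'D_(e_ i) g z - 'D_(e_ i) g xi0| <= 3 * \sum_k s k.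
  move=> Az; rewrite mulr_sumr.
  apply: (le_trans (@cell_mean_value _ _ A ('D_(e_ i) g) (fun=> 3) _ _ iA _ _ A0 Az)).
  - by move=> k w /Aa; exact: (tame_d2 ga).
  - by move=> k w /Aa; exact: (tame_hess ga).
  - by apply: ler_sum => k _; rewrite ler_pM2l//; case: (Az k).
have := @cell_mean_value _ _ A (g - L) (fun=> 3 * \sum_k s k) _ _ iA _ _ A0 Ax.
have -> : (g - L) xi - (g - L) xi0 =
    g xi - g xi0 - \sum_j 'D_(e_ j) g xi0 * (xi 0 j - xi0 0 j).
  under eq_bigr do rewrite mulrBr.
  by rewrite sumrB !fctE -/(L xi) -/(L xi0); ring.
move=> H; apply: (le_trans (H _ _)).
- by move=> i z Az; have [] := dF z i Az.
- by move=> i z Az; have [_ ->] := dF z i Az; exact: dd.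
rewrite -mulr_sumr -mulrA expr2 ler_pM2l// ler_wpM2l ?sumr_ge0//.
by apply: ler_sum => i _; exact: sx.
Qed.

Hypothesis a0 : forall i, 0 < a i.

Lemma rbox0 : rbox a 0.
Proof. by move=> i; rewrite mxE normr0. Qed.

Lemma tame_value_le xi (s : 'I_d -> R) : rbox a xi -> (forall i, `|xi 0 i| <= s i) ->
  `|g xi| <= 3 * (\sum_i s i) ^+ 2.
Proof.
move=> ax xs; have := @taylor2 0 xi s rbox0 ax.
rewrite (tame0 ga) subr0 big1 ?subr0; last by move=> j _; rewrite (tame_grad0 ga) mul0r.
by apply=> i; rewrite mxE subr0.
Qed.

Lemma rbox_cbox : rbox a = cbox 0 a.
Proof. by apply/seteqP; split => x H i; have := H i; rewrite mxE subr0. Qed.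

Lemma tame_admissible (B : set 'rV[R]_d) : B `<=` rbox a -> measurable B ->
  admissible g B.
Proof.
move=> Ba mB; have ma : measurable (rbox a) by rewrite rbox_cbox; exact: measurable_cbox.
split => //.
- have := lebesgue_cbox 0 a0; rewrite -rbox_cbox => aE.
  have : (lebesgue_row d B <= lebesgue_row d (rbox a))%E by apply: le_measure; rewrite ?inE.
  by rewrite aE => /le_lt_trans; apply; exact: ltry.
- apply: (measurable_funS ma Ba); apply: measurable_fun_continuous_row.
    by rewrite openE => x; exact: near_rbox.
  exact: (tame_cont ga).
exists (3 * (\sum_i a i) ^+ 2 + \sum_i a i) => xi /Ba ax; split.
  rewrite (le_trans (tame_value_le ax (fun i => ltW (ax i))))// lerDl sumr_ge0// => i _.
  exact: ltW.
move=> i; rewrite (le_trans (ltW (ax i)))//.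
have h1 : 0 <= 3 * (\sum_i a i) ^+ 2 by rewrite mulr_ge0// sqr_ge0.
apply: (@le_trans _ _ (\sum_i a i)); last by rewrite lerDr.
by rewrite (bigD1 i)//= lerDl sumr_ge0// => j _; exact: ltW.
Qed.

End taylor.

Section knapp.
Context {R : realType} {d : nat}.
(** Small enough for the two parts of a phase variation, at most [3 * c * d^2] and [c * d], to add
    up to at most 1/2. *)
Definition small_const : R := (64 * (d%:R + 1) ^+ 2)^-1.

Lemma small_const_gt0 : 0 < small_const.
Proof. by rewrite invr_gt0 mulr_gt0// exprn_gt0// ltr_wpDl. Qed.

Lemma small_const_le : small_const * (d%:R + 1) ^+ 2 = 64^-1.
Proof.
by rewrite /small_const; field; rewrite gt_eqF// ltr_wpDl.
Qed.

(** The measure [(2 c)^(d+1)] of the dual slab for unit sides, times the factor 1/2 lost in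
    [wave_lower]. *)
Definition knapp_const : R := (2 * small_const) ^+ d.+1 / 2.

Lemma knapp_const_gt0 : 0 < knapp_const.
Proof. by rewrite divr_gt0// exprn_gt0// mulr_gt0// small_const_gt0. Qed.

Lemma small_const_le2 : 2 * small_const <= 1.
Proof.
have d1 : 1 <= (d%:R + 1) ^+ 2 :> R by rewrite exprn_ege1// lerDr.
by have := small_const_le; have := small_const_gt0; nra.
Qed.

(** The dual slab has measure about [lam^-2 / prod a]; the extension has size about [prod a] on it,
    against an L^p norm of about [(prod a)^(1/p)]. The duration of the slab depends only on a bound
    for the largest side, hence the separate [lam]. *)
Lemma knapp (l : 'I_d -> \bar R) g p q (a : 'I_d -> R) (lam C : R) :
  (1 <= p)%E -> (1 <= q)%E -> (forall i, 0 < a i) -> tame a g -> rbox a `<=` box l ->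
  (forall i, a i <= lam) -> 0 < lam -> 0 <= C -> test_bound l g p q C ->
  knapp_const * (\prod_i a i) `^ (1 - rcp p - rcp q) * lam `^ (- (2 * rcp q)) <= C.
Proof.
move=> p1 q1 a0 ga al alam lam0 C0 bC.
have c0 := small_const_gt0; have c2 := small_const_le2; have cE := small_const_le.
set c := small_const in c0 c2 cE.
(* The indicator of the box is the packet with one piece, no shift and sign 1. *)
pose B (_ : unit) := rbox a; pose y (_ : unit) := 0 : 'rV[R]_d; pose eps (_ : unit) := 1 : R.
have aB j : admissible g (B j).
  by apply: (tame_admissible ga) => //; rewrite /B rbox_cbox; exact: measurable_cbox.
have disj (i j : unit) x : B i x -> B j x -> i = j by case: i; case: j.
have eps1 j : eps j ^+ 2 = 1 by rewrite expr1n.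
have Bl j : B j `<=` box l by [].
have := packet_test_bound y p1 bC aB disj eps1 a0 al (fun _ x => id) C0.
set V := \prod_i (2 * a i).
have V0 : 0 < V by apply: prodr_gt0 => i _; rewrite mulr_gt0.
set P := \prod_i a i.
have P0 : 0 < P by apply: prodr_gt0.
have VE : V = 2 ^+ d * P by rewrite /V big_split/= prodr_const card_ord.
have muB : fine (lebesgue_row d (rbox a)) = V by rewrite rbox_cbox lebesgue_cbox.
pose S := slab 0 (0 : 'rV[R]_d) (c * lam ^- 2) (fun i => c / a i).
pose VS := (2 * c) ^+ d.+1 * lam ^- 2 / P.
have l20 : 0 < lam ^- 2 by rewrite invr_gt0 exprn_gt0.
have VS0 : 0 < VS by rewrite divr_gt0// mulr_gt0// exprn_gt0// mulr_gt0.
have muS : lebesgue_row (1 + d) S = VS%:E.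
  rewrite lebesgue_slab ?mulr_gt0// => [|i]; last by rewrite divr_gt0.
  congr EFin; under eq_bigr do rewrite mulrA.
  by rewrite big_split/= prodr_const card_ord prodfV -/P /VS (exprS (2 * c) d); set X := (2 * c) ^+ d; ring.
have phS tx : S tx -> forall xi, rbox a xi -> `|phase g 0 tx xi - 0| <= 2^-1.
  move=> [ht hx] xi ax; rewrite subr0 /phase.
  have -> : dot 0 xi = 0 by rewrite /dot big1// => i _; rewrite mxE mul0r.
  rewrite subr0 (le_trans (ler_normD _ _))//.
  have b1 : `|lsubmx tx 0 0 * g xi| <= c * (3 * d%:R ^+ 2).
    rewrite normrM; apply: (@le_trans _ _ (c * lam ^- 2 * (3 * (\sum_(i < d) lam) ^+ 2))).
      apply: ler_pM => //; first by move: ht; rewrite subr0 => /ltW.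
      by apply: (tame_value_le ga) => // i; rewrite (le_trans (ltW (ax i))).
    rewrite sumr_const card_ord -[lam *+ d]mulr_natr exprMn le_eqVlt; apply/orP; left; apply/eqP.
    by field; rewrite gt_eqF.
  have b2 : `|dot (rsubmx tx) xi| <= c * d%:R.
    rewrite (le_trans (ler_norm_sum _ _ _))// mulr_natr -[in leRHS](card_ord d) -sumr_const.
    apply: ler_sum => i _; rewrite normrM.
    apply: (@le_trans _ _ (c / a i * a i)); last by rewrite divfK// gt_eqF.
    by apply: ler_pM => //; [have := hx i; rewrite [X in _ - X]mxE subr0 => /ltW|exact/ltW/ax].
  have dd : 0 <= d%:R :> R by [].
  nra.
have lower tx : S tx -> V / 2 <= ComplexField.Normc.normc (extension l g (packet B y eps) tx).
  move=> Stx; rewrite normcE (Re_extension_packet y eps aB Bl) (Im_extension_packet y eps aB Bl).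
  have sumu (F : unit -> R) : \sum_j F j = F tt by rewrite (bigD1 tt)//= big1 ?addr0// => -[].
  rewrite !sumu /eps !mul1r.
  have := wave_lower (aB tt) (phS _ Stx); rewrite muB => /(ler_wsqrtr).
  apply: le_trans; rewrite sqrtrM ?sqr_ge0// sqrtr_sqr gtr0_norm//.
  by rewrite sqrtrV// (_ : 4 = 2 ^+ 2)// ?sqrtr_sqr ?ger0_norm// -natrX.
move=> H; have := le_trans (le_Lp_normT q1 (measurable_slab _ _ _ _)
  (measurable_extension_Re y eps aB Bl) (measurable_extension_Im y eps aB Bl) muS VS0
  (ltW (divr_gt0 V0 (ltr0Sn _ 1))) lower) H.
rewrite lee_fin => {}H.
have [/andP[rp0 rp1]] := rcp_bounds p1; have /andP[rq0 rq1] := rcp_bounds q1.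
set K := (2 * c) ^+ d.+1 in VS VS0 muS H *.
have K0 : 0 < K by rewrite exprn_gt0// mulr_gt0.
have K1 : K <= 1 by rewrite exprn_ile1// ltW// mulr_gt0.
(* Since [K <= 1] and [rcp q <= 1], the power [K ^ rcp q] is at least [K]; the final constant is
   thus independent of [q]. *)
have VSq : K * lam `^ (- (2 * rcp q)) * P `^ (- rcp q) <= VS `^ rcp q.
  rewrite /VS !powRM ?invr_ge0 ?(ltW P0) ?(ltW l20) ?(ltW K0) ?mulr_ge0 ?(ltW l20) ?(ltW K0) ?(ltW lam0)//.
  rewrite -(powR_invn 2 (ltW lam0)) -powRrM mulNr -(powR_inv1 (ltW P0)) -powRrM mulN1r.
  by rewrite !ler_wpM2r ?powR_ge0 ?ger1_powR ?K0.
have Vp : P `^ (1 - rcp p) * V `^ rcp p <= V.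
  rewrite -[leRHS](powRr1 (ltW V0)) -[X in _ <= V `^ X](subrK (rcp p)).
  rewrite (@powRD _ V) ?ler_wpM2r ?powR_ge0//; last by rewrite (gt_eqF V0) implybT.
  by rewrite ge0_ler_powR ?subr_ge0 ?nnegrE ?(ltW P0) ?(ltW V0)// VE ler_peMl ?(ltW P0)// exprn_ege1// ler1n.
rewrite -(ler_pM2r (powR_gt0 (rcp p) V0)); apply: le_trans H.
rewrite (@powRD _ P); last by rewrite (gt_eqF P0) implybT.
apply: (@le_trans _ _ ((P `^ (1 - rcp p) * V `^ rcp p) / 2 *
   (K * lam `^ (- (2 * rcp q)) * P `^ (- rcp q)))).
  by rewrite le_eqVlt; apply/orP; left; apply/eqP; rewrite /knapp_const -/c -/K; ring.
by apply: ler_pM; rewrite ?mulr_ge0 ?powR_ge0 ?(ltW K0) ?invr_ge0 ?ler_pM2r// invr_gt0.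
Qed.

End knapp.

(** * Compression of tubes *)

Section compression.
Context {R : realType}.
Implicit Types (m k nu : nat) (t : R).

(** The base-m digit of [nu] at place [k], multiplied by its weight [m ^ k]. *)
Definition digit_part m k nu : nat := (nu %% m ^ k.+1 - nu %% m ^ k)%N.

(* The k-th base-m digit of the slope selects the time k / m at which the line
   is pinned. *)
Definition pinned_shift m nu : R := \sum_(k < m) (digit_part m k nu)%:R * (k%:R / m%:R).

Lemma modn_pow_le m k nu : (nu %% m ^ k <= nu %% m ^ k.+1)%N.
Proof.
by rewrite -(modn_dvdm nu (dvdn_exp2l m (leqnSn k))) leq_mod.
Qed.

Lemma sum_digit_part m k nu : (\sum_(i < k) digit_part m i nu = nu %% m ^ k)%N.
Proof.
elim: k => [|k IH]; first by rewrite big_ord0 expn0 modn1.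
by rewrite big_ord_recr/= IH /digit_part subnKC// modn_pow_le.
Qed.

(** Restoring the low digits causes no carry, so the higher ones depend only on the quotient by
    [m ^ k]. *)
Lemma digit_part_high m k j nu : (0 < m)%N -> (k <= j)%N ->
  digit_part m j nu = digit_part m j (nu %/ m ^ k * m ^ k).
Proof.
move=> m0 kj; have M0 : (0 < m ^ k)%N by rewrite expn_gt0 m0.
have E i : (k <= i)%N ->
    (nu %% m ^ i = (nu %/ m ^ k * m ^ k) %% m ^ i + nu %% m ^ k)%N.
  move=> ki; rewrite {1}(divn_eq nu (m ^ k)) -modnDml modn_small//.
  rewrite -(subnK ki) expnD -muln_modl.
  have : (nu %/ m ^ k %% m ^ (i - k) < m ^ (i - k))%N by rewrite ltn_mod expn_gt0 m0.
  rewrite -(leq_pmul2r M0) mulSn; apply: leq_trans.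
  by rewrite addnC ltn_add2r ltn_mod.
by rewrite /digit_part (E j.+1 (leqW kj)) (E j kj) subnDr.
Qed.

(** At a time within [1 / m] of [k / m] the line sits at the sum over [j] of the weighted digits
    times [j / m - t]. The digits above [k] are common to all [nu] with the same quotient [h] by
    [m ^ k.+1]; the weighted digit [k] is below [m ^ k.+1] but has a factor at most [1 / m]; the
    lower ones add up to less than [m ^ k]. Each of the [m ^ (m - k - 1)] clusters therefore has
    diameter [O(m ^ k)], and [5 * m ^ m.-1] positions serve all [m ^ m] lines. *)
Lemma compression m t : (0 < m)%N -> 0 <= t <= 1 ->
  exists Z : nat -> R, forall nu, (nu < m ^ m)%N ->
    exists2 z, (z < 5 * m ^ m.-1)%N & `|pinned_shift m nu - nu%:R * t - Z z| <= 1.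
Proof.
move=> m0 /andP[t0 t1].
have mR : 0 < m%:R :> R by rewrite ltr0n.
(* Rounding [t * m] down gives [k], except at [t = 1], where it would give [m] and the last place is
   taken instead. *)
have [k km tk] : exists2 k, (k < m)%N & `|k%:R / m%:R - t| <= m%:R^-1.
  move: t1; rewrite le_eqVlt => /predU1P[->|t1].
    exists m.-1; first by rewrite prednK.
    rewrite -subn1 natrB// mulrBl mulfV ?gt_eqF// mul1r addrAC subrr add0r.
    by rewrite normrN ger0_norm// invr_ge0 ltW.
  have tm0 : 0 <= t * m%:R by rewrite mulr_ge0// ltW.
  have /andP[h1 h2] := truncn_itv tm0; exists (Num.truncn (t * m%:R)).
    by rewrite -(ltr_nat R) (le_lt_trans h1)// gtr_pMl.
  rewrite -(ler_pM2r mR) mulVf ?gt_eqF// -[X in _ * X](ger0_norm (ltW mR)) -normrM.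
  rewrite mulrBl divfK ?gt_eqF// ler_norml; apply/andP; split; last by lra.
  by move: h2; rewrite -natr1; lra.
pose G h := \sum_(k.+1 <= j < m) (digit_part m j (h * m ^ k.+1))%:R * (j%:R / m%:R - t).
pose w := (m ^ k)%N.
(* The index [z] encodes a cluster [h] and one of [5 * w] unit steps in it, starting [2 * w] to the
   left of its centre. *)
exists (fun z => G (z %/ (5 * w))%N - (2 * w)%:R + (z %% (5 * w))%:R) => nu numm.
set v := pinned_shift m nu - nu%:R * t; set h := (nu %/ m ^ k.+1)%N.
have vE : v = \sum_(0 <= j < m) (digit_part m j nu)%:R * (j%:R / m%:R - t).
  rewrite /v /pinned_shift -[nu in nu%:R * t](modn_small numm) -(sum_digit_part m m nu).
  rewrite natr_sum mulr_suml -sumrB big_mkord; apply: eq_bigr => j _; ring.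
have vG : `|v - G h| <= (2 * w)%:R.
  rewrite vE (big_cat_nat _ (n := k.+1))//= big_nat_recr//=.
  have -> : \sum_(k.+1 <= j < m) (digit_part m j nu)%:R * (j%:R / m%:R - t) = G h.
    by apply: eq_big_nat => j /andP[kj _]; rewrite (digit_part_high nu m0 kj).
  rewrite addrK mul2n -addnn natrD (le_trans (ler_normD _ _))// lerD//.
    rewrite (le_trans (ler_norm_sum _ _ _))//.
    apply: (@le_trans _ _ (\sum_(0 <= j < k) (digit_part m j nu)%:R)).
      rewrite big_nat [leRHS]big_nat; apply: ler_sum => j /andP[_ jk].
      rewrite normrM ger0_norm// ler_piMr//.
      have j0 : 0 <= j%:R / m%:R :> R by rewrite divr_ge0// ltW.
      have j1 : j%:R / m%:R <= 1 :> R.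
        by rewrite ler_pdivrMr// mul1r ler_nat ltnW// (ltn_trans jk).
      by rewrite ler_norml; apply/andP; split; lra.
    by rewrite big_mkord -natr_sum sum_digit_part ler_nat ltnW// ltn_mod expn_gt0 m0.
  rewrite normrM ger0_norm//.
  apply: (@le_trans _ _ ((m ^ k.+1)%:R * m%:R^-1)).
    rewrite ler_pM// ler_nat /digit_part (leq_trans (leq_subr _ _))// ltnW// ltn_mod.
    by rewrite expn_gt0 m0.
  by rewrite expnSr natrM mulfK// gt_eqF.
have w0 : (0 < w)%N by rewrite expn_gt0 m0.
pose u := v - G h + (2 * w)%:R.
have u0 : 0 <= u by move: vG; rewrite ler_norml /u => /andP[]; lra.
have u4 : u <= (4 * w)%:R.
  have -> : (4 * w = 2 * w + 2 * w)%N by rewrite -mulnDl.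
  by move: vG; rewrite ler_norml /u natrD => /andP[]; lra.
have /andP[i1 i2] := truncn_itv u0; set i := Num.truncn u in i1 i2.
(* The offset ranges over the closed interval from 0 to [4 * w], so [4 * w + 1] steps can occur;
   [5 * w] suffices since [w >= 1]. *)
have iw : (i < 5 * w)%N.
  have : (i <= 4 * w)%N by rewrite -(ler_nat R) (le_trans i1).
  by move=> /leq_ltn_trans; apply; rewrite ltn_pmul2r.
exists (h * (5 * w) + i)%N.
  have hm : (h < m ^ (m - k.+1))%N.
    by rewrite ltn_divLR ?expn_gt0 ?m0// -expnD subnK.
  have -> : (5 * m ^ m.-1 = m ^ (m - k.+1) * (5 * w))%N.
    by rewrite mulnCA /w -expnD; congr (5 * m ^ _)%N; rewrite -[in LHS](subnK km) addnS.
  have := hm; rewrite -(leq_pmul2r (_ : 0 < 5 * w)%N) ?muln_gt0// mulSn.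
  by apply: leq_trans; rewrite addnC ltn_add2r.
rewrite divnMDl ?muln_gt0// divn_small// addn0 modnMDl modn_small//.
move: i1 i2; rewrite /u -natr1 => i1 i2; rewrite ler_norml; apply/andP; split; lra.
Qed.

End compression.

Section finite_unions.
Context {d} {T : measurableType d} {R : realType} (mu : {measure set T -> \bar R}).
Variables (J : finType) (F : J -> set T).
Hypothesis mF : forall j, measurable (F j).

Lemma exists_setE : [set x | exists j, F j x] = [set x | exists2 j, j \in index_enum J & F j x].
Proof.
apply/seteqP; split => x [j].
  by exists j => //; rewrite mem_index_enum.
by move=> _ Fj; exists j.
Qed.

Lemma exists_cons j (s : seq J) : [set x | exists2 i, i \in j :: s & F i x] =
  F j `|` [set x | exists2 i, i \in s & F i x].
Proof.
apply/seteqP; split => x /=.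
  by move=> [k]; rewrite inE => /predU1P[->|si] Fi; [left|right; exists k].
by move=> [Fj|[i si Fi]]; [exists j; rewrite ?mem_head|exists i; rewrite // inE si orbT].
Qed.

Lemma measurable_exists_seq (s : seq J) : measurable [set x | exists2 i, i \in s & F i x].
Proof.
elim: s => [|j s IH]; last by rewrite exists_cons; exact: measurableU.
by rewrite (_ : [set x | _] = set0)//; apply/seteqP; split => x // [k].
Qed.

Lemma measurable_exists : measurable [set x | exists j, F j x].
Proof. by rewrite exists_setE; exact: measurable_exists_seq. Qed.

Lemma measure_exists_le : (mu [set x | exists j, F j x] <= \sum_j mu (F j))%E.
Proof.
rewrite exists_setE; elim: (index_enum J) => [|j s IH].
  rewrite big_nil (_ : [set x | _] = set0) ?measure0//.
  by apply/seteqP; split => x // [k].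
rewrite big_cons exists_cons; apply: le_trans (measureU2 _ _ _) _ => //.
  exact: measurable_exists_seq.
by rewrite leeD2l.
Qed.

Lemma measure_exists : (forall i j x, F i x -> F j x -> i = j) ->
  mu [set x | exists j, F j x] = (\sum_j mu (F j))%E.
Proof.
move=> disj; rewrite exists_setE; have := index_enum_uniq J.
elim: (index_enum J) => [_|j s IH /= /andP[js us]].
  rewrite big_nil (_ : [set x | _] = set0) ?measure0//.
  by apply/seteqP; split => x // [k].
have ms := measurable_exists_seq s.
rewrite big_cons exists_cons measureU//; first by congr (_ + _)%E; exact: IH.
apply/seteqP; split => x // [Fj [i si Fi]].
by move: js; rewrite (disj _ _ _ Fj Fi) si.
Qed.

End finite_unions.

(** * Pieces, blocks, tubes and the cells that cover them *)

Section kakeya_geometry.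
Context {R : realType} {d : nat}.
Variables (e : 'I_d) (a : 'I_d -> R) (g : 'rV[R]_d -> R) (lam : R) (m : nat).
Hypotheses (a0 : forall i, 0 < a i) (ga : tame a g).
Hypotheses (lam0 : 0 < lam) (m0 : (0 < m)%N).
(* A block has [m ^ m] pieces; the square pays for the second-order term in the
   expansion of the velocities along it. *)
Hypothesis small : ((m ^ m) ^ 2)%:R * lam <= a e.
Notation e_ i := (delta_mx 0 i : 'rV[R]_d).
Notation N := (m ^ m)%N.

Definition piece_side i : R := Num.min (a i) lam.
Definition block_side i : R := if i == e then N%:R * lam else piece_side i.
Definition block_count i : nat := Num.truncn (a i / block_side i).
Definition block : finType := {dffun forall i : 'I_d, 'I_(block_count i)}.
Definition piece_index : finType := (block * 'I_N)%type.

(** The grid of blocks starts at the origin and fills part of the positive orthant; the base is the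
    centre of the first piece of a block. *)
Definition base (be : block) : 'rV[R]_d :=
  \row_i ((be i)%:R * block_side i + piece_side i / 2).
Definition center (j : piece_index) : 'rV[R]_d := base j.1 + (j.2%:R * lam) *: e_ e.
Definition kpiece (j : piece_index) := cbox (center j) (fun i => piece_side i / 2).

Lemma N_gt0 : (0 < N)%N. Proof. by rewrite expn_gt0 m0. Qed.

Lemma N_lam_le : N%:R * lam <= a e.
Proof.
apply: le_trans small; rewrite ler_pM2r// ler_nat -{1}(expn1 N).
by rewrite leq_pexp2l// N_gt0.
Qed.

Lemma lam_le : lam <= a e.
Proof. by apply: le_trans N_lam_le; rewrite ler_peMl ?(ltW lam0)// ler1n N_gt0. Qed.

Lemma piece_side_e : piece_side e = lam.
Proof. by rewrite /piece_side min_r// lam_le. Qed.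

Lemma piece_side_gt0 i : 0 < piece_side i.
Proof. by rewrite /piece_side lt_min a0 lam0. Qed.

Lemma piece_side_le_lam i : piece_side i <= lam.
Proof. by rewrite /piece_side ge_min lexx orbT. Qed.

Lemma block_side_gt0 i : 0 < block_side i.
Proof.
by rewrite /block_side; case: ifP => _; rewrite ?mulr_gt0 ?ltr0n ?N_gt0 ?piece_side_gt0.
Qed.

Lemma block_side_le i : block_side i <= a i.
Proof.
rewrite /block_side; case: eqP => [->|_]; first exact: N_lam_le.
by rewrite /piece_side ge_min lexx.
Qed.

Lemma block_count_gt0 i : (0 < block_count i)%N.
Proof.
by rewrite /block_count truncn_gt0 ler_pdivlMr ?block_side_gt0// mul1r block_side_le.
Qed.

Lemma block_count_le i : (block_count i)%:R * block_side i <= a i.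
Proof.
rewrite -ler_pdivlMr ?block_side_gt0//.
have : 0 <= a i / block_side i by rewrite divr_ge0 ?(ltW (a0 i)) ?(ltW (block_side_gt0 i)).
by move=> /truncn_itv/andP[].
Qed.

(** The quotient is at least 1, so rounding it down at most halves it. *)
Lemma block_count_ge i : a i / 2 <= (block_count i)%:R * block_side i.
Proof.
have bs := block_side_gt0 i.
have : 0 <= a i / block_side i by rewrite divr_ge0 ?(ltW (a0 i)) ?(ltW bs).
move=> /truncn_itv/andP[_]; rewrite -/(block_count i) ltr_pdivrMr// -natr1 => h.
have : 1 <= (block_count i)%:R :> R by rewrite ler1n block_count_gt0.
by nra.
Qed.

Lemma card_block : #|block| = (\prod_i block_count i)%N.
Proof.
rewrite card_dep_ffun foldrE big_image/=.
by apply: eq_bigr => i _; rewrite card_ord.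
Qed.

Lemma card_pieceE : #|piece_index|%:R * \prod_i piece_side i =
  \prod_i ((block_count i)%:R * block_side i).
Proof.
rewrite card_prod card_block card_ord natrM natr_prod big_split/= -mulrA; congr (_ * _).
rewrite (bigD1 e)//= [RHS](bigD1 e)//= mulrA piece_side_e {1}/block_side eqxx.
by congr (_ * _); apply: eq_bigr => i ie; rewrite /block_side (negbTE ie).
Qed.

Lemma card_piece_le : #|piece_index|%:R * \prod_i piece_side i <= \prod_i a i.
Proof.
rewrite card_pieceE; apply: ler_prod => i _; rewrite block_count_le andbT.
by rewrite mulr_ge0 ?(ltW (block_side_gt0 i)).
Qed.

Lemma card_piece_ge : (2^-1) ^+ d * \prod_i a i <= #|piece_index|%:R * \prod_i piece_side i.
Proof.
rewrite card_pieceE -[d in _ ^+ d](card_ord d) -prodr_const -big_split/=.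
apply: ler_prod => i _; rewrite mulr_ge0 ?invr_ge0 ?(ltW (a0 i))//= mulrC.
exact: block_count_ge.
Qed.

Lemma centerE (j : piece_index) i : center j 0 i =
  (j.1 i)%:R * block_side i + (if i == e then j.2%:R * lam else 0) + piece_side i / 2.
Proof.
rewrite !mxE eqxx/=; case: eqVneq => [->|_]; first by rewrite mulr1 addrAC.
by rewrite mulr0 !addr0.
Qed.

Lemma kpiece_itv j xi i : kpiece j xi ->
  (j.1 i)%:R * block_side i + (if i == e then j.2%:R * lam else 0) < xi 0 i <
  (j.1 i)%:R * block_side i + (if i == e then j.2%:R * lam else 0) + piece_side i.
Proof.
move=> /(_ i); rewrite centerE ltr_distl; set u := _ * _ + (if _ then _ else _).
by move: (piece_side i) (xi 0 i) u => b x u /andP[h1 h2]; apply/andP; split; lra.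
Qed.

Lemma block_end (j : piece_index) i : (j.1 i)%:R * block_side i + (if i == e then j.2%:R * lam else 0) +
  piece_side i <= (j.1 i).+1%:R * block_side i.
Proof.
rewrite -natr1 mulrDl mul1r -addrA lerD2l /block_side; case: eqVneq => [->|_].
  rewrite piece_side_e -[X in _ + X]mul1r -mulrDl ler_pM2r// natr1 ler_nat.
  exact: ltn_ord.
by rewrite add0r.
Qed.

Lemma kpiece_sub j : kpiece j `<=` rbox a.
Proof.
move=> xi jx i; have /andP[h1 h2] := kpiece_itv i jx; have h3 := block_end j i.
have h4 := block_count_le i.
have h5 : (j.1 i).+1%:R * block_side i <= (block_count i)%:R * block_side i.
  by rewrite ler_pM2r ?block_side_gt0// ler_nat ltn_ord.
have h6 : 0 <= (j.1 i)%:R * block_side i + (if i == e then j.2%:R * lam else 0).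
  by rewrite addr_ge0 ?mulr_ge0 ?(ltW (block_side_gt0 i))//; case: ifP => // _; rewrite mulr_ge0// ltW.
rewrite gtr0_norm ?(le_lt_trans h6 h1)//.
exact: lt_le_trans h2 (le_trans h3 (le_trans h5 h4)).
Qed.

Lemma grid_unique (s x : R) (n n' : nat) : 0 < s ->
  n%:R * s < x < n.+1%:R * s -> n'%:R * s < x < n'.+1%:R * s -> n = n'.
Proof.
move=> s0 /andP[h1 h2] /andP[h3 h4]; apply/eqP; rewrite eqn_leq.
have := lt_trans h1 h4; have := lt_trans h3 h2.
by rewrite !ltr_pM2r// !ltr_nat !ltnS => -> ->.
Qed.

(** The coarse grid determines the block; inside it, the grid of step [lam] in direction [e]
    determines the piece. *)
Lemma kpiece_disjoint i j xi : kpiece i xi -> kpiece j xi -> i = j.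
Proof.
move=> ix jx.
have bs (j' : piece_index) k : kpiece j' xi ->
    (j'.1 k)%:R * block_side k < xi 0 k < (j'.1 k).+1%:R * block_side k.
  move=> j'x; have /andP[h1 h2] := kpiece_itv k j'x.
  rewrite (lt_le_trans h2 (block_end _ _)) andbT; apply: le_lt_trans h1.
  by rewrite lerDl; case: ifP => // _; rewrite mulr_ge0// ltW.
have E1 : i.1 = j.1.
  apply/ffunP => k; apply/val_inj.
  exact: (grid_unique (block_side_gt0 k) (bs _ _ ix) (bs _ _ jx)).
have E2 : i.2 = j.2.
  apply/val_inj; apply: (@grid_unique lam (xi 0 e - (j.1 e)%:R * block_side e)) => //.
    have := kpiece_itv e ix; rewrite eqxx E1 piece_side_e -natr1 => /andP[h1 h2].
    by apply/andP; split; lra.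
  have := kpiece_itv e jx; rewrite eqxx piece_side_e -natr1 => /andP[h1 h2].
  by apply/andP; split; lra.
by move: E1 E2; case: (i) => u1 u2; case: (j) => v1 v2 /= -> ->.
Qed.

Lemma measure_kpiece j : lebesgue_row d (kpiece j) = (\prod_i piece_side i)%:E.
Proof.
rewrite lebesgue_cbox => [|i]; last by rewrite divr_gt0// piece_side_gt0.
by congr EFin; apply: eq_bigr => i _; rewrite mulrC divfK.
Qed.

Notation c := (@small_const R d).
Notation D1 i := ('D_(e_ i) g).

Lemma center_in j : kpiece j (center j).
Proof. by move=> i; rewrite subrr normr0 divr_gt0// piece_side_gt0. Qed.

Lemma baseE be : base be = center (be, Ordinal N_gt0).
Proof. by rewrite /center /= mul0r scale0r addr0. Qed.

Lemma center_rbox j : rbox a (center j).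
Proof. by apply: (@kpiece_sub j); exact: center_in. Qed.

Lemma base_line_rbox (j : piece_index) u : 0 <= u <= j.2%:R * lam -> rbox a (base j.1 + u *: e_ e).
Proof.
move=> /andP[u0 us] i; have cj := center_rbox j i.
have bp : 0 < base j.1 0 i.
  rewrite mxE ltr_wpDl ?divr_gt0 ?piece_side_gt0// mulr_ge0// ltW//.
  exact: block_side_gt0.
move: cj bp; rewrite !mxE eqxx/=; move: (_ + _ / 2) => b.
case: (i == e); rewrite ?mulr1 ?mulr0 ?addr0// => + b0.
by rewrite !gtr0_norm; lra.
Qed.

(** The rate of change of the velocity [grad g] along the block; [lam] times it is the common
    difference of the approximate arithmetic progression. *)
Definition slope be i : R := 'D_(e_ e) (D1 i) (base be).

Lemma slope_le be i : `|slope be i| <= 3.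
Proof. by apply: (tame_hess ga); rewrite baseE; exact: center_rbox. Qed.

(** The third derivatives [D_e D_e D_i g] are at most [1 / a e], so the deviation from linear growth
    over a block is at most [(N lam)^2 / a e], which [small] bounds by [lam]. *)
Lemma velocity_linear (j : piece_index) i :
  `|D1 i (center j) - D1 i (base j.1) - j.2%:R * lam * slope j.1 i| <= lam.
Proof.
set s := j.2%:R * lam; have s0 : 0 <= s by rewrite mulr_ge0// ltW.
have sgn (u v : R) : 0 <= v -> `|u| <= `|v| -> 0 <= u * v -> 0 <= u <= v.
  move=> v0; rewrite (ger0_norm v0) ler_norml => /andP[h1 h2] uv; rewrite h2 andbT.
  have [v00|vn0] := eqVneq v 0; first by move: h1; rewrite v00 oppr0.
  by move: uv; rewrite pmulr_lge0// lt_def vn0.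
have ae := a0 e.
have step1 u : 0 <= u <= s -> `|'D_(e_ e) (D1 i) (base j.1 + u *: e_ e) - slope j.1 i|
    <= (a e)^-1 * u.
  move=> /andP[u0 us]; rewrite -[X in _ * X](ger0_norm u0) /slope.
  apply: (@line_mean_value R d ('D_(e_ e) (D1 i)) (base j.1) (e_ e) u (a e)^-1) => w w1 w2;
    have /andP[w3 w4] := sgn _ _ u0 w1 w2.
    by apply: (tame_d3 ga); apply: base_line_rbox; rewrite w3 (le_trans w4).
  by apply: (tame_third ga); apply: base_line_rbox; rewrite w3 (le_trans w4).
pose F := D1 i - (slope j.1 i \*: (fun z : 'rV[R]_d => z 0 e)).
have dF u : 0 <= u <= s -> is_derive (base j.1 + u *: e_ e) (e_ e) F
    ('D_(e_ e) (D1 i) (base j.1 + u *: e_ e) - slope j.1 i).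
  move=> us; apply: is_deriveB.
    by apply: derivableP; apply: (tame_d2 ga); exact: base_line_rbox.
  have := is_deriveZ (slope j.1 i) (is_derive_coord (base j.1 + u *: e_ e) (e_ e) e).
  by rewrite mxE !eqxx [slope _ _ *: _]mulr1.
have : `|F (base j.1 + s *: e_ e) - F (base j.1)| <= (a e)^-1 * s * `|s|.
  apply: (@line_mean_value R d F (base j.1) (e_ e) s ((a e)^-1 * s)) => w w1 w2; have ws := sgn _ _ s0 w1 w2.
    by have [] := dF w ws.
  have [_ ->] := dF w ws; rewrite (le_trans (step1 w ws))// ler_pM2l ?invr_gt0//.
  by case/andP: ws.
rewrite (ger0_norm s0) -/(center j) => H.
have -> : D1 i (center j) - D1 i (base j.1) - s * slope j.1 i = F (center j) - F (base j.1).
  rewrite /F !fctE /=.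
  have -> : center j 0 e = base j.1 0 e + s by rewrite /center !mxE !eqxx mulr1.
  rewrite /GRing.scale/=; ring.
apply: le_trans H _; rewrite -mulrA ler_pdivrMl//.
have sN : s <= N%:R * lam by rewrite ler_pM2r// ler_nat ltnW.
apply: (@le_trans _ _ (N%:R * lam * (N%:R * lam))); first by rewrite ler_pM.
have -> : N%:R * lam * (N%:R * lam) = (N ^ 2)%:R * lam * lam.
  by rewrite (natrX _ N 2); set n := N%:R; ring.
by rewrite ler_pM2r.
Qed.

Lemma velocity_le x i : rbox a x -> `|D1 i x| <= 3 * \sum_k a k.
Proof.
move=> ax; pose A k : set R := [set u | `|u| < a k].
have iA k : is_interval (A k).
  move=> u v; rewrite /A/= => u2 v2 w /andP[uw wv].
  by move: u2 v2; rewrite /= !ltr_norml => /andP[h1 h2] /andP[h3 h4]; apply/andP; split; lra.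
have := @cell_mean_value _ _ A (D1 i) (fun=> 3) 0 x iA (fun k z => @tame_d2 _ _ _ _ ga k i z)
  (fun k z => @tame_hess _ _ _ _ ga k i z) (rbox0 a0) ax.
rewrite (tame_grad0 ga) subr0 => /le_trans; apply.
rewrite mulr_sumr; apply: ler_sum => k _; rewrite ler_pM2l// mxE subr0 ltW//; exact: ax.
Qed.

(** Chosen so that [duration * lam^2] is the small constant: second-order phase variations over a
    piece stay small for this long. *)
Definition duration : R := c * lam ^- 2.
(** The tube has centre [pshift j - t * grad g (center j)] at time [t]. Up to [t * lam], this is a
    motion common to the block plus [duration * lam * slope] times
    [pinned_shift m nu - nu * t / duration], with [nu] the position in the block: the quantity
    treated in [compression]. *)
Definition pshift (j : piece_index) : 'rV[R]_d :=
  \row_i (duration * lam * pinned_shift m j.2 * slope j.1 i).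

Variable nsl : nat.
Hypothesis nsl0 : (0 < nsl)%N.
(* Velocities are at most [3 * \sum_i a i], so during one time slice a tube moves
   by less than its radius and may be replaced by a slab. *)
Hypothesis nsl_large : 3 * \sum_i a i <= 2 * nsl%:R * lam.

Definition slice_time (k : 'I_nsl) : R := (k%:R + 2^-1) * (duration / nsl%:R).
Definition slice_half : R := duration / (2 * nsl%:R).
Definition tube_radius i : R := c / piece_side i.
Definition tube_pos j k : 'rV[R]_d := \row_i (pshift j 0 i - slice_time k * D1 i (center j)).
Definition tube j k := slab (slice_time k) (tube_pos j k) slice_half tube_radius.

Lemma duration_gt0 : 0 < duration.
Proof. by rewrite mulr_gt0 ?small_const_gt0// invr_gt0 exprn_gt0. Qed.

Lemma slice_half_gt0 : 0 < slice_half.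
Proof. by rewrite divr_gt0 ?duration_gt0// mulr_gt0// ltr0n. Qed.

Lemma tube_radius_gt0 i : 0 < tube_radius i.
Proof. by rewrite divr_gt0 ?small_const_gt0 ?piece_side_gt0. Qed.

Lemma slice_time_itv k : 0 <= slice_time k <= duration.
Proof.
have n0 : 0 < nsl%:R :> R by rewrite ltr0n.
have d0 : 0 <= duration / nsl%:R by rewrite divr_ge0 ?(ltW duration_gt0).
apply/andP; split; first by rewrite mulr_ge0// addr_ge0.
rewrite /slice_time mulrCA ler_piMr ?(ltW duration_gt0)// ler_pdivrMr// mul1r.
have : k.+1%:R <= nsl%:R :> R by rewrite ler_nat.
by rewrite -natr1; lra.
Qed.

Lemma tube_time j k tx : tube j k tx -> `|lsubmx tx 0 0| <= duration.
Proof.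
move=> [+ _]; rewrite ltr_distl /slice_half /slice_time => /andP[h1 h2].
have n0 : 0 < nsl%:R :> R by rewrite ltr0n.
set w := duration / nsl%:R in h1 h2.
have w0 : 0 < w by rewrite divr_gt0// duration_gt0.
have wE : duration / (2 * nsl%:R) = w / 2.
  by rewrite /w invfM; ring.
have dE : duration = w * nsl%:R by rewrite /w divfK// gt_eqF.
rewrite wE in h1 h2.
have kn : k.+1%:R <= nsl%:R :> R by rewrite ler_nat.
have k0 : 0 <= k%:R :> R by [].
rewrite -natr1 in kn; rewrite dE ler_norml; apply/andP; split; nra.
Qed.

(** The phase minus its value at the centre of the piece is [t] times the Taylor remainder of [g],
    plus [(x - y + t v) . (xi - center)] with [v] the velocity. The first part is at most [c * d^2]
    because [duration * lam^2 = c]; each coordinate of the second contributes at most [2 c / side]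
    times [side / 2]. *)
Lemma phase_tube j k tx xi : tube j k tx -> kpiece j xi ->
  `|phase g (pshift j) tx xi - (lsubmx tx 0 0 * g (center j) + dot (rsubmx tx) (center j)
     - dot (pshift j) (center j))| <= 2^-1.
Proof.
move=> Ttx Bxi; set t := lsubmx tx 0 0; set x := rsubmx tx.
have cE := @small_const_le R d; have c0 := @small_const_gt0 R d.
pose v i := D1 i (center j).
have -> : phase g (pshift j) tx xi - (t * g (center j) + dot x (center j) -
    dot (pshift j) (center j)) =
    t * (g xi - g (center j) - \sum_i v i * (xi 0 i - center j 0 i)) +
    \sum_i (x 0 i - pshift j 0 i + t * v i) * (xi 0 i - center j 0 i).
  rewrite mulrBr mulr_sumr /phase /dot.
  rewrite [X in _ = _ + X](eq_bigr (fun i => x 0 i * xi 0 i - pshift j 0 i * xi 0 i -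
    x 0 i * center j 0 i + pshift j 0 i * center j 0 i +
    t * (v i * (xi 0 i - center j 0 i)))); last by move=> i _; ring.
  rewrite !big_split/= !sumrN -/t -/x; ring.
have xic i : `|xi 0 i - center j 0 i| <= piece_side i / 2 by apply/ltW; exact: Bxi.
have b1 : `|t * (g xi - g (center j) - \sum_i v i * (xi 0 i - center j 0 i))| <= c * d%:R ^+ 2.
  rewrite normrM; apply: (@le_trans _ _ (duration * (3 * (\sum_(i < d) lam / 2) ^+ 2))).
    apply: ler_pM => //; first exact: tube_time Ttx.
    apply: le_trans (taylor2 ga (center_rbox j) (kpiece_sub Bxi) xic) _.
    rewrite ler_pM2l// lerXn2r ?nnegrE ?sumr_ge0// => [i _|i _|].
    + by rewrite divr_ge0// ltW// piece_side_gt0.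
    + by rewrite divr_ge0// ltW.
    + by apply: ler_sum => i _; rewrite ler_pM2r// piece_side_le_lam.
  rewrite sumr_const card_ord -[_ *+ d]mulr_natr exprMn /duration.
  have -> : c * lam ^- 2 * (3 * ((lam / 2) ^+ 2 * d%:R ^+ 2)) = 3 / 4 * (c * d%:R ^+ 2).
    by field; rewrite gt_eqF.
  by rewrite ler_piMl ?mulr_ge0 ?(ltW c0)//; lra.
have b2 : `|\sum_i (x 0 i - pshift j 0 i + t * v i) * (xi 0 i - center j 0 i)| <= c * d%:R.
  rewrite (le_trans (ler_norm_sum _ _ _))// mulr_natr.
  have -> : c *+ d = \sum_(i < d) c by rewrite sumr_const card_ord.
  apply: ler_sum => i _; rewrite normrM.
  have bi := piece_side_gt0 i.
  (* One radius for the distance to the centre of the slab, one for the motion of the tube during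
     half a slice. *)
  apply: (@le_trans _ _ (2 * tube_radius i * (piece_side i / 2))); last first.
    by rewrite /tube_radius le_eqVlt; apply/orP; left; apply/eqP; field; rewrite gt_eqF.
  apply: ler_pM => //.
  case: Ttx => /= ht /(_ i) hx; rewrite -/t -/x in ht hx.
  have -> : x 0 i - pshift j 0 i + t * v i =
      (x 0 i - tube_pos j k 0 i) + (t - slice_time k) * v i.
    by rewrite [tube_pos _ _ _ _]mxE /v; ring.
  rewrite mulr_natl mulr2n (le_trans (ler_normD _ _))// lerD//; first exact: ltW.
  rewrite normrM; apply: (@le_trans _ _ (slice_half * (2 * nsl%:R * lam))).
    apply: ler_pM => //; first exact: ltW.
    by rewrite (le_trans (velocity_le _ (center_rbox j))).
  have -> : slice_half * (2 * nsl%:R * lam) = c / lam.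
    rewrite /slice_half /duration; field; rewrite gt_eqF//= pnatr_eq0 -lt0n; exact: nsl0.
  by rewrite /tube_radius ler_pM2l// lef_pV2 ?posrE// piece_side_le_lam.
rewrite (le_trans (ler_normD _ _))//.
have dd : 0 <= d%:R :> R by [].
nra.
Qed.

Variable Z : 'I_nsl -> nat -> R.
Hypothesis ZP : forall k nu, (nu < N)%N -> exists2 z, (z < 5 * m ^ m.-1)%N &
  `|pinned_shift m nu - nu%:R * (slice_time k / duration) - Z k z| <= 1.

Definition kcell_index : finType := (block * 'I_nsl * 'I_(5 * m ^ m.-1))%type.
(** Of the factor 5 in the radius, 1 is for the tube itself, 3 for the unit error of [compression]
    multiplied by a slope of at most 3, and 1 for the nonlinearity of the velocities. Each block and
    slice has [5 * m ^ m.-1] cells, against [m ^ m] tubes. *)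
Definition kcell (w : kcell_index) := slab (slice_time w.1.2)
  (\row_i (duration * lam * slope w.1.1 i * Z w.1.2 w.2 - slice_time w.1.2 * D1 i (base w.1.1)))
  slice_half (fun i => 5 * tube_radius i).

Lemma tube_kcell j k tx : tube j k tx -> exists w, kcell w tx.
Proof.
move=> [ht hx]; have [z zm zP] := ZP k (ltn_ord j.2).
exists (j.1, k, Ordinal zm); split => //= i.
have h1 := hx i; rewrite -(subrKA (tube_pos j k 0 i)) (le_lt_trans (ler_normD _ _))//.
rewrite (_ : 5 * tube_radius i = tube_radius i + 4 * tube_radius i); last by ring.
apply: ltr_leD => //.
have dur := duration_gt0; have /andP[t0 t1] := slice_time_itv k.
(* The distance between the two centres splits into the compression error and the deviation bounded
   by [velocity_linear]. *)
have -> : tube_pos j k 0 i - (\row_i0 (duration * lam * slope j.1 i0 * Z k z -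
      slice_time k * D1 i0 (base j.1))) 0 i =
    duration * lam * slope j.1 i *
      (pinned_shift m j.2 - j.2%:R * (slice_time k / duration) - Z k z)
    - slice_time k * (D1 i (center j) - D1 i (base j.1) - j.2%:R * lam * slope j.1 i).
  by rewrite !mxE; field; rewrite gt_eqF.
have dl : duration * lam <= tube_radius i.
  have -> : duration * lam = c / lam by rewrite /duration; field; rewrite gt_eqF.
  rewrite /tube_radius ler_pM2l ?small_const_gt0// lef_pV2 ?posrE ?piece_side_gt0//.
  exact: piece_side_le_lam.
have dl0 : 0 <= duration * lam by rewrite mulr_ge0 ?ltW.
have e1 : `|duration * lam * slope j.1 i *
    (pinned_shift m j.2 - j.2%:R * (slice_time k / duration) - Z k z)| <= tube_radius i * 3 * 1.
  set DL := duration * lam in dl dl0 *.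
  rewrite (normrM (DL * slope j.1 i)) (normrM DL) (ger0_norm dl0).
  apply: ler_pM => //; first by rewrite mulr_ge0.
  by apply: ler_pM => //; exact: slope_le.
have e2 : `|slice_time k * (D1 i (center j) - D1 i (base j.1) - j.2%:R * lam * slope j.1 i)|
    <= duration * lam.
  rewrite (normrM (slice_time k)) (ger0_norm t0).
  by rewrite ler_pM// velocity_linear.
rewrite (le_trans (ler_normB _ _))//.
lra.
Qed.

End kakeya_geometry.

(** * Square integrals of packets over compressed tubes *)

Section kakeya_packet.
Context {R : realType} {d : nat}.
Variables (l : 'I_d -> \bar R) (e : 'I_d) (a : 'I_d -> R) (g : 'rV[R]_d -> R) (lam : R) (m : nat).
Hypotheses (a0 : forall i, 0 < a i) (ga : tame a g) (al : rbox a `<=` box l).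
Hypotheses (lam0 : 0 < lam) (m0 : (0 < m)%N).
Hypothesis small : ((m ^ m) ^ 2)%:R * lam <= a e.
Notation c := (@small_const R d).
Notation cmod := (@ComplexField.Normc.normc R).
Notation side := (piece_side a lam).
Notation dur := (@duration R d lam).
Notation mu := (lebesgue_row (1 + d)).

Lemma Rintegral_subset_ge {dd} {T : measurableType dd} (nu : {measure set T -> \bar R})
    (A S : set T) (f : T -> R) : measurable A -> measurable S -> (nu S < +oo)%E -> A `<=` S ->
  mbounded S f -> (forall x, 0 <= f x) ->
  \int[nu]_(x in A) f x <= \int[nu]_(x in S) f x.
Proof.
move=> mA mS fS AS bf f0; have iS := mbounded_integrable mS fS bf.
rewrite /Rintegral fine_le//.
- by apply: integrable_fin_num => //; exact: integrableS iS.
- exact: integrable_fin_num.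
- apply: ge0_subset_integral => //; last by move=> x _; rewrite lee_fin.
  by apply/measurable_EFinP; case: bf.
Qed.

Definition packet_const : R := c ^+ d.+1 / 8.

(** Half of the guaranteed mean of the squared modulus over the union: with [beta] the measure of a
    piece, the square integral is at least [beta^2 / 4] times the total measure of the tubes, and
    the union has at most [5^(d+1) / m] times that total. *)
Definition packet_level : R := (\prod_i side i) ^+ 2 * m%:R / (8 * 5 ^+ d.+1).

Lemma packet_const_gt0 : 0 < packet_const.
Proof. by rewrite divr_gt0// exprn_gt0// small_const_gt0. Qed.

(** Subtracting [packet_level] times the measure of the union leaves at least [beta^2 / 8] times the
    total measure of the tubes, and counting pieces turns this into a multiple of [lam^-2 * prod a].
    The sup bound comes from adding one [beta] per piece in the real and in the imaginary part. *)
Lemma kakeya_packet : exists (J : finType) (B : J -> set 'rV[R]_d) (y : J -> 'rV[R]_d)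
    (eps : J -> R) (S : set 'rV[R]_(1 + d)),
  ((forall j, admissible g (B j)) /\ (forall i j x, B i x -> B j x -> i = j) /\
   (forall j, eps j ^+ 2 = 1) /\ (forall j, B j `<=` rbox a)) /\
  (measurable S /\ (mu S < +oo)%E /\
   (forall tx, cmod (extension l g (packet B y eps) tx) <= 2 * \prod_i a i) /\
   packet_const * lam ^- 2 * \prod_i a i <=
     \int[mu]_(tx in S) (cmod (extension l g (packet B y eps) tx) ^+ 2) -
     packet_level * fine (mu S)).
Proof.
have c0 := @small_const_gt0 R d.
pose nsl := (Num.truncn (3 * (\sum_i a i) / (2 * lam))).+1.
have nsl_large : 3 * \sum_i a i <= 2 * nsl%:R * lam.
  have h : 0 <= 3 * (\sum_i a i) / (2 * lam).
    by rewrite divr_ge0 ?mulr_ge0 ?(ltW lam0)// sumr_ge0// => i _; exact: ltW.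
  have /andP[_ /ltW] := truncn_itv h.
  by rewrite ler_pdivrMr ?mulr_gt0// -/nsl; rewrite mulrA [nsl%:R * 2]mulrC.
have nsl0 : (0 < nsl)%N by [].
have nR : 0 < nsl%:R :> R by rewrite ltr0n.
have dur0 : 0 < dur by exact: duration_gt0.
have [Z ZP] : {Z : 'I_nsl -> nat -> R & forall k nu, (nu < m ^ m)%N ->
    exists2 z, (z < 5 * m ^ m.-1)%N &
    `|pinned_shift m nu - nu%:R * (@slice_time R d lam nsl k / dur) - Z k z| <= 1}.
  apply: (@choice 'I_nsl (nat -> R) (fun k Z => forall nu, (nu < m ^ m)%N ->
    exists2 z, (z < 5 * m ^ m.-1)%N &
    `|pinned_shift m nu - nu%:R * (@slice_time R d lam nsl k / dur) - Z z| <= 1)) => k.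
  apply: compression => //; have /andP[t0 t1] := slice_time_itv (d := d) lam0 nsl0 k.
  by rewrite divr_ge0 ?(ltW dur0)//= ler_pdivrMr// mul1r.
pose J := piece_index e a lam m.
pose B (j : J) := kpiece j; pose y (j : J) := pshift g j.
have Ba (j : J) : B j `<=` rbox a by exact: kpiece_sub.
have aB (j : J) : admissible g (B j).
  by apply: (tame_admissible ga a0) => //; exact: measurable_cbox.
have disj (i j : J) x : B i x -> B j x -> i = j by exact: kpiece_disjoint.
have Bl (j : J) : B j `<=` box l by exact: subset_trans (Ba j) al.
set beta := \prod_i side i.
have beta0 : 0 < beta by apply: prodr_gt0 => i _; exact: piece_side_gt0.
have muB (j : J) : fine (lebesgue_row d (B j)) = beta by rewrite measure_kpiece.
pose rho := \prod_i (2 * tube_radius a lam i : R).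
have rho0 : 0 < rho.
  by apply: prodr_gt0 => i _; rewrite mulr_gt0// tube_radius_gt0.
have rhoE : rho = (2 * c) ^+ d / beta.
  rewrite /rho /tube_radius; under eq_bigr do rewrite mulrA.
  by rewrite big_split/= prodr_const card_ord prodfV.
pose half := @slice_half R d lam nsl.
have half0 : 0 < half by exact: slice_half_gt0.
have halfE : nsl%:R * (2 * half) = dur.
  by rewrite /half /slice_half; field; rewrite pnatr_eq0.
pose W := kcell_index e a lam m nsl.
pose C (w : W) := kcell g Z w.
have mC w : measurable (C w) by exact: measurable_slab.
pose S := [set tx | exists w, C w tx].
have mS : measurable S by exact: measurable_exists.
have muC w : mu (C w) = (2 * half * (5 ^+ d * rho))%:E.
  rewrite lebesgue_slab// => [|i]; last by rewrite mulr_gt0// tube_radius_gt0.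
  congr ((_ * _)%:E); rewrite /rho -[d in 5 ^+ d](card_ord d) -prodr_const -big_split/=.
  by apply: eq_bigr => i _; rewrite mulrCA.
have muSle : (mu S <= (#|W|%:R * (2 * half * (5 ^+ d * rho)))%:E)%E.
  apply: le_trans (measure_exists_le _ mC) _.
  rewrite (eq_bigr (fun=> (2 * half * (5 ^+ d * rho))%:E)); last by move=> w _; exact: muC.
  by rewrite sumEFin sumr_const lee_fin [#|W|%:R * _]mulr_natl; exact: lexx.
have fS : (mu S < +oo)%E by apply: le_lt_trans muSle _; exact: ltry.
pose u (j : J) := wave_cos g (B j) (y j); pose v (j : J) := wave_sin g (B j) (y j).
have bu j : mbounded S (u j).
  split; first exact: measurable_funS (measurable_wave_cos (y j) (aB j)).
  by exists beta => x _; rewrite -(muB j); exact: wave_cos_le.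
have bv j : mbounded S (v j).
  split; first exact: measurable_funS (measurable_wave_sin (y j) (aB j)).
  by exists beta => x _; rewrite -(muB j); exact: wave_sin_le.
have [eps [eps1 epsE]] := sign_selection mS fS bu bv.
exists J, B, y, eps, S; split; first by split.
do 2 split => //; split.
  move=> tx; rewrite normcE (Re_extension_packet y eps aB Bl) (Im_extension_packet y eps aB Bl).
  have eps_norm j : `|eps j| = 1.
    by apply/eqP; rewrite -(@eqrXn2 _ 2)// ?expr1n -?normrX ?eps1 ?normr1.
  have sumle (f : J -> R) : (forall j, `|f j| <= beta) ->
      (\sum_j eps j * f j) ^+ 2 <= (\prod_i a i) ^+ 2.
    move=> fb; have P0 : 0 <= \prod_i a i by apply: prodr_ge0 => i _; exact: ltW.
    rewrite -[leLHS]ger0_norm ?sqr_ge0// normrX lerXn2r ?nnegrE//.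
    apply: le_trans (ler_norm_sum _ _ _) _.
    apply: le_trans (card_piece_le a0 lam0 m0 small).
    rewrite mulr_natl -sumr_const; apply: ler_sum => j _.
    by rewrite normrM eps_norm mul1r; exact: fb.
  have P0 : 0 <= 2 * \prod_i a i by rewrite mulr_ge0// prodr_ge0// => i _; exact: ltW.
  rewrite -[leRHS]ger0_norm// -sqrtr_sqr ler_wsqrtr//.
  have h1 : (\sum_j eps j * u j tx) ^+ 2 <= (\prod_i a i) ^+ 2.
    by apply: sumle => j; rewrite -(muB j); exact: wave_cos_le.
  have h2 : (\sum_j eps j * v j tx) ^+ 2 <= (\prod_i a i) ^+ 2.
    by apply: sumle => j; rewrite -(muB j); exact: wave_sin_le.
  rewrite exprMn; apply: le_trans (lerD h1 h2) _.
  by have := sqr_ge0 (\prod_i a i); lra.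
(* [theta] is the total measure of the tubes counted with multiplicity, [dur * rho] for each. *)
pose nJ : R := #|J|%:R; pose theta := nJ * dur * rho.
have lower j : beta ^+ 2 / 4 * (dur * rho) <= \int[mu]_(x in S) (u j x ^+ 2 + v j x ^+ 2).
  pose T := [set tx | exists k : 'I_nsl, tube g j k tx].
  have mt k : measurable (tube g j k : set 'rV[R]_(1 + d)) by exact: measurable_slab.
  have mT : measurable T by exact: measurable_exists.
  have TS : T `<=` S by move=> tx [k] /(tube_kcell a0 ga lam0 m0 small nsl0 ZP).
  (* The slabs of one tube occupy disjoint time slices, so their measures add exactly. *)
  have muT : mu T = (dur * rho)%:E.
    have in_slice (k : 'I_nsl) (t : R) : `|t - @slice_time R d lam nsl k| < half ->
        k%:R * (dur / nsl%:R) < t < k.+1%:R * (dur / nsl%:R).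
      rewrite ltr_distl /slice_time -[k.+1%:R]natr1.
      have -> : half = dur / nsl%:R / 2 by rewrite /half /slice_half; field; rewrite pnatr_eq0.
      set w := dur / nsl%:R; rewrite !mulrDl !mul1r; set n := k%:R * w.
      by move=> /andP[h1 h2]; apply/andP; split; lra.
    rewrite measure_exists//; last first.
      move=> k k' tx [h _] [h' _]; apply/val_inj.
      apply: (@grid_unique _ (dur / nsl%:R) (lsubmx tx 0 0)); first by rewrite divr_gt0.
        exact: in_slice.
      exact: in_slice.
    rewrite (eq_bigr (fun=> (2 * half * rho)%:E)); last first.
      move=> k _; rewrite lebesgue_slab// => i; exact: tube_radius_gt0.
    by rewrite sumEFin sumr_const card_ord -[_ *+ nsl]mulr_natl mulrA halfE.
  have bq : mbounded S (fun x => u j x ^+ 2 + v j x ^+ 2).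
    by apply: mboundedD; exact: mboundedX2.
  apply: le_trans (Rintegral_subset_ge mT mS fS TS bq _); last first.
    by move=> x; rewrite addr_ge0// sqr_ge0.
  have -> : dur * rho = fine (mu T) by rewrite muT.
  have [mq [K bK]] := bq.
  apply: (@Rintegral_ge_cst _ _ _ _ _ _ _ K) => //.
  - by rewrite muT ltry.
  - exact: measurable_funS mq.
  - by move=> x /TS; exact: bK.
  - move=> x [k tx]; rewrite -(muB j) /u /v.
    apply: (wave_lower (aB j) (fun xi Bxi =>
      phase_tube a0 ga lam0 m0 small nsl0 nsl_large tx Bxi)).
have I1 : beta ^+ 2 / 4 * theta <=
    \int[mu]_(tx in S) (cmod (extension l g (packet B y eps) tx) ^+ 2).
  have -> : \int[mu]_(tx in S) (cmod (extension l g (packet B y eps) tx) ^+ 2) =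
      \int[mu]_(x in S) ((\sum_j eps j * u j x) ^+ 2 + (\sum_j eps j * v j x) ^+ 2).
    apply: eq_Rintegral => tx _; rewrite normc_sqr (Re_extension_packet y eps aB Bl).
    by rewrite (Im_extension_packet y eps aB Bl).
  apply: le_trans epsE; rewrite /theta /nJ.
  have -> : beta ^+ 2 / 4 * (#|J|%:R * dur * rho) = #|J|%:R * (beta ^+ 2 / 4 * (dur * rho)).
    by ring.
  by rewrite [#|J|%:R * _]mulr_natl -sumr_const; apply: ler_sum => j _; exact: lower.
have muSf : fine (mu S) <= #|W|%:R * (2 * half * (5 ^+ d * rho)).
  by rewrite -lee_fin fineK// ge0_fin_numE.
have I2 : packet_level * fine (mu S) <= beta ^+ 2 / 8 * theta.
  apply: (@le_trans _ _ (packet_level * (#|W|%:R * (2 * half * (5 ^+ d * rho))))).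
    by rewrite ler_wpM2l// /packet_level -/beta; rewrite !mulr_ge0 ?invr_ge0 ?mulr_ge0 ?exprn_ge0// ltW.
  rewrite le_eqVlt; apply/orP; left; apply/eqP.
  have -> : #|W| = (#|block e a lam m| * nsl * (5 * m ^ m.-1))%N.
    by rewrite /W /kcell_index !card_prod !card_ord.
  rewrite /theta /nJ /J /piece_index card_prod card_ord -halfE.
  have -> : (m ^ m = m * m ^ m.-1)%N by rewrite -expnS prednK.
  rewrite !natrM /packet_level -/beta (exprS 5 d); move: (#|_|%:R) => nb.
  have : 5 ^+ d != 0 :> R by rewrite expf_neq0.
  by move: (5 ^+ d) => P5 P50; field.
have I3 : packet_const * lam ^- 2 * \prod_i a i <= beta ^+ 2 / 8 * theta.
  have cg := card_piece_ge a0 lam0 m0 small.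
  apply: (@le_trans _ _ ((2 * c) ^+ d * c * lam ^- 2 / 8 * (2^-1 ^+ d * \prod_i a i))).
    rewrite /packet_const exprMn exprVn (exprS c d) le_eqVlt; apply/orP; left; apply/eqP.
    have : 2 ^+ d != 0 :> R by rewrite expf_neq0.
    by move: (2 ^+ d) => P2 P20; field; rewrite P20 gt_eqF.
  apply: (@le_trans _ _ ((2 * c) ^+ d * c * lam ^- 2 / 8 * (nJ * beta))).
    rewrite ler_wpM2l//; rewrite !mulr_ge0 ?invr_ge0 ?exprn_ge0 ?mulr_ge0//; exact: ltW.
  rewrite le_eqVlt; apply/orP; left; apply/eqP; rewrite /theta rhoE /duration.
  by field; rewrite !gt_eqF.
lra.
Qed.

End kakeya_packet.

(** * Bounds on the extension norm *)

Section kakeya_bounds.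
Context {R : realType} {d : nat}.
Variables (l : 'I_d -> \bar R) (e : 'I_d) (a : 'I_d -> R) (g : 'rV[R]_d -> R) (lam : R) (m : nat).
Hypotheses (a0 : forall i, 0 < a i) (ga : tame a g) (al : rbox a `<=` box l).
Hypotheses (lam0 : 0 < lam) (m0 : (0 < m)%N).
Hypothesis small : ((m ^ m) ^ 2)%:R * lam <= a e.
Notation cmod := (@ComplexField.Normc.normc R).
Notation pconst := (@packet_const R d).
Notation level := (packet_level a lam m).

Lemma packet_level_gt0 : 0 < level.
Proof.
by rewrite divr_gt0 ?mulr_gt0 ?exprn_gt0 ?ltr0n// prodr_gt0// => i _; exact: piece_side_gt0.
Qed.

(* Integrated over a set of small measure, this plays the role of Hoelder's
   inequality between L^2 and L^r. *)
Lemma powR_tangent (r u Y : R) : 2 <= r -> 0 <= u -> 0 < Y ->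
  Y `^ ((r - 2) / 2) * (u ^+ 2 - Y) <= u `^ r.
Proof.
move=> r2 u0 Y0; have [uY|Yu] := leP (u ^+ 2) Y.
  by rewrite (le_trans _ (powR_ge0 _ _))// mulr_ge0_le0 ?powR_ge0// subr_le0.
have u20 : 0 < u ^+ 2 by exact: lt_trans Yu.
have -> : u `^ r = (u ^+ 2) `^ ((r - 2) / 2) * u ^+ 2.
  rewrite -[X in _ * X](powRr1 (ltW u20)) -powRD; last by rewrite (gt_eqF u20) implybT.
  by rewrite -powR_mulrn// -powRrM; congr (_ `^ _); field.
apply: ler_pM; rewrite ?powR_ge0 ?subr_ge0 ?(ltW Yu)//.
  by rewrite ge0_ler_powR ?nnegrE ?(ltW Y0) ?(ltW u20) ?(ltW Yu)// divr_ge0 ?subr_ge0.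
by rewrite gerBl ltW.
Qed.

(** For [r < r0] the bound [F <= K] gives [F^r >= K^(r - r0) * F^r0], so an estimate at the exponent
    [r0 >= 2] serves every smaller [r], including those below 2. *)
Lemma kakeya_bound p (r r0 C : R) : (1 <= p)%E -> 1 <= r -> r <= r0 -> 2 <= r0 -> 0 <= C ->
  test_bound l g p r%:E C ->
  ((2 * \prod_i a i) `^ (r - r0) *
    (level `^ ((r0 - 2) / 2) * (pconst * lam ^- 2 * \prod_i a i))) `^ r^-1
  <= C * (\prod_i (2 * a i)) `^ rcp p.
Proof.
move=> p1 r1 rr0 r02 C0 bC.
have [J [B [y [eps [S [[aB [disj [eps1 Ba]]] [mS [fS [Fle Fge]]]]]]]]] :=
  kakeya_packet a0 ga al lam0 m0 small.
have Bl j : B j `<=` box l by apply: subset_trans al; exact: Ba.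
have H := packet_test_bound y p1 bC aB disj eps1 a0 al Ba C0.
set F := fun tx => cmod (extension l g (packet B y eps) tx) in Fle Fge *.
have P0 : 0 < \prod_i a i by exact: prodr_gt0.
set K := 2 * \prod_i a i in Fle *.
have K0 : 0 < K by rewrite mulr_gt0.
have L0 := packet_level_gt0.
pose A := K `^ (r - r0) * level `^ ((r0 - 2) / 2).
have A0 : 0 <= A by rewrite mulr_ge0 ?powR_ge0.
have FA tx : S tx -> A * (F tx ^+ 2 - level) <= F tx `^ r.
  move=> _; have F0 : 0 <= F tx by exact: normc_ge0.
  have [->|Fn0] := eqVneq (F tx) 0.
    rewrite expr0n/= sub0r mulrN powR0 ?oppr_le0; last by rewrite gt_eqF// (lt_le_trans _ r1).
    by rewrite mulr_ge0 ?(ltW L0).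
  have Fp : 0 < F tx by rewrite lt_def Fn0.
  have -> : F tx `^ r = F tx `^ (r - r0) * F tx `^ r0.
    by rewrite -powRD ?subrK// Fn0 implybT.
  rewrite /A -mulrA; apply: (@le_trans _ _ (K `^ (r - r0) * F tx `^ r0)).
    by rewrite ler_wpM2l ?powR_ge0// powR_tangent.
  rewrite ler_wpM2r ?powR_ge0// -opprB !powRN lef_pV2 ?posrE ?powR_gt0//.
  by rewrite ge0_ler_powR ?subr_ge0 ?nnegrE ?(ltW K0)//; exact: Fle.
have W0 : 0 <= pconst * lam ^- 2 * \prod_i a i.
  apply: mulr_ge0 (ltW P0); apply: mulr_ge0 (ltW (@packet_const_gt0 R d)) _.
  by rewrite invr_ge0 exprn_ge0// ltW.
have Fge' := ler_wpM2l A0 Fge.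
have := le_Lp_normT_quadratic r1 mS fS (measurable_extension_Re y eps aB Bl)
  (measurable_extension_Im y eps aB Bl) (fun x _ => Fle x) FA
  (le_trans (mulr_ge0 A0 W0) Fge').
move=> /le_trans/(_ H); rewrite lee_fin; apply: le_trans.
rewrite mulrA -/A; apply: ge0_ler_powR; rewrite ?nnegrE.
- by rewrite invr_ge0 (le_trans _ r1).
- exact: mulr_ge0 A0 W0.
- exact: le_trans (mulr_ge0 A0 W0) Fge'.
- exact: Fge'.
Qed.

Definition kakeya_const : R := pconst / (8 * 5 ^+ d.+1) / 2 ^+ d.

Lemma kakeya_const_gt0 : 0 < kakeya_const.
Proof.
apply: divr_gt0; last by rewrite exprn_gt0.
by apply: divr_gt0; rewrite ?packet_const_gt0// mulr_gt0// exprn_gt0.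
Qed.

Lemma packet_const_le1 : pconst <= 1.
Proof.
have c0 := @small_const_gt0 R d; have c2 := @small_const_le2 R d.
have : (@small_const R d) ^+ d.+1 <= 1 by rewrite exprn_ile1; lra.
by rewrite /packet_const; lra.
Qed.

(** The case [r0 = r]. The level, about [m] times the squared measure of a piece, enters with the
    power [1/2 - 1/r]. Fractional powers of constants are replaced by first powers, so that
    [kakeya_const] is independent of [p] and [r]. *)
Lemma kakeya_lower p (r C : R) : (1 <= p)%E -> 2 <= r -> 0 <= C -> test_bound l g p r%:E C ->
  kakeya_const * m%:R `^ (2^-1 - r^-1) * (\prod_i a i) `^ (r^-1 - rcp p) *
    (\prod_i piece_side a lam i) `^ (1 - 2 * r^-1) * lam `^ (- (2 * r^-1)) <= C.
Proof.
move=> p1 r2 C0 bC; have r1 : 1 <= r by rewrite (le_trans _ r2)// ler1n.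
have r0 : 0 < r by exact: lt_le_trans r1.
have := kakeya_bound p1 r1 (lexx r) r2 C0 bC.
rewrite subrr powRr0 mul1r.
set U := \prod_i a i; set b := \prod_i piece_side a lam i.
have U0 : 0 < U by exact: prodr_gt0.
have b0 : 0 < b by apply: prodr_gt0 => i _; exact: piece_side_gt0.
have mR : 0 < m%:R :> R by rewrite ltr0n.
set k := 8 * 5 ^+ d.+1 : R.
have k1 : 1 <= k.
  have : 1 <= 5 ^+ d.+1 :> R by rewrite exprn_ege1// ler1n.
  by rewrite /k; lra.
have k0 : 0 < k by exact: lt_le_trans k1.
have pc0 := @packet_const_gt0 R d; have pc1 := packet_const_le1.
set pc := pconst in pc0 pc1 *.
have ri1 : r^-1 <= 1 by rewrite invf_le1.
have ri0 : 0 <= r^-1 by rewrite invr_ge0 ltW.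
have ri2 : 2 * r^-1 <= 1 by rewrite -/(2 / r) ler_pdivrMr// mul1r.
have l20 : 0 < lam ^- 2 by rewrite invr_gt0 exprn_gt0.
have -> : level `^ ((r - 2) / 2) * (pc * lam ^- 2 * U) =
    (b ^+ 2 * m%:R / k) `^ ((r - 2) / 2) * (pc * lam ^- 2 * U) by [].
have X0 : 0 < b ^+ 2 * m%:R / k by rewrite divr_gt0// mulr_gt0// exprn_gt0.
have pl0 : 0 <= pc * lam ^- 2 := mulr_ge0 (ltW pc0) (ltW l20).
have b20 : 0 <= b ^+ 2 by exact: sqr_ge0.
have bm0 : 0 <= b ^+ 2 * m%:R := mulr_ge0 b20 (ltW mR).
have ki0 : 0 <= k^-1 by rewrite invr_ge0 ltW.
rewrite (powRM _ (powR_ge0 _ _) (mulr_ge0 pl0 (ltW U0))).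
rewrite -powRrM.
have -> : (r - 2) / 2 * r^-1 = 2^-1 - r^-1 by field; rewrite gt_eqF.
set E := 2^-1 - r^-1.
have E0 : 0 <= E by rewrite /E; lra.
have E1 : E <= 1 by rewrite /E; lra.
rewrite (powRM _ pl0 (ltW U0)) (powRM _ (ltW pc0) (ltW l20)).
rewrite (powRM _ bm0 ki0) (powRM _ b20 (ltW mR)).
rewrite -(powR_mulrn 2 (ltW b0)) -powRrM.
have -> : 2 * E = 1 - 2 * r^-1 by rewrite /E; field; rewrite gt_eqF.
rewrite -(powR_invn 2 (ltW lam0)) -(powRrM lam) mulNr.
have -> : \prod_i (2 * a i) = 2 ^+ d * U by rewrite big_split/= prodr_const card_ord.
have /andP[rp0 rp1] := rcp_bounds p1.
have d2 : 1 <= 2 ^+ d :> R by rewrite exprn_ege1// ler1n.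
have d20 : 0 < 2 ^+ d :> R by rewrite exprn_gt0.
rewrite (powRM _ (ltW d20) (ltW U0)) => H.
have h1 : (2 ^+ d) `^ rcp p <= 2 ^+ d :> R by rewrite ler1_powR.
have h2 : k^-1 <= (k^-1) `^ E by rewrite ger1_powR ?invr_gt0 ?k0//= invf_le1.
have h3 : pc <= pc `^ r^-1 by rewrite ger1_powR ?pc0.
have UE : U `^ (r^-1 - rcp p) * U `^ rcp p = U `^ r^-1.
  by rewrite -powRD ?subrK// (gt_eqF U0) implybT.
set be := b `^ _ in H *; set mm := m%:R `^ _ in H *; set ll := lam `^ _ in H *.
set k' := k^-1 `^ E in H h2 *; set pc' := pc `^ r^-1 in H h3 *.
set up := U `^ rcp p in H UE *; set uq := U `^ (_ - _) in UE *.
have be0 : 0 <= be by exact: powR_ge0.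
have mm0 : 0 <= mm by exact: powR_ge0.
have ll0 : 0 <= ll by exact: powR_ge0.
have uq0 : 0 <= uq by exact: powR_ge0.
have up0 : 0 < up by exact: powR_gt0.
have H2 : be * mm * k^-1 * (pc * ll * (uq * up)) <= C * (2 ^+ d * up).
  apply: le_trans (le_trans H _); last by rewrite ler_wpM2l// ler_pM2r.
  rewrite UE; apply: ler_pM.
  - exact: mulr_ge0 (mulr_ge0 be0 mm0) ki0.
  - exact: mulr_ge0 (mulr_ge0 (ltW pc0) ll0) (powR_ge0 _ _).
  - by apply: ler_wpM2l => //; exact: mulr_ge0.
  - by rewrite ler_wpM2r ?powR_ge0// ler_wpM2r.
have H3 : be * mm * k^-1 * (pc * ll * uq) <= C * 2 ^+ d.
  by rewrite -(ler_pM2r up0); move: H2; rewrite !mulrA.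
rewrite /kakeya_const -/pc -/k.
have -> : pc / k / 2 ^+ d * mm * uq * be * ll = be * mm * k^-1 * (pc * ll * uq) / 2 ^+ d.
  by ring.
by rewrite ler_pdivrMr.
Qed.

End kakeya_bounds.

Section unbounded_powers.
Context {R : realType}.

Lemma powR_unbounded (s K C rho : R) : 0 < s -> 0 < K ->
  exists x, [/\ 0 < x, rho <= x & C < K * x `^ s].
Proof.
move=> s0 K0; pose X := (`|C| + 1) / K; pose x := Num.max (Num.max rho 1) (X `^ s^-1).
have X0 : 0 < X by rewrite divr_gt0// ltr_wpDl.
exists x; split.
- by rewrite /x !lt_max ltr01 orbT.
- by rewrite /x !le_max lexx.
have xs : X <= x `^ s.
  have sn0 : s != 0 by rewrite gt_eqF.
  rewrite -[leLHS](powRr1 (ltW X0)) -(mulVf sn0) powRrM.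
  rewrite ge0_ler_powR ?nnegrE ?powR_ge0 ?(ltW s0)//.
  - by rewrite /x !le_max ler01 !orbT.
  - by rewrite /x le_max lexx orbT.
have := ler_wpM2l (ltW K0) xs; rewrite /X mulrC divfK ?gt_eqF//.
by apply: lt_le_trans; rewrite (le_lt_trans (ler_norm _))// ltrDl.
Qed.

Lemma natr_powR_unbounded (s K C : R) : 0 < s -> 0 < K ->
  exists2 m : nat, (0 < m)%N & C < K * m%:R `^ s.
Proof.
move=> s0 K0; have [x [x0 _ xC]] := powR_unbounded C 0 s0 K0.
exists (Num.truncn x).+1 => //; apply: lt_le_trans xC _.
rewrite ler_pM2l// ge0_ler_powR ?nnegrE ?(ltW s0) ?(ltW x0)//.
by have /andP[_ /ltW] := truncn_itv (ltW x0).
Qed.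

End unbounded_powers.

(** * Conditions forced by boundedness *)

Section necessary_conditions.
Context {R : realType} {d : nat}.
Variables (hd : (0 < d)%N) (l : 'I_d -> \bar R) (g : 'rV[R]_d -> R).
Hypothesis l0 : forall i, (0 < l i)%E.
Hypothesis lsorted : forall i j : 'I_d, (i <= j)%N -> (l i <= l j)%E.
Hypothesis gtame : forall a : 'I_d -> R, (forall i, 0 < a i) ->
  (forall i, ((a i)%:E <= l i)%E) -> tame a g.
Notation kc := (@knapp_const R d).
Notation kk := (@kakeya_const R d).
Implicit Types (p q : \bar R) (C lam : R) (a : 'I_d -> R).

Lemma rbox_sub_box a : (forall i, ((a i)%:E <= l i)%E) -> rbox a `<=` box l.
Proof. by move=> al x ax i; apply: lt_le_trans (al i); rewrite lte_fin; exact: ax. Qed.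

Lemma knapp_below p q a lam C : (1 <= p)%E -> (1 <= q)%E -> (forall i, 0 < a i) ->
  (forall i, ((a i)%:E <= l i)%E) -> (forall i, a i <= lam) -> 0 < lam -> 0 <= C ->
  test_bound l g p q C ->
  kc * (\prod_i a i) `^ (1 - rcp p - rcp q) * lam `^ (- (2 * rcp q)) <= C.
Proof.
by move=> p1 q1 a0 al alam lam0 C0; apply: knapp => //; [exact: gtame|exact: rbox_sub_box].
Qed.

Lemma exists_below : exists2 rho : R, 0 < rho & forall i, (rho%:E <= l i)%E.
Proof.
pose i0 : 'I_d := Ordinal hd; have li i : (l i0 <= l i)%E by exact: lsorted.
move: (l0 i0) li; case: (l i0) => [r r0 li|_ li|//]; first by exists r.
by exists 1 => // i; apply: le_trans (li i); rewrite leey.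
Qed.

Lemma powR_collect (x u v : R) n : 0 < x -> (x ^+ n) `^ u * x `^ v = x `^ (n%:R * u + v).
Proof.
move=> x0; rewrite -(powR_mulrn n (ltW x0)) -powRrM -powRD//.
by rewrite (gt_eqF x0) implybT.
Qed.

(** Cubes of side [1 / x] fit into the box for large [x], and their Knapp quotient is a constant
    times [x] to the power [(d + 2)/q - d (1 - 1/p)]. *)
Lemma knapp_small p q C : (1 <= p)%E -> (1 <= q)%E -> 0 <= C -> test_bound l g p q C ->
  (d%:R + 2) * rcp q <= d%:R * (1 - rcp p).
Proof.
move=> p1 q1 C0 bC; rewrite leNgt; apply/negP; rewrite -subr_gt0; set s := _ - _ => s0.
have [rho rho0 rhol] := exists_below.
have [x [x0 rx Cx]] := powR_unbounded C rho^-1 s0 (@knapp_const_gt0 R d).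
have xi0 : 0 < x^-1 by rewrite invr_gt0.
have xrho : x^-1 <= rho by rewrite invf_ple ?posrE.
have xl i : ((x^-1)%:E <= l i)%E by apply: le_trans (rhol i); rewrite lee_fin.
have := knapp_below p1 q1 (fun=> xi0) xl (fun=> lexx _) xi0 C0 bC.
rewrite prodr_const card_ord -mulrA powR_collect// leNgt => /negP; apply.
rewrite -(powR_inv1 (ltW x0)) -powRrM; apply: lt_le_trans Cx _.
rewrite le_eqVlt; apply/orP; left; apply/eqP; congr (_ * _ `^ _).
by rewrite /s; ring.
Qed.

(** The cube is fixed and [lam] shrinks as [m] grows. At [r0 = 2 (d + 1) / d] the factor
    [level ^ ((r0 - 2) / 2)] is a constant times [lam^2 * m^(1/d)]: the powers of [lam] cancel
    against [lam^-2], and only the growth in [m] is left. *)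
Lemma kakeya_small p (r C : R) : (1 <= p)%E -> 1 <= r -> 0 <= C -> test_bound l g p r%:E C ->
  2 * (d%:R + 1) / d%:R < r.
Proof.
move=> p1 r1 C0 bC; rewrite ltNge; apply/negP; set r0 := 2 * _ / _ => rr0.
have dR : 0 < d%:R :> R by rewrite ltr0n.
have r00 : 0 < r by exact: lt_le_trans r1.
have r0E : (r0 - 2) / 2 = d%:R^-1 by rewrite /r0; field; rewrite gt_eqF.
have r02 : 2 <= r0.
  rewrite -subr_ge0 -(@pmulr_lge0 _ 2^-1) ?invr_gt0// r0E invr_ge0; exact: ltW.
have [rho rho0 rhol] := exists_below.
pose a (_ : 'I_d) := rho.
have a0 i : 0 < a i by [].
have ga := gtame a0 rhol; have al := rbox_sub_box rhol.
have U0 : 0 < \prod_i a i by apply: prodr_gt0.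
set U := \prod_i a i in U0.
pose k : R := 8 * 5 ^+ d.+1.
have k0 : 0 < k by rewrite mulr_gt0// exprn_gt0.
have pc0 := @packet_const_gt0 R d.
pose K := (2 * U) `^ (r - r0) * (k^-1 `^ d%:R^-1 * (@packet_const R d * U)).
have K0 : 0 < K.
  apply: mulr_gt0; first by rewrite powR_gt0// mulr_gt0.
  by apply: mulr_gt0 (mulr_gt0 pc0 U0); rewrite powR_gt0// invr_gt0.
have di0 : 0 < d%:R^-1 :> R by rewrite invr_gt0.
pose X := C * (\prod_i (2 * a i)) `^ rcp p.
have [m m0 mX] := natr_powR_unbounded (X `^ r) di0 K0.
pose lam := rho / ((m ^ m) ^ 2)%:R.
have N0 : 0 < ((m ^ m) ^ 2)%:R :> R by rewrite ltr0n !expn_gt0 m0.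
have lam0 : 0 < lam by rewrite divr_gt0.
have small : ((m ^ m) ^ 2)%:R * lam <= a (last_ord hd).
  by rewrite /lam mulrC divfK// gt_eqF.
have := kakeya_bound a0 ga al lam0 m0 small p1 r1 rr0 r02 C0 bC.
rewrite -/X -/U r0E leNgt => /negP; apply.
have lr : lam <= rho.
  by rewrite /lam ler_pdivrMr// ler_peMr ?(ltW rho0)// ler1n !expn_gt0 m0.
have side i : piece_side a lam i = lam by rewrite /piece_side min_r.
have -> : packet_level a lam m = (lam ^+ d) ^+ 2 * m%:R * k^-1.
  by rewrite /packet_level (eq_bigr _ (fun i _ => side i)) prodr_const card_ord.
have -> : (lam ^+ d ^+ 2 * m%:R * k^-1) `^ d%:R^-1 = lam ^+ 2 * m%:R `^ d%:R^-1 * k^-1 `^ d%:R^-1.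
  have l20 : 0 <= lam ^+ d ^+ 2 by exact: sqr_ge0.
  have ki0 : 0 <= k^-1 by rewrite invr_ge0 ltW.
  rewrite (powRM _ (mulr_ge0 l20 (ler0n _ _)) ki0) (powRM _ l20 (ler0n _ _)).
  rewrite exprAC -(powR_mulrn d) ?exprn_ge0 ?(ltW lam0)// -powRrM mulfV ?gt_eqF// powRr1//.
  by rewrite exprn_ge0// ltW.
have -> : (2 * U) `^ (r - r0) * (lam ^+ 2 * m%:R `^ d%:R^-1 * k^-1 `^ d%:R^-1 *
    (@packet_const R d * lam ^- 2 * U)) = K * m%:R `^ d%:R^-1.
  by rewrite /K; field; rewrite gt_eqF.
have X0 : 0 <= X by rewrite mulr_ge0 ?powR_ge0.
have -> : X = (X `^ r) `^ r^-1 by rewrite -powRrM mulfV ?gt_eqF// powRr1.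
rewrite gt0_ltr_powR ?invr_gt0 ?nnegrE ?powR_ge0//.
by rewrite mulr_ge0 ?powR_ge0// ltW.
Qed.

Lemma prod_split (F : 'I_d -> R) (x : R) k : (k <= d)%N -> 0 < x ->
  \prod_(i < d) (if (i < k)%N then F i else x) = (\prod_(i < d | (i < k)%N) F i) * x ^+ (d - k).
Proof.
move=> kd x0; rewrite (bigID (fun i : 'I_d => (i < k)%N))/=; congr (_ * _).
  by apply: eq_bigr => i ->.
rewrite (eq_bigr (fun=> x)) => [|i /negbTE->//].
have : x ^+ d = \prod_(i < d) x by rewrite prodr_const card_ord.
rewrite (bigID (fun i : 'I_d => (i < k)%N))/= -(big_ord_widen _ (fun=> x) kd).
rewrite prodr_const card_ord -{1}(subnKC kd) exprD => /mulfI-> //.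
by rewrite expf_neq0// gt_eqF.
Qed.

(** With indices from 0, the [d - k] sides from the infinite one on grow to [x] and the others stay
    at [rho]. The Knapp quotient is a constant times [x] to the power
    [(d - k) (1 - 1/p) - (d - k + 2)/q]. *)
Lemma knapp_large (k : 'I_d) p q C : (1 <= p)%E -> (1 <= q)%E -> 0 <= C ->
  l k = +oo%E -> test_bound l g p q C ->
  (d%:R - k%:R) * (1 - rcp p) <= (d%:R - k%:R + 2) * rcp q.
Proof.
move=> p1 q1 C0 lk bC; rewrite leNgt; apply/negP; rewrite -subr_gt0; set s := _ - _ => s0.
have [rho rho0 rhol] := exists_below.
set gam := 1 - rcp p - rcp q.
have K0 : 0 < kc * (rho ^+ k) `^ gam.
  by apply: mulr_gt0 (@knapp_const_gt0 R d) _; rewrite powR_gt0// exprn_gt0.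
have [x [x0 rx Cx]] := powR_unbounded C rho s0 K0.
pose a (i : 'I_d) := if (i < k)%N then rho else x.
have a0 i : 0 < a i by rewrite /a; case: ifP.
have al i : ((a i)%:E <= l i)%E.
  rewrite /a; case: ltnP => // ki; apply: le_trans (lsorted ki).
  by rewrite lk leey.
have ax i : a i <= x by rewrite /a; case: ifP.
have := knapp_below p1 q1 a0 al ax x0 C0 bC.
rewrite leNgt => /negP; apply; apply: lt_le_trans Cx _.
have kd : (k <= d)%N by exact: ltnW.
rewrite prod_split// -(big_ord_widen _ (fun=> rho) kd) prodr_const card_ord.
rewrite powRM ?exprn_ge0 ?(ltW rho0) ?(ltW x0)// -/gam -!mulrA powR_collect//.
rewrite le_eqVlt; apply/orP; left; apply/eqP; congr (_ * (_ * (_ * _ `^ _))).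
by rewrite /s /gam natrB//; ring.
Qed.

(** Pieces keep the side [rho], and the infinite last side supplies the length of a block for every
    [m]. For [p >= r] the exponent [1/r - 1/p] of the volume is nonnegative, so enlarging the box
    does no harm. *)
Lemma kakeya_large (k : 'I_d) p (r C : R) : (1 <= p)%E -> 2 < r -> 0 <= C ->
  rcp p <= r^-1 -> l k = +oo%E -> ~ test_bound l g p r%:E C.
Proof.
move=> p1 r2 C0 pr lk bC.
have [rho rho0 rhol] := exists_below.
have s0 : 0 < 2^-1 - r^-1 :> R by rewrite subr_gt0 ltf_pV2 ?posrE// (lt_trans _ r2).
pose P := rho ^+ d.
have P0 : 0 < P by rewrite exprn_gt0.
pose K := kk * P `^ (r^-1 - rcp p) * P `^ (1 - 2 * r^-1) * rho `^ (- (2 * r^-1)).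
have K0 : 0 < K.
  apply: mulr_gt0 (powR_gt0 _ rho0); apply: mulr_gt0 (powR_gt0 _ P0).
  exact: mulr_gt0 (@kakeya_const_gt0 R d) (powR_gt0 _ P0).
have [m m0 mC] := natr_powR_unbounded C s0 K0.
have N1 : 1 <= ((m ^ m) ^ 2)%:R :> R by rewrite ler1n !expn_gt0 m0.
pose a (i : 'I_d) := if (i < k)%N then rho else ((m ^ m) ^ 2)%:R * rho.
have ar i : rho <= a i by rewrite /a; case: ifP => // _; rewrite ler_peMl// ltW.
have a0 i : 0 < a i by exact: lt_le_trans (ar i).
have al i : ((a i)%:E <= l i)%E.
  rewrite /a; case: ltnP => // ki; apply: le_trans (lsorted ki).
  by rewrite lk leey.
have small : ((m ^ m) ^ 2)%:R * rho <= a (last_ord hd).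
  by rewrite /a ltnNge /= -ltnS prednK// ltn_ord.
have := kakeya_lower a0 (gtame a0 al) (rbox_sub_box al) rho0 m0 small p1 (ltW r2) C0 bC.
rewrite leNgt => /negP; apply; apply: lt_le_trans mC _.
have -> : \prod_i piece_side a rho i = P.
  rewrite (eq_bigr (fun=> rho)) ?prodr_const ?card_ord// => i _.
  by rewrite /piece_side min_r.
have PU : P <= \prod_i a i.
  rewrite /P -[d in _ ^+ d](card_ord d) -prodr_const; apply: ler_prod => i _.
  by rewrite ar (ltW rho0).
have -> : K * m%:R `^ (2^-1 - r^-1) = kk * m%:R `^ (2^-1 - r^-1) * P `^ (r^-1 - rcp p) *
   P `^ (1 - 2 * r^-1) * rho `^ (- (2 * r^-1)) by rewrite /K; ring.
do 2 apply: ler_wpM2r (powR_ge0 _ _) _ _ _.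
apply: ler_wpM2l; first exact: mulr_ge0 (ltW (@kakeya_const_gt0 R d)) (powR_ge0 _ _).
by rewrite ge0_ler_powR ?subr_ge0 ?nnegrE ?(ltW P0)// (le_trans (ltW P0)).
Qed.

End necessary_conditions.

(** * Quantitative lower bounds in terms of the sides *)

Section lower_bounds.
Context {R : realType} {d : nat}.
Variables (hd : (0 < d)%N) (l : 'I_d -> \bar R) (g : 'rV[R]_d -> R).
Hypothesis l0 : forall i, (0 < l i)%E.
Hypothesis lsorted : forall i j : 'I_d, (i <= j)%N -> (l i <= l j)%E.
Hypothesis gtame : forall a : 'I_d -> R, (forall i, 0 < a i) ->
  (forall i, ((a i)%:E <= l i)%E) -> tame a g.
Notation kc := (@knapp_const R d).
Notation kk := (@kakeya_const R d).
Implicit Types (p q : \bar R) (C lam theta : R) (a : 'I_d -> R).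

(** On the scaling line [(d - j - theta) (1 - 1/p - 1/q) = 2/q]; of the powers of [lam] coming from
    the [d - j] equal sides and from [lam^(-2/q)], exactly [theta (1 - 1/p - 1/q)] remains. *)
Lemma knapp_prefix (j : 'I_d) theta p q a lam C : (1 <= p)%E -> (1 <= q)%E ->
  (forall i, 0 < a i) -> (forall i, ((a i)%:E <= l i)%E) -> (forall i, a i <= lam) ->
  (forall i : 'I_d, (j <= i)%N -> a i = lam) -> 0 < lam ->
  (d%:R - j%:R - theta) * (1 - rcp p) = (d%:R - j%:R - theta + 2) * rcp q ->
  0 <= C -> test_bound l g p q C ->
  kc * ((\prod_(i < d | (i < j)%N) a i) * lam `^ theta) `^ (1 - rcp p - rcp q) <= C.
Proof.
move=> p1 q1 a0 al alam aj lam0 sc C0 bC.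
apply: le_trans (knapp_below gtame p1 q1 a0 al alam lam0 C0 bC).
set F := \prod_(i < d | _) a i; have F0 : 0 < F by apply: prodr_gt0.
set gam := 1 - rcp p - rcp q.
have -> : \prod_i a i = F * lam ^+ (d - j).
  rewrite /F -prod_split ?(ltnW (ltn_ord j))//; apply: eq_bigr => i _.
  by case: ltnP => // /aj.
have E1 : (F * lam `^ theta) `^ gam = F `^ gam * lam `^ (theta * gam).
  by rewrite (powRM _ (ltW F0) (powR_ge0 _ _)) -powRrM.
have E2 : (F * lam ^+ (d - j)) `^ gam * lam `^ (- (2 * rcp q)) = F `^ gam * lam `^ (theta * gam).
  rewrite (powRM _ (ltW F0) (exprn_ge0 _ (ltW lam0))) -mulrA powR_collect//.
  congr (_ * _ `^ _); rewrite natrB ?(ltnW (ltn_ord j))//.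
  have : (d%:R - j%:R - theta) * gam = 2 * rcp q by rewrite /gam mulrBr sc; ring.
  by move=> <-; ring.
by rewrite E1 -E2 mulrA.
Qed.

Lemma extension_norm_eqy p q : (forall C, 0 <= C -> ~ test_bound l g p q C) ->
  extension_norm l g p q = +oo%E.
Proof.
by move=> H; apply: eq_infty => r; apply: le_extension_norm => C C0 /(H C C0).
Qed.

Lemma finite_below (j i : 'I_d) : (l j < +oo)%E -> (i <= j)%N -> l i = (fine (l i))%:E.
Proof.
move=> lj ij; rewrite fineK// gt0_fin_numE//; exact: le_lt_trans (lsorted ij) lj.
Qed.

Lemma fine_side_gt0 i : (l i < +oo)%E -> 0 < fine (l i).
Proof. by move=> li; rewrite fine_gt0// l0. Qed.

Lemma scaling_exponent_ge0 (s u v : R) : 0 <= s -> 0 <= u <= 1 -> 0 <= v ->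
  s * (1 - u) = (s + 2) * v -> 0 <= 1 - u - v.
Proof.
move=> s0 /andP[u0 u1] v0 E; have [s00|sn0] := eqVneq s 0.
  by move: E; rewrite s00 mul0r add0r => E; lra.
have sp : 0 < s by rewrite lt_def sn0.
rewrite -(pmulr_rge0 _ sp) mulrBr E; lra.
Qed.

Lemma ereal_prefix_prod (j : 'I_d) : (forall i : 'I_d, (i < j)%N -> (l i < +oo)%E) ->
  (\prod_(i < d | (i < j)%N) l i = (\prod_(i < d | (i < j)%N) fine (l i))%:E)%E.
Proof.
move=> lf; rewrite -prodEFin; apply: eq_bigr => i ij.
by rewrite (finite_below (lf _ ij)).
Qed.

(** When the left-hand side is finite a single box attains it; when it is infinite, a growing family
    of boxes defeats every test constant. *)
Lemma knapp_scaling_bound (j : 'I_d) theta p q : (1 <= p)%E -> (1 <= q)%E -> 0 <= theta <= 1 ->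
  scaling_line (d%:R - j%:R - theta) p q ->
  (kc%:E * ((\prod_(i < d | (i < j)%N) l i) * l j `^ theta)
     `^ (rcp (hoelder_conjugate p) - rcp q) <= extension_norm l g p q)%E.
Proof.
move=> p1 q1 /andP[th0 th1]; rewrite /scaling_line rcp_conj// => sc.
set gam := 1 - rcp p - rcp q.
have js : 1 <= d%:R - j%:R :> R.
  have : j.+1%:R <= d%:R :> R by rewrite ler_nat.
  by rewrite -natr1; lra.
have /andP[rq0 _] := rcp_bounds q1.
have gam0 : 0 <= gam.
  by apply: (scaling_exponent_ge0 _ (rcp_bounds p1) rq0 sc); lra.
have [rho rho0 rhol] := exists_below hd l0 lsorted.
have [ljf|] := boolP (l j < +oo)%E.
  have lij (i : 'I_d) : (i < j)%N -> (l i < +oo)%E.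
    by move=> ij; apply: le_lt_trans ljf; exact/lsorted/ltnW.
  rewrite ereal_prefix_prod// (finite_below ljf (leqnn j)) poweR_EFin -EFinM.
  apply: le_extension_norm => C C0 bC.
  pose a (i : 'I_d) := if (i < j)%N then fine (l i) else fine (l j).
  have a0 i : 0 < a i by rewrite /a; case: ifP => [/lij|_]; exact: fine_side_gt0.
  have al i : ((a i)%:E <= l i)%E.
    rewrite /a; case: ltnP => ij; first by rewrite -(finite_below (lij _ ij) (leqnn i)).
    by rewrite -(finite_below ljf (leqnn j)) lsorted.
  have := @knapp_prefix j theta p q a (fine (l j)) C p1 q1 a0 al.
  have -> : \prod_(i < d | (i < j)%N) a i = \prod_(i < d | (i < j)%N) fine (l i).
    by apply: eq_bigr => i ij; rewrite /a ij.
  apply => //; last exact: fine_side_gt0.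
    move=> i; rewrite /a; case: ltnP => // ij.
    rewrite -lee_fin -(finite_below ljf (leqnn j)) -(finite_below (lij _ ij) (leqnn i)).
    exact/lsorted/ltnW.
  by move=> i ji; rewrite /a ltnNge ji.
rewrite -leNgt leye_eq => /eqP lj.
(* If [gam = 0], the convention that the zeroth power is 1 leaves only a constant, and any cube in
   the box will do. *)
move: gam0; rewrite le_eqVlt => /predU1P[gam00|gam0].
  rewrite -gam00 poweRe0 mule1; apply: le_extension_norm => C C0 bC.
  have := @knapp_prefix j theta p q (fun=> rho) rho C p1 q1 (fun=> rho0) rhol
    (fun=> lexx _) (fun _ _ => erefl) rho0 sc C0 bC.
  by rewrite -/gam -gam00 powRr0 mulr1.
(* If [theta = 0] and the earlier sides are finite, the infinite [l j] drops out, and the common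
   side [x] only has to exceed the earlier ones. *)
have [[th00 lf]|nfin] := pselect (theta = 0 /\ forall i : 'I_d, (i < j)%N -> (l i < +oo)%E).
  rewrite th00 poweRe0 mule1 ereal_prefix_prod// poweR_EFin -EFinM.
  apply: le_extension_norm => C C0 bC.
  pose x := 1 + \sum_i `|fine (l i)|.
  have x0 : 0 < x by rewrite ltr_pwDl// sumr_ge0.
  pose a (i : 'I_d) := if (i < j)%N then fine (l i) else x.
  have a0 i : 0 < a i by rewrite /a; case: ifP => [/lf|//]; exact: fine_side_gt0.
  have al i : ((a i)%:E <= l i)%E.
    rewrite /a; case: ltnP => ij; first by rewrite -(finite_below (lf _ ij) (leqnn i)).
    by apply: le_trans (lsorted ij); rewrite lj leey.
  have := @knapp_prefix j theta p q a x C p1 q1 a0 al.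
  have -> : \prod_(i < d | (i < j)%N) a i = \prod_(i < d | (i < j)%N) fine (l i).
    by apply: eq_bigr => i ij; rewrite /a ij.
  rewrite th00 powRr0 mulr1; apply => //; last by rewrite -th00.
    move=> i; rewrite /a; case: ltnP => // ij.
    by rewrite /x (bigD1 i)//= (le_trans (ler_norm _))// addrCA lerDl addr_ge0 ?sumr_ge0.
  by move=> i ji; rewrite /a ltnNge ji.
rewrite extension_norm_eqy ?leey// => C C0 bC.
pose a (x : R) (i : 'I_d) := if ((i < j)%N && (l i < +oo)%E) then rho else x.
have key x : 0 < x -> rho <= x ->
    kc * ((\prod_(i < d | (i < j)%N) a x i) * x `^ theta) `^ gam <= C.
  move=> x0 rx; apply: (@knapp_prefix j theta p q (a x) x C p1 q1) => //.
  - by move=> i; rewrite /a; case: ifP.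
  - move=> i; rewrite /a; case: ifP => // /negbT; rewrite negb_and -leNgt leye_eq -leqNgt.
    move=> /orP[ji|/eqP->]; last by rewrite leey.
    by apply: le_trans (lsorted ji); rewrite lj leey.
  - by move=> i; rewrite /a; case: ifP.
  - by move=> i ji; rewrite /a ltnNge ji.
have ax x i : rho <= x -> rho <= a x i by move=> rx; rewrite /a; case: ifP.
have kc0 := @knapp_const_gt0 R d.
(* Growth comes from an infinite side before [j] if there is one, and otherwise from [x ^ theta]
   with [theta > 0]. *)
have [[i0 i0j li0]|allfin] := pselect (exists2 i0 : 'I_d, (i0 < j)%N & l i0 = +oo%E).
  pose P : R := \prod_(i < d | (i < j)%N && (i != i0)) rho.
  have P0 : 0 < P by exact: prodr_gt0.
  have K0 : 0 < kc * P `^ gam by apply: mulr_gt0 kc0 (powR_gt0 _ P0).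
  have [x [x0 + Cx]] := powR_unbounded C (Num.max rho 1) gam0 K0.
  rewrite ge_max => /andP[rx x1].
  have := key x x0 rx; rewrite leNgt => /negP; apply; apply: lt_le_trans Cx _.
  rewrite -[leLHS]mulrA -powRM ?(ltW P0) ?(ltW x0)// ler_pM2l//.
  have h : P * x <= \prod_(i < d | (i < j)%N) a x i * x `^ theta.
    rewrite (bigD1 i0)//= {1}/a i0j li0 ltxx/= [x * _]mulrC.
    have h1 : P <= \prod_(i < d | (i < j)%N && (i != i0)) a x i.
      by apply: ler_prod => i _; rewrite (ltW rho0) ax.
    have h2 : 1 <= x `^ theta by rewrite -[leLHS](powRr0 x) ler_powR.
    rewrite -[leLHS]mulr1; apply: ler_pM => //; first by rewrite mulr_ge0 ?ltW.
    by rewrite ler_wpM2r// ltW.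
  apply: ge0_ler_powR h; rewrite ?nnegrE ?(ltW gam0) ?mulr_ge0 ?powR_ge0 ?(ltW P0) ?(ltW x0)//.
  by apply: prodr_ge0 => i _; apply: le_trans (ax x i rx); exact: ltW.
have th : 0 < theta.
  rewrite lt_def th0 andbT; apply/eqP => th00; apply: nfin; split => // i ij.
  by rewrite ltNge leye_eq; apply/eqP => li; apply: allfin; exists i.
pose P : R := \prod_(i < d | (i < j)%N) rho.
have P0 : 0 < P by exact: prodr_gt0.
have K0 : 0 < kc * P `^ gam by apply: mulr_gt0 kc0 (powR_gt0 _ P0).
have [x [x0 rx Cx]] := powR_unbounded C rho (mulr_gt0 th gam0) K0.
have := key x x0 rx; rewrite leNgt => /negP; apply; apply: lt_le_trans Cx _.
rewrite powRrM -[leLHS]mulrA -powRM ?(ltW P0) ?powR_ge0// ler_pM2l//.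
have h1 : P <= \prod_(i < d | (i < j)%N) a x i.
  by apply: ler_prod => i _; rewrite (ltW rho0) ax.
apply: ge0_ler_powR; rewrite ?nnegrE ?(ltW gam0) ?mulr_ge0 ?powR_ge0 ?(ltW P0)//.
  exact: le_trans (ltW P0) h1.
by rewrite ler_wpM2r ?powR_ge0.
Qed.

(** With [lam = l j], pieces have sides [l i] before [j] and [l j] from there on; blocks run along
    the longest side, where [small] becomes the condition on the ratio. For [s = d - j - theta] one
    has [s (1 - 2/r) = 2/r], which leaves the power [theta (1 - 2/r)] of [l j]. *)
Lemma kakeya_scaling_bound (j : 'I_d) theta p (r : R) (m : nat) : (1 <= p)%E ->
  (l (last_ord hd) < +oo)%E -> (j.+1 < d)%N -> 0 < theta <= 1 ->
  r = 2 * (d%:R - j%:R - theta + 1) / (d%:R - j%:R - theta) -> (0 < m)%N ->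
  ((m ^ m) ^ 2)%:R <= fine (l (last_ord hd)) / fine (l j) ->
  (kk%:E * (\prod_(i < d) l i) `^ (rcp r%:E - rcp p) * (m%:R `^ (2^-1 - r^-1))%:E *
     ((\prod_(i < d | (i < j)%N) l i) * l j `^ theta) `^ (1 - 2 * rcp r%:E)
   <= extension_norm l g p r%:E)%E.
Proof.
move=> p1 lf jd /andP[th0 th1] rE m0 mN.
set s := d%:R - j%:R - theta in rE.
have s1 : 1 <= s.
  have : j.+2%:R <= d%:R :> R by rewrite ler_nat.
  by rewrite /s -addn2 natrD; lra.
have s0 : 0 < s by exact: lt_le_trans s1.
have r2 : 2 <= r by rewrite rE ler_pdivlMr//; lra.
have r1 : 1 <= r by rewrite (le_trans _ r2)// ler1n.
have lt_last (i : 'I_d) : (i <= last_ord hd)%N by rewrite /= -ltnS prednK// ltn_ord.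
have lfi i : (l i < +oo)%E by apply: le_lt_trans lf; exact: lsorted.
have lE i : l i = (fine (l i))%:E by exact: finite_below (lfi i) (leqnn i).
rewrite rcp_fin//.
pose a i := fine (l i).
have a0 i : 0 < a i by exact: fine_side_gt0.
have al i : ((a i)%:E <= l i)%E by rewrite -lE.
rewrite ereal_prefix_prod// [l j]lE (eq_bigr (fun i => (a i)%:E)) => [|i _]; last exact: lE.
rewrite prodEFin !poweR_EFin -!EFinM.
apply: le_extension_norm => C C0 bC.
have small : ((m ^ m) ^ 2)%:R * a j <= a (last_ord hd) by rewrite -ler_pdivlMr.
apply: le_trans (kakeya_lower a0 (gtame a0 al) (rbox_sub_box al) (a0 j) m0 small p1 r2 C0 bC).
have aij (i k : 'I_d) : (i <= k)%N -> a i <= a k.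
  by move=> /lsorted; rewrite [l i]lE [l k]lE lee_fin.
set F := \prod_(i < d | _) fine (l i); have F0 : 0 < F by apply: prodr_gt0 => i _; exact: a0.
have -> : \prod_i piece_side a (a j) i = F * a j ^+ (d - j).
  rewrite /F -prod_split ?(ltnW (ltn_ord j))//; apply: eq_bigr => i _.
  rewrite /piece_side; case: ltnP => ij; first by rewrite min_l// aij// ltnW.
  by rewrite min_r// aij.
set u := 1 - 2 * r^-1; have uE : u * s = 2 * r^-1.
  by rewrite /u rE; field; rewrite !gt_eqF// addr_gt0.
have E1 : (F * a j `^ theta) `^ u = F `^ u * a j `^ (theta * u).
  by rewrite (powRM _ (ltW F0) (powR_ge0 _ _)) -powRrM.
have E2 : (F * a j ^+ (d - j)) `^ u * a j `^ (- (2 * r^-1)) = F `^ u * a j `^ (theta * u).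
  rewrite (powRM _ (ltW F0) (exprn_ge0 _ (ltW (a0 j)))) -mulrA powR_collect//.
  congr (_ * _ `^ _); rewrite natrB ?(ltnW (ltn_ord j))//.
  by rewrite -uE /s; ring.
rewrite -/(a j) E1 -E2 le_eqVlt; apply/orP; left; apply/eqP.
by ring.
Qed.

(** The Knapp example of the whole box, with [lam] the longest side: [lam^(-2/q)] combines with the
    power [1 - 1/p - 1/q] of that side. *)
Lemma knapp_full_bound p q : (1 <= p)%E -> (1 <= q)%E -> (l (last_ord hd) < +oo)%E ->
  (kc%:E * (\prod_(i < d | (i.+1 < d)%N) l i) `^ (rcp (hoelder_conjugate p) - rcp q)
     * l (last_ord hd) `^ (1 - 3 * rcp q - rcp p) <= extension_norm l g p q)%E.
Proof.
move=> p1 q1 lf; rewrite rcp_conj//; set ld := last_ord hd in lf *.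
have lt_last (i : 'I_d) : (i <= ld)%N by rewrite /= -ltnS prednK// ltn_ord.
have lfi i : (l i < +oo)%E by apply: le_lt_trans lf; exact: lsorted.
have lE i : l i = (fine (l i))%:E by exact: finite_below (lfi i) (leqnn i).
pose a i := fine (l i).
have a0 i : 0 < a i by exact: fine_side_gt0.
have al i : ((a i)%:E <= l i)%E by rewrite -lE.
rewrite (eq_bigr (fun i => (a i)%:E)) => [|i _]; last exact: lE.
rewrite prodEFin [l ld]lE !poweR_EFin -!EFinM; apply: le_extension_norm => C C0 bC.
have ald i : a i <= a ld by rewrite -lee_fin -!lE lsorted.
apply: le_trans (knapp_below gtame p1 q1 a0 al ald (a0 ld) C0 bC).
rewrite -/(a ld) [X in _ <= _ * X `^ _ * _](bigD1 ld)//= [a ld * _]mulrC.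
have -> : \prod_(i < d | (i.+1 < d)%N) a i = \prod_(i < d | i != ld) a i.
  apply: eq_bigl => i; rewrite -val_eqE/= neq_ltn.
  have := ltn_ord i; case: d hd i => // n _ i /=; rewrite !ltnS => h.
  by rewrite [(n < i)%N]ltnNge h orbF.
set F := \prod_(i < d | _) a i; have F0 : 0 < F by apply: prodr_gt0.
set gam := 1 - rcp p - rcp q.
rewrite (powRM _ (ltW F0) (ltW (a0 ld))) -!mulrA -powRD; last by rewrite (gt_eqF (a0 ld)) implybT.
by rewrite le_eqVlt; apply/orP; left; apply/eqP; congr (_ * (_ * (_ * _ `^ _))); rewrite /gam; ring.
Qed.

End lower_bounds.

(** * The growth function in (d) and the proof of the five statements *)

Section compression_level.
Context {R : realType}.

(* The largest admissible [m] in the compression of [x] pieces. *)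
Definition compression_level (x : R) : nat :=
  \max_(m < (Num.truncn x).+1 | ((m ^ m) ^ 2)%:R <= x) m.

Lemma compression_level_le (x : R) : 1 <= x ->
  ((compression_level x ^ compression_level x) ^ 2)%:R <= x.
Proof.
move=> x1; rewrite /compression_level.
elim/big_ind : _ => //= m n hm hn; rewrite /maxn; by case: ifP.
Qed.

Lemma compression_level_ge (x : R) m : ((m ^ m) ^ 2)%:R <= x -> (m <= compression_level x)%N.
Proof.
move=> mx; have [->//|m0] := posnP m.
have mN : (m <= (m ^ m) ^ 2)%N.
  rewrite -expnM; apply: leq_trans (leq_pexp2l m0 (_ : 1 <= m * 2)%N); first by rewrite expn1.
  by rewrite muln_gt0 m0.
have x0 : 0 <= x by exact: le_trans mx.
have mt : (m < (Num.truncn x).+1)%N.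
  rewrite -(ltr_nat R); have /andP[_] := truncn_itv x0; apply: le_lt_trans.
  by apply: le_trans mx; rewrite ler_nat.
exact: (@leq_bigmax_cond _ _ (fun i : 'I_(Num.truncn x).+1 => i : nat) (Ordinal mt)).
Qed.

Lemma compression_level_gt0 (x : R) : 1 <= x -> (0 < compression_level x)%N.
Proof. by move=> x1; apply: compression_level_ge; rewrite !exp1n. Qed.

Lemma compression_level_cvg (s : R) : 0 < s ->
  (compression_level x)%:R `^ s @[x --> +oo] --> +oo.
Proof.
move=> s0; apply/cvgryPge => A.
have [m m0] := natr_powR_unbounded A s0 ltr01; rewrite mul1r => mA.
near=> x; apply: le_trans (ltW mA) _.
apply: ge0_ler_powR; rewrite ?nnegrE ?(ltW s0)// ler_nat.
apply: compression_level_ge.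
by near: x; apply: nbhs_pinfty_ge; exact: num_real.
Unshelve. all: by end_near. Qed.

End compression_level.

Lemma hoelder_conjugateP {R : realType} (p : \bar R) : (1 <= p)%E ->
  (rcp p = 1 /\ hoelder_conjugate p = +oo%E) \/
  exists2 t : R, 0 < t & hoelder_conjugate p = t%:E /\ 1 - rcp p = t^-1.
Proof.
case: p => [r|_|//]; last first.
  by right; exists 1 => //; rewrite hoelder_conjugatey rcpy subr0 invr1.
rewrite lee_fin => r1; have r0 : 0 < r by exact: lt_le_trans r1.
move: r1; rewrite le_eqVlt => /predU1P[<-|r1].
  by left; rewrite rcp_fin// invr1 hoelder_conjugate1.
have r10 : 0 < r - 1 by rewrite subr_gt0.
right; exists (r / (r - 1)); first by rewrite divr_gt0.
rewrite rcp_fin ?ltW// /hoelder_conjugate/= eqe gt_eqF// -EFinB inver gt_eqF// -EFinM.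
by split => //; field; rewrite !gt_eqF.
Qed.

(* Only the first branch matters; the value 1 elsewhere keeps alpha unbounded. *)
Definition gain_exponent {R : realType} (q : \bar R) : R :=
  if q is r%:E then (if 2 < r then 2^-1 - r^-1 else 1) else 1.

Lemma gain_exponent_gt0 {R : realType} (q : \bar R) : 0 < gain_exponent q.
Proof.
case: q => [r||] //=; case: ifP => // r2.
by rewrite subr_gt0 ltf_pV2 ?posrE// (lt_trans _ r2).
Qed.
Unset Implicit Arguments.

Theorem theorem1p6 (R : realType) (d : nat) (hd : (0 < d)%N) (p q : \bar R)
    (hp : (1 <= p)%E) (hq : (1 <= q)%E) :
  exists (c : R) (alpha : R -> R),
    0 < c /\
    (forall r, 1 <= r -> c <= alpha r) /\
    alpha r @[r --> +oo] --> +oo /\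
    forall (l : 'I_d -> \bar R) (N : option nat) (eps0 : R)
           (g : 'rV[R]_d -> R),
      (forall i, (0 < l i)%E) ->
      (forall i j : 'I_d, (i <= j)%N -> (l i <= l j)%E) ->
      le_extnat 2 N -> 0 < eps0 -> eps0 < 1 ->
      elliptic N eps0 l g ->
      let p' := hoelder_conjugate p in
      let ld := l (last_ord hd) in
      [/\
        ~ ((((d%:R + 2) / d%:R)%:E * p' <= q)%E /\
           ((2 * (d%:R + 1) / d%:R)%:E < q)%E) ->
        ~ extends_bounded l g p q,
        forall k : 'I_d, l k = +oo%E ->
          (q <= p)%E \/
          (((d%:R - k.+1%:R + 3) / (d%:R - k.+1%:R + 1))%:E * p' < q)%E ->
          ~ extends_bounded l g p q,
        (p < q)%E ->
        forall (j : 'I_d) (theta : R), 0 <= theta <= 1 ->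
          scaling_line (d%:R - j%:R - theta) p q ->
          (c%:E * ((\prod_(i < d | (i < j)%N) l i) * l j `^ theta)
                    `^ (rcp p' - rcp q)
            <= extension_norm l g p q)%E,
        (ld < +oo)%E ->
        forall (j : 'I_d) (theta : R), (j.+1 < d)%N -> 0 < theta <= 1 ->
          q = (2 * (d%:R - j%:R - theta + 1) / (d%:R - j%:R - theta))%:E ->
          (q <= p)%E ->
          (c%:E * (\prod_(i < d) l i) `^ (rcp q - rcp p)
             * (alpha (fine ld / fine (l j)))%:E
             * ((\prod_(i < d | (i < j)%N) l i) * l j `^ theta)
                 `^ (1 - 2 * rcp q)
            <= extension_norm l g p q)%E &
        (ld < +oo)%E -> (4%:E < q)%E ->
        (hoelder_conjugate (q / 3%:E) <= p)%E ->
        (c%:E * (\prod_(i < d | (i.+1 < d)%N) l i) `^ (rcp p' - rcp q)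
           * ld `^ (1 - 3 * rcp q - rcp p)
          <= extension_norm l g p q)%E ].
Proof.
set kc := @knapp_const R d; set kk := @kakeya_const R d.
have kc0 : 0 < kc by exact: knapp_const_gt0.
have kk0 : 0 < kk by exact: kakeya_const_gt0.
(* The entry 1 ensures [c <= alpha r], since the compression level is at least 1 for [r >= 1]. *)
pose c := Num.min (Num.min kc kk) 1.
have ckc : c <= kc by rewrite /c !ge_min lexx.
have ckk : c <= kk by rewrite /c !ge_min lexx orbT.
exists c, (fun x => (compression_level x)%:R `^ gain_exponent q); split.
  by rewrite /c !lt_min kc0 kk0 ltr01.
split.
  move=> x x1; apply: (@le_trans _ _ 1); first by rewrite /c ge_min lexx orbT.
  rewrite -[leLHS](powRr0 (compression_level x)%:R) ler_powR ?(ltW (gain_exponent_gt0 _))//.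
  by rewrite ler1n compression_level_gt0.
split; first exact: compression_level_cvg (gain_exponent_gt0 q).
move=> l N eps0 g l0 lsorted N2 _ eps1 ell p' ld.
have gtame (a : 'I_d -> R) : (forall i, 0 < a i) -> (forall i, ((a i)%:E <= l i)%E) -> tame a g.
  exact: elliptic_tame ell.
have scale_c (k : R) (X Z : \bar R) : c <= k -> (0 <= X)%E ->
    (k%:E * X <= Z)%E -> (c%:E * X <= Z)%E.
  by move=> ck X0; apply: le_trans; rewrite lee_wpmul2r ?lee_fin.
have p'0 : rcp p' = 1 - rcp p by exact: rcp_conj.
have partA : ~ ((((d%:R + 2) / d%:R)%:E * p' <= q)%E /\
    ((2 * (d%:R + 1) / d%:R)%:E < q)%E) -> ~ extends_bounded l g p q.
  move=> outside ext; have [C C0 bC] := extends_test_bound hq ext; apply: outside.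
  have dR : 0 < d%:R :> R by rewrite ltr0n.
  have K := knapp_small hd l0 lsorted gtame hp hq C0 bC.
  move: K bC; case: q hq {ext} => [r|_|//]; last by rewrite leey ltry.
  rewrite lee_fin => r1 + bC; have r0 : 0 < r by exact: lt_le_trans r1.
  have H := kakeya_small hd l0 lsorted gtame hp r1 C0 bC.
  rewrite rcp_fin// lte_fin => K; split; last exact: H.
  rewrite /p'; have [[E _]|[t t0 [-> E]]] := hoelder_conjugateP hp.
    (* For [p = 1] the Knapp condition would make [(d + 2) / r] nonpositive. *)
    by move: K; rewrite E subrr mulr0 leNgt mulr_gt0 ?invr_gt0// ltr_wpDl.
  rewrite -EFinM lee_fin mulrAC ler_pdivrMr//.
  by move: K; rewrite E ler_pdivrMr// mulrAC ler_pdivlMr// [r * _]mulrC.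
have partB1 (k : 'I_d) : l k = +oo%E ->
    (((d%:R - k.+1%:R + 3) / (d%:R - k.+1%:R + 1))%:E * p' < q)%E -> ~ extends_bounded l g p q.
  move=> lk + ext; have [C C0 bC] := extends_test_bound hq ext.
  have K := knapp_large hd l0 lsorted gtame hp hq C0 lk bC.
  have kd : 0 < d%:R - k%:R :> R by rewrite subr_gt0 ltr_nat.
  (* Statement (b) counts the sides from 1, [knapp_large] from 0. *)
  rewrite -natr1; have -> : d%:R - (k%:R + 1) + 3 = d%:R - k%:R + 2 :> R by ring.
  have -> : d%:R - (k%:R + 1) + 1 = d%:R - k%:R :> R by ring.
  set M := d%:R - k%:R in K kd *; have M2 : 0 < M + 2 by rewrite addr_gt0.
  rewrite /p'; have [[_ ->]|[t t0 [-> E]]] := hoelder_conjugateP hp.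
    by rewrite gt0_muley ?lte_fin ?divr_gt0// ltNge leey.
  move: K; rewrite E; case: q hq {bC ext p'0 partA} => [r|_|//]; last first.
    by rewrite rcpy mulr0 leNgt mulr_gt0// invr_gt0.
  rewrite lee_fin => r1; have r0 : 0 < r by exact: lt_le_trans r1.
  rewrite rcp_fin// -EFinM lte_fin ler_pdivrMr// mulrAC ler_pdivlMr// => K.
  by rewrite mulrAC ltr_pdivrMr// ltNge mulrC K.
split.
- exact: partA.
- move=> k lk [qp|]; last exact: partB1.
  case: q hq qp partA partB1 {p'0} => [r|_ qp _ partB1|//]; last first.
    (* An infinite [q <= p] forces [p] infinite, so [p' = 1] and the other criterion of (b)
       applies. *)
    apply: (partB1 k lk); have py : p = +oo%E by apply/eqP; rewrite -leye_eq.
    by rewrite /p' py hoelder_conjugatey mule1 ltry.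
  rewrite lee_fin => r1 rp partA _ ext.
  have [C C0 bC] := extends_test_bound (r1 : (1 <= r%:E)%E) ext.
  have r2 := kakeya_small hd l0 lsorted gtame hp r1 C0 bC.
  have dR : 0 < d%:R :> R by rewrite ltr0n.
  (* The gain [m^(1/2 - 1/r)] requires [r > 2], which the endpoint condition of (a) supplies. *)
  have {}r2 : 2 < r.
    by apply: lt_trans r2; rewrite ltr_pdivlMr// ltr_pM2l// ltrDl.
  have r0 : 0 < r by exact: lt_trans r2.
  apply: (kakeya_large hd l0 lsorted gtame hp r2 C0 _ lk bC).
  move: hp rp r0; clear -p r; case: p => [t|_ _ r0|//]; last by rewrite rcpy invr_ge0 ltW.
  rewrite !lee_fin => t1 rt r0; rewrite rcp_fin//.
  by rewrite lef_pV2 ?posrE// (lt_le_trans r0).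
- move=> _ j theta th sc.
  apply: scale_c ckc _ (knapp_scaling_bound hd l0 lsorted gtame hp hq th sc).
  exact: poweR_ge0.
- move=> lf j theta jd th qE _.
  have lj : (l j <= ld)%E by apply: lsorted; rewrite /= -ltnS prednK// ltn_ord.
  have ljf : (l j < +oo)%E by exact: le_lt_trans lj lf.
  have x1 : 1 <= fine ld / fine (l j).
    have fj : 0 < fine (l j) by rewrite fine_gt0// l0.
    by rewrite ler_pdivlMr// mul1r fine_le// ?gt0_fin_numE// l0.
  set r := 2 * _ / _ in qE.
  have r2 : 2 < r.
    have s1 : 0 < d%:R - j%:R - theta.
      have : j.+2%:R <= d%:R :> R by rewrite ler_nat.
      by rewrite -addn2 natrD; case/andP: th; lra.
    by rewrite /r ltr_pdivlMr//; lra.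
  rewrite qE /gain_exponent r2.
  have := kakeya_scaling_bound l0 lsorted gtame hp lf jd th (erefl r)
    (compression_level_gt0 x1) (compression_level_le x1).
  rewrite -!muleA; apply: scale_c ckk _.
  by rewrite mule_ge0 ?poweR_ge0// mule_ge0 ?poweR_ge0// lee_fin powR_ge0.
- move=> lf _ _; rewrite -muleA; apply: scale_c ckc _ _; first by rewrite mule_ge0 ?poweR_ge0.
  by rewrite muleA; exact: knapp_full_bound.
Qed.
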